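(* Let $r>f^*$, $\epsilon_{\mathcal A}>0$, $\delta\in(0,1)$ and $\gamma_t=1/(M\sqrt{t+1})$ for $t\ge0$, and let $$T(\delta,\epsilon_{\mathcal A}):=\max\left\{6,\left(\frac{16\left(Q\Omega(\delta)+10M\Omega(\delta)+4.5M\right)}{\epsilon_{\mathcal A}}\ln\left(\frac{8\left(Q\Omega(\delta)+10M\Omega(\delta)+4.5M\right)}{\epsilon_{\mathcal A}}\right)\right)^2-2\right\}.$$ Then OVSMD guarantees that $\mathcal P(r,\bar{\mathbf x}^{(t)})-H(r)\le\epsilon_{\mathcal A}$ and $|\hat u_*^{(t)}-H(r)|\le\epsilon_{\mathcal A}$ hold (jointly) with probability at least $1-\delta$ in at most $T(\delta,\epsilon_{\mathcal A})$ gradient iterations, i.e. for every integer $t\ge T(\delta,\epsilon_{\mathcal A})$. Consequently, OVSMD with iteration limit $T\ge T(\delta,\epsilon_{\mathcal A})$ (returning $(\hat u_*^{(T)},\bar{\mathbf x}^{(T)})$) is a valid stochastic oracle $\mathcal A(r,\epsilon_{\mathcal A},\delta)$.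
   Context: SOEC: $f^*:=\min_{\mathbf x\in\mathcal X}\{f_0(\mathbf x)=\mathbb E[F_0(\mathbf x,\xi_0)]\}$ subject to $f_i(\mathbf x):=\mathbb E[F_i(\mathbf x,\xi_i)]\le r_i$, $i=1,\dots,m$, where $\mathcal X\subset\mathbb R^d$ is nonempty, closed and convex, $\xi_i$ is a random vector supported on $\Xi_i\subseteq\mathbb R^{q_i}$, and $F_i(\cdot,\xi_i)$ is continuous and convex on $\mathcal X$ for each realization of $\xi_i$. All minima/maxima written are assumed attained. Assume there is $\tilde{\mathbf x}\in\mathcal X$ with $\max_{1\le i\le m}\{f_i(\tilde{\mathbf x})-r_i\}<0$ and $f_0(\tilde{\mathbf x})>f^*$. Level-set function: for $r\in\mathbb R$, $\mathcal P(r,\mathbf x):=\max\{f_0(\mathbf x)-r,f_1(\mathbf x)-r_1,\dots,f_m(\mathbf x)-r_m\}$, $H(r):=\min_{\mathbf x\in\mathcal X}\mathcal P(r,\mathbf x)$. With $r_0:=r$, $\mathcal Y:=\{\mathbf y=(y_0,\dots,y_m)^\top\in\mathbb R^{m+1}:\sum_i y_i=1,\ y_i\ge0\}$, $\boldsymbol\xi=(\xi_0,\dots,\xi_m)\in\Xi:=\Xi_0\times\cdots\times\Xi_m$, $\Phi(\mathbf x,\mathbf y,\boldsymbol\xi):=\sum_{i=0}^m y_i(F_i(\mathbf x,\xi_i)-r_i)$, $\phi(\mathbf x,\mathbf y):=\mathbb E[\Phi(\mathbf x,\mathbf y,\boldsymbol\xi)]$, one has $H(r)=\min_{\mathbf x\in\mathcal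 X}\max_{\mathbf y\in\mathcal Y}\phi(\mathbf x,\mathbf y)$. Stochastic oracle: given $r>f^*$, $\epsilon>0$, $\delta\in(0,1)$, a stochastic oracle $\mathcal A(r,\epsilon,\delta)$ returns a value $U(r)$ and $\hat{\mathbf x}\in\mathcal X$ such that, with probability at least $1-\delta$, $\mathcal P(r,\hat{\mathbf x})-H(r)\le\epsilon$ and $|U(r)-H(r)|\le\epsilon$. Stochastic subgradients: for a selection $F_i'(\mathbf x,\xi_i)\in\partial F_i(\mathbf x,\xi_i)$ (subdifferential in $\mathbf x$), $G_x(\mathbf x,\mathbf y,\boldsymbol\xi):=\sum_{i=0}^m y_iF_i'(\mathbf x,\xi_i)$, $G_y(\mathbf x,\mathbf y,\boldsymbol\xi):=(F_0(\mathbf x,\xi_0)-r_0,\dots,F_m(\mathbf x,\xi_m)-r_m)^\top$, $G:=(G_x,-G_y)$, $g_x:=\mathbb E[G_x]$, $g_y:=\mathbb E[G_y]$, $g:=\mathbb E[G]=(g_x,-g_y)$. Geometry: $\mathcal X$, $\mathcal Y$ carry norms $\|\cdot\|_x,\|\cdot\|_y$ with dual norms $\|\cdot\|_{*,x},\|\cdot\|_{*,y}$, and distance-generating functions $\omega_x$, $\omega_y$ that are continuous on $\mathcal X$ (resp. $\mathcal Y$), strongly convex with modulus $\alpha_x$ (resp. $\alpha_y$) with respect to these norms, and continuously differentiable on $\mathcal X^o=\{\mathbf x\in\mathcal X:\partial\omega_x(\mathbf x)\ne\emptyset\}$ (resp. $\mathcal Y^o$, defined analogously). $D_x:=\sqrt{\max_{\mathcal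 X}\omega_x-\min_{\mathcal X}\omega_x}$, $D_y:=\sqrt{\max_{\mathcal Y}\omega_y-\min_{\mathcal Y}\omega_y}$ (finite and positive). With $\mathbf z=(\mathbf x,\mathbf y)\in\mathcal Z:=\mathcal X\times\mathcal Y$: $\omega_z(\mathbf z):=\frac{\omega_x(\mathbf x)}{2D_x^2}+\frac{\omega_y(\mathbf y)}{2D_y^2}$, $\mathcal Z^o:=\{\mathbf z\in\mathcal Z:\partial\omega_z(\mathbf z)\neq\emptyset\}$, $V(\mathbf z',\mathbf z):=\omega_z(\mathbf z)-[\omega_z(\mathbf z')+\nabla\omega_z(\mathbf z')^\top(\mathbf z-\mathbf z')]$ for $\mathbf z'\in\mathcal Z^o$, and $P_{\mathbf z'}(\boldsymbol\zeta):=\arg\min_{\mathbf z\in\mathcal Z}\{\boldsymbol\zeta^\top(\mathbf z-\mathbf z')+V(\mathbf z',\mathbf z)\}$. Light-tail assumption: the selections $F_i'$ can be chosen so that $g(\mathbf x,\mathbf y)$ is well defined with $g_x(\mathbf x,\mathbf y)\in\partial_x\phi(\mathbf x,\mathbf y)$ and $-g_y(\mathbf x,\mathbf y)\in\partial_y[-\phi(\mathbf x,\mathbf y)]$, and there are constants $M_x,M_y,Q>0$ such that for all $(\mathbf x,\mathbf y)\in\mathcal X\times\mathcal Y$: $\mathbb E[\exp(\|G_x\|_{*,x}^2/M_x^2)]\le e$, $\mathbb E[\exp(\|G_y\|_{*,y}^2/M_y^2)]\le e$, $\mathbb E[\exp(|\Phi(\mathbf x,\mathbf y,\boldsymbol\xi)-\phi(\mathbf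 x,\mathbf y)|^2/Q^2)]\le e$. Constants: $M:=\sqrt{\frac{2D_x^2}{\alpha_x}M_x^2+\frac{2D_y^2}{\alpha_y}M_y^2}$, $\Omega(\delta):=\max\{\sqrt{12\ln(24/\delta)},\frac43\ln(24/\delta)\}$. OVSMD (online validation based stochastic mirror descent; inputs: level $r$, step lengths $\gamma_t>0$, iteration limit $T$): $\mathbf z^{(0)}=(\mathbf x^{(0)},\mathbf y^{(0)})\in\arg\min_{\mathcal Z}\omega_z$; for $t=0,1,\dots,T$, draw an i.i.d. sample $\boldsymbol\xi^{(t)}$ of $\boldsymbol\xi$, set $\bar{\mathbf z}^{(t)}=(\bar{\mathbf x}^{(t)},\bar{\mathbf y}^{(t)})=\frac{\sum_{s=0}^t\gamma_s\mathbf z^{(s)}}{\sum_{s=0}^t\gamma_s}$ and $\mathbf z^{(t+1)}=(\mathbf x^{(t+1)},\mathbf y^{(t+1)})=P_{\mathbf z^{(t)}}(\gamma_tG(\mathbf x^{(t)},\mathbf y^{(t)},\boldsymbol\xi^{(t)}))$. It returns $(\hat u_*^{(t)},\bar{\mathbf x}^{(t)})$ at the last $t$, where $$\hat u_*^{(t)}:=\max_{\mathbf y\in\mathcal Y}\frac{1}{\sum_{s=0}^t\gamma_s}\sum_{s=0}^t\gamma_s\left[\Phi(\mathbf x^{(s)},\mathbf y^{(s)},\boldsymbol\xi^{(s)})+G_y(\mathbf x^{(s)},\mathbf y^{(s)},\boldsymbol\xi^{(s)})^\top(\mathbf y-\mathbf y^{(s)})\right].$$ *)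

(* Defs.v *)
(* Everything is over an arbitrary [R : realType]; vectors of R^n are row vectors
   ['rV[R]_n]. Functions defined on X or on the simplex in the mathematics are
   total here, with arbitrary values elsewhere. *)
From HB Require Import structures.
From mathcomp Require Import all_boot all_order all_algebra finmap.
From mathcomp Require Import all_classical all_reals all_analysis.

Set Implicit Arguments.
Unset Strict Implicit.
Unset Printing Implicit Defensive.

Import Order.TTheory GRing.Theory Num.Theory.
Import numFieldNormedType.Exports.

Local Open Scope classical_set_scope.
Local Open Scope ring_scope.

Section ConvexAnalysis.
Context {R : realType}.

Definition is_argmin {T : Type} (A : set T) (h : T -> R) (x : T) : Prop :=
  A x /\ forall x', A x' -> h x <= h x'.

Definition is_argmax {T : Type} (A : set T) (h : T -> R) (x : T) : Prop :=
  A x /\ forall x', A x' -> h x' <= h x.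

Definition dot {n : nat} (u v : 'rV[R]_n) : R := \sum_i u 0 i * v 0 i.

Definition is_norm {n : nat} (N : 'rV[R]_n -> R) : Prop :=
  [/\ forall x, N x = 0 -> x = 0,
      forall (a : R) x, N (a *: x) = `|a| * N x
    & forall x y, N (x + y) <= N x + N y].

Definition dual_norm {n : nat} (N : 'rV[R]_n -> R) (g : 'rV[R]_n) : R :=
  sup [set dot g x | x in [set x | N x <= 1]].

Definition simplex (n : nat) : set 'rV[R]_n :=
  [set y | (forall i, 0 <= y 0 i) /\ \sum_i y 0 i = 1].

(* Subdifferential at [x] of a function whose domain is [A], i.e. of the
   extended-valued function equal to [h] on [A] and to +oo elsewhere. *)
Definition subdiff {n : nat} (A : set 'rV[R]_n) (h : 'rV[R]_n -> R)
    (x : 'rV[R]_n) : set 'rV[R]_n :=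
  [set g | forall x', A x' -> h x + dot g (x' - x) <= h x'].

Definition dom_subdiff {n : nat} (A : set 'rV[R]_n) (h : 'rV[R]_n -> R) :
    set 'rV[R]_n :=
  [set x | A x /\ subdiff A h x !=set0].

Definition strongly_convex {n : nat} (N : 'rV[R]_n -> R) (alpha : R)
    (A : set 'rV[R]_n) (h : 'rV[R]_n -> R) : Prop :=
  forall (x y : 'rV[R]_n) (t : R), A x -> A y -> 0 <= t <= 1 ->
    h (t *: x + (1 - t) *: y) <=
      t * h x + (1 - t) * h y - alpha / 2 * t * (1 - t) * N (x - y) ^+ 2.

(* First-order expansion along [A] only: [A] may have empty interior (the
   simplex does), so that [h] need not make sense around [x]. *)
Definition is_gradient_within {n : nat} (A : set 'rV[R]_n)
    (h : 'rV[R]_n -> R) (x g : 'rV[R]_n) : Prop :=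
  forall e : R, 0 < e -> \forall x' \near within A (nbhs x),
    `|h x' - h x - dot g (x' - x)| <= e * `|x' - x|.

(* [grad] is the gradient map of [w] on the set where the subdifferential is
   nonempty. *)
Record is_dgf {n : nat} (N : 'rV[R]_n -> R) (A : set 'rV[R]_n)
    (w : 'rV[R]_n -> R) (grad : 'rV[R]_n -> 'rV[R]_n) (alpha : R) : Prop := {
  dgf_modulus_gt0 : 0 < alpha;
  dgf_continuous : {within A, continuous w};
  dgf_strongly_convex : strongly_convex N alpha A w;
  dgf_gradient : forall x, dom_subdiff A w x ->
    is_gradient_within A w x (grad x);
  dgf_gradient_continuous : {within dom_subdiff A w, continuous grad}
}.

Definition dgf_diam {n : nat} (A : set 'rV[R]_n) (w : 'rV[R]_n -> R) : R :=
  Num.sqrt (sup (w @` A) - inf (w @` A)).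

End ConvexAnalysis.

Arguments simplex {R} n.

Section Randomness.
Context {R : realType}.

Definition borel (n : nat) := g_sigma_algebraType (@open 'rV[R]_n).

Definition vectors (m : nat) (q : 'I_m.+1 -> nat) : pointedType :=
  (forall i : 'I_m.+1, 'rV[R]_(q i)) : pointedType.

Definition cylinders (m : nat) (q : 'I_m.+1 -> nat) : set (set (vectors q)) :=
  \bigcup_i preimage_set_system setT
    (fun xi : vectors q => xi i : borel (q i)) measurable.

Arguments cylinders {m} q.

(* The space of joint samples xi = (xi_0, ..., xi_m) with its product
   sigma-algebra; the components of xi may be dependent. *)
Definition samples (m : nat) (q : 'I_m.+1 -> nat) :=
  g_sigma_algebraType (cylinders q).

Definition mutually_independent {dO dT : measure_display}
    {Om : measurableType dO} {T : measurableType dT} {P : probability Om R}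
    (X : nat -> {RV P >-> T}) : Prop :=
  forall (I : {fset nat}) (A : nat -> set T), (forall t, measurable (A t)) ->
    P (\bigcap_(t in [set` I]) (X t @^-1` A t)) =
    (\prod_(t <- I) P (X t @^-1` A t))%E.

Definition iid {dO dT : measure_display} {Om : measurableType dO}
    {T : measurableType dT} {P : probability Om R} (mu : probability T R)
    (X : nat -> {RV P >-> T}) : Prop :=
  (forall t (A : set T), measurable A -> distribution P (X t) A = mu A) /\
  mutually_independent X.

(* For a measurable [E] this is [p <= P E]; the library only constrains the
   values of a measure on measurable sets. *)
Definition with_prob_ge {dO : measure_display} {Om : measurableType dO}
    (P : probability Om R) (p : R) (E : set Om) : Prop :=
  exists A : set Om, [/\ measurable A, A `<=` E & (p%:E <= P A)%E].

End Randomness.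

Arguments borel R n : clear implicits.
Arguments samples R {m} q.

Section SOEC.
Context {R : realType} {d m : nat} {q : 'I_m.+1 -> nat}.

(* [mu] is the law of xi; [F i] and its subgradient selection [F' i] take the
   i-th component of xi. The objective is index [ord0], and the j-th constraint,
   with right-hand side [rc j], is index [lift ord0 j]. *)
Variables (X : set 'rV[R]_d) (mu : probability (samples R q) R)
  (F : forall i : 'I_m.+1, 'rV[R]_d -> 'rV[R]_(q i) -> R) (rc : 'I_m -> R)
  (F' : forall i : 'I_m.+1, 'rV[R]_d -> 'rV[R]_(q i) -> 'rV[R]_d).

Definition fmean (i : 'I_m.+1) (x : 'rV[R]_d) : R :=
  \int[mu]_xi F x (xi i).

Definition feasible : set 'rV[R]_d :=
  [set x | X x /\ forall j : 'I_m, fmean (lift ord0 j) x <= rc j].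

Definition fstar : R := inf (fmean ord0 @` feasible).

Definition Plevel (r : R) (x : 'rV[R]_d) : R :=
  \big[Num.max/fmean ord0 x - r]_(j < m) (fmean (lift ord0 j) x - rc j).

Definition H (r : R) : R := inf (Plevel r @` X).

(* (r_0, ..., r_m) with r_0 = r *)
Definition level (r : R) (i : 'I_m.+1) : R := oapp rc r (unlift ord0 i).

Definition Phi (r : R) (x : 'rV[R]_d) (y : 'rV[R]_m.+1) (xi : samples R q) : R :=
  \sum_i y 0 i * (F x (xi i) - level r i).

Definition phi (r : R) (x : 'rV[R]_d) (y : 'rV[R]_m.+1) : R :=
  \int[mu]_xi Phi r x y xi.

Definition Gx (x : 'rV[R]_d) (y : 'rV[R]_m.+1) (xi : samples R q) : 'rV[R]_d :=
  \sum_i y 0 i *: F' x (xi i).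

Definition Gy (r : R) (x : 'rV[R]_d) (xi : samples R q) : 'rV[R]_m.+1 :=
  \row_i (F x (xi i) - level r i).

Definition gx (x : 'rV[R]_d) (y : 'rV[R]_m.+1) : 'rV[R]_d :=
  \row_k \int[mu]_xi Gx x y xi 0 k.

Definition gy (r : R) (x : 'rV[R]_d) : 'rV[R]_m.+1 :=
  \row_i \int[mu]_xi Gy r x xi 0 i.

(* Integrability makes the expectations f_i well defined. *)
Record soec_assumptions (Xi : forall i : 'I_m.+1, set 'rV[R]_(q i)) : Prop := {
  soec_nonempty : X !=set0;
  soec_closed : closed X;
  soec_convex : convex_set X;
  soec_support : {ae mu, forall xi : samples R q, forall i, Xi i (xi i)};
  soec_F_continuous : forall i (s : 'rV[R]_(q i)), Xi i s ->
    {within X, continuous (fun x => F x s)};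
  soec_F_convex : forall i (s : 'rV[R]_(q i)), Xi i s ->
    convex_function X (fun x => F x s);
  soec_F_integrable : forall i x, X x ->
    mu.-integrable setT (fun xi : samples R q => (F x (xi i))%:E);
  soec_fstar_attained : exists x, is_argmin feasible (fmean ord0) x;
  soec_H_attained : forall r, exists x, is_argmin X (Plevel r) x;
  soec_slater : exists x, [/\ X x,
    forall j : 'I_m, fmean (lift ord0 j) x - rc j < 0 & fstar < fmean ord0 x]
}.

(* [lt_F'_measurable] is the (tacit) regularity without which
   F'_i(x^(t), xi^(t)) need not be a random vector. *)
Record light_tail (Xi : forall i : 'I_m.+1, set 'rV[R]_(q i)) (r : R)
    (Nx : 'rV[R]_d -> R) (Ny : 'rV[R]_m.+1 -> R) (Mx My Q : R) : Prop := {
  lt_F'_subgradient : forall i x (s : 'rV[R]_(q i)), X x -> Xi i s ->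
    subdiff X (fun x' => F x' s) x (F' x s);
  lt_F'_measurable : forall i,
    measurable_fun (X `*` setT : set (borel R d * borel R (q i)))
      (fun p : borel R d * borel R (q i) => F' (i := i) p.1 p.2 : borel R d);
  lt_Gx_integrable : forall x y k, X x -> simplex m.+1 y ->
    mu.-integrable setT (fun xi => (Gx x y xi 0 k)%:E);
  lt_gx : forall x y, X x -> simplex m.+1 y ->
    subdiff X (fun x' => phi r x' y) x (gx x y);
  lt_gy : forall x y, X x -> simplex m.+1 y ->
    subdiff (simplex m.+1) (fun y' => - phi r x y') y (- gy r x);
  lt_Mx_gt0 : 0 < Mx;
  lt_My_gt0 : 0 < My;
  lt_Q_gt0 : 0 < Q;
  lt_Gx_tail : forall x y, X x -> simplex m.+1 y ->
    (\int[mu]_xi (expR (dual_norm Nx (Gx x y xi) ^+ 2 / Mx ^+ 2))%:E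
      <= (expR 1)%:E)%E;
  lt_Gy_tail : forall x, X x ->
    (\int[mu]_xi (expR (dual_norm Ny (Gy r x xi) ^+ 2 / My ^+ 2))%:E
      <= (expR 1)%:E)%E;
  lt_Phi_tail : forall x y, X x -> simplex m.+1 y ->
    (\int[mu]_xi (expR (`|Phi r x y xi - phi r x y| ^+ 2 / Q ^+ 2))%:E
      <= (expR 1)%:E)%E
}.

(* [U] and [xhat] are the (random) outputs of the oracle. *)
Definition is_stochastic_oracle {dO : measure_display} {Om : measurableType dO}
    (P : probability Om R) (r eps delta : R)
    (U : Om -> R) (xhat : Om -> 'rV[R]_d) : Prop :=
  (forall o, X (xhat o)) /\
  with_prob_ge P (1 - delta)
    [set o | Plevel r (xhat o) - H r <= eps /\ `|U o - H r| <= eps].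

Section OVSMD.
Variables (wx : 'rV[R]_d -> R) (gradx : 'rV[R]_d -> 'rV[R]_d)
  (wy : 'rV[R]_m.+1 -> R) (grady : 'rV[R]_m.+1 -> 'rV[R]_m.+1).

Let Y : set 'rV[R]_m.+1 := simplex m.+1.
Let Z : set ('rV[R]_d * 'rV[R]_m.+1) := X `*` Y.
Let cx : R := (2 * dgf_diam X wx ^+ 2)^-1.
Let cy : R := (2 * dgf_diam Y wy ^+ 2)^-1.

Definition dotz (u v : 'rV[R]_d * 'rV[R]_m.+1) : R :=
  dot u.1 v.1 + dot u.2 v.2.

Definition omegaz (z : 'rV[R]_d * 'rV[R]_m.+1) : R :=
  wx z.1 * cx + wy z.2 * cy.

Definition gradz (z : 'rV[R]_d * 'rV[R]_m.+1) : 'rV[R]_d * 'rV[R]_m.+1 :=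
  (cx *: gradx z.1, cy *: grady z.2).

(* Meaningful for z' such that the subdifferential of omegaz at z' is nonempty;
   this is the case of every iterate, by optimality. *)
Definition bregman (z' z : 'rV[R]_d * 'rV[R]_m.+1) : R :=
  omegaz z - (omegaz z' + dotz (gradz z') (z - z')).

Definition is_prox (z' zeta z : 'rV[R]_d * 'rV[R]_m.+1) : Prop :=
  is_argmin Z (fun z1 => dotz zeta (z1 - z') + bregman z' z1) z.

Definition G (r : R) (z : 'rV[R]_d * 'rV[R]_m.+1) (xi : samples R q) :
    'rV[R]_d * 'rV[R]_m.+1 :=
  (Gx z.1 z.2 xi, - Gy r z.1 xi).

(* [z] is a run of OVSMD with level [r], step lengths [gamma] and iteration
   limit [N] on the samples [xi]. *)
Definition is_OVSMD_run {Om : Type} (r : R) (gamma : nat -> R) (N : nat)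
    (xi : nat -> Om -> samples R q)
    (z : nat -> Om -> 'rV[R]_d * 'rV[R]_m.+1) : Prop :=
  forall o : Om,
    is_argmin Z omegaz (z 0 o) /\
    forall t : nat, (t <= N)%N ->
      is_prox (z t o) (gamma t *: G r (z t o) (xi t o)) (z t.+1 o).

End OVSMD.

Definition xbar {Om : Type} (gamma : nat -> R)
    (z : nat -> Om -> 'rV[R]_d * 'rV[R]_m.+1) (t : nat) (o : Om) : 'rV[R]_d :=
  (\sum_(s < t.+1) gamma s)^-1 *: \sum_(s < t.+1) gamma s *: (z s o).1.

Definition uhat {Om : Type} (r : R) (gamma : nat -> R)
    (xi : nat -> Om -> samples R q)
    (z : nat -> Om -> 'rV[R]_d * 'rV[R]_m.+1) (t : nat) (o : Om) : R :=
  sup [set (\sum_(s < t.+1) gamma s)^-1 *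
           \sum_(s < t.+1) gamma s *
             (Phi r (z s o).1 (z s o).2 (xi s o)
              + dot (Gy r (z s o).1 (xi s o)) (y - (z s o).2))
      | y in simplex m.+1].

End SOEC.

Section Constants.
Context {R : realType}.

Definition ovsmd_M (Dx Dy ax ay Mx My : R) : R :=
  Num.sqrt (2 * Dx ^+ 2 / ax * Mx ^+ 2 + 2 * Dy ^+ 2 / ay * My ^+ 2).

Definition Omega (delta : R) : R :=
  Num.max (Num.sqrt (12 * ln (24 / delta))) (4 / 3 * ln (24 / delta)).

Definition iteration_bound (Q M delta eps : R) : R :=
  let C := Q * Omega delta + 10 * M * Omega delta + 9 / 2 * M in
  Num.max 6 ((16 * C / eps * ln (8 * C / eps)) ^+ 2 - 2).

End Constants.

(* Main.v *)
(* Two inequalities are proved along the run, with weights gamma_s, S = sum gamma_s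
   and x* a minimizer of the level function P(r, .).

   Since phi(x, .) is affine, u_t is the maximum over y of
   S^-1 sum_s gamma_s <G_y(x_s, xi_s), y>. The mirror descent inequality in y at an
   arbitrary y, the one in x at the fixed point x*, and convexity of phi(., y_s) give
     u_t <= H(r) + S^-1 (mirror descent terms + scalar martingales).
   In the other direction, convexity gives P(r, xbar_t) <= max_y S^-1 sum_s gamma_s
   phi(x_s, y), and phi(x_s, y) differs from <G_y(x_s, xi_s), y> by a noise term linear
   in y. The supremum over y of the weighted noise is compared with its value along an
   auxiliary dual averaging sequence v_s on the simplex driven by that noise, and
   sum_s gamma_s (phi(x_s, v_s) - Phi(x_s, v_s, xi_s)) is again a scalar martingale.
   As H(r) <= P(r, xbar_t), both claims follow.

   The martingales are controlled by the exponential supermartingale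
   E exp(lambda D) <= exp(2 lambda^2 sigma^2), and the sums of squares by Jensen's
   inequality for exp; five events of probability delta / 24 are excluded. *)
Require Import Defs.
From HB Require Import structures.
From mathcomp Require Import all_boot all_order all_algebra finmap.
From mathcomp Require Import all_classical all_reals all_analysis.
From mathcomp Require Import measurable_realfun ring lra zify.

Set Implicit Arguments.
Unset Strict Implicit.
Unset Printing Implicit Defensive.

Import Order.TTheory GRing.Theory Num.Theory.
Import numFieldNormedType.Exports.

Local Open Scope classical_set_scope.
Local Open Scope ring_scope.

(** * Norms, strong convexity and mirror descent *)

(** The integrands are only controlled for samples in the supports [Xi i], which need not be
    measurable, so the run itself need not be a measurable process. Every probabilistic estimate is
    made for a substitute adapted to the samples, which agrees with the run while all samples lie in
    a measurable set of full measure; the conclusions are carried back outside a null event. Its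
    measurability rests on strong convexity: the solution of a prox problem is Lipschitz in the
    linear term.

    The auxiliary sequence v_s is there because the maximizing y depends on all the samples, so that
    the noise tested at that y is not a martingale, whereas v_s depends on earlier samples only.

    For gamma_s = 1/(M sqrt(s+1)) one has S >= sqrt(t+1)/M, while the sum of the gamma_s^2 is a
    harmonic sum divided by M^2. Both errors are therefore of order ln t / sqrt t, and the logarithm
    in the iteration bound inverts this rate. *)

Section Dot.
Context {R : realType} {n : nat}.
Implicit Types u v w : 'rV[R]_n.

Lemma dotC u v : dot u v = dot v u.
Proof. by apply: eq_bigr => i _; rewrite mulrC. Qed.

Lemma dotDr u v w : dot u (v + w) = dot u v + dot u w.
Proof. by rewrite -big_split; apply: eq_bigr => i _; rewrite mxE mulrDr. Qed.

Lemma dotZr (a : R) u v : dot u (a *: v) = a * dot u v.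
Proof. by rewrite mulr_sumr; apply: eq_bigr => i _; rewrite mxE mulrCA. Qed.

Lemma dotNr u v : dot u (- v) = - dot u v.
Proof. by rewrite -scaleN1r dotZr mulN1r. Qed.

Lemma dotBr u v w : dot u (v - w) = dot u v - dot u w.
Proof. by rewrite dotDr dotNr. Qed.

Lemma dotDl u v w : dot (u + v) w = dot u w + dot v w.
Proof. by rewrite dotC dotDr !(dotC w). Qed.

Lemma dotZl (a : R) u v : dot (a *: u) v = a * dot u v.
Proof. by rewrite dotC dotZr dotC. Qed.

Lemma dotNl u v : dot (- u) v = - dot u v.
Proof. by rewrite dotC dotNr dotC. Qed.

Lemma dotBl u v w : dot (u - v) w = dot u w - dot v w.
Proof. by rewrite dotDl dotNl. Qed.

Lemma dot0l v : dot 0 v = 0.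
Proof. by rewrite -(scale0r 0) dotZl mul0r. Qed.

Lemma dot0r v : dot v 0 = 0.
Proof. by rewrite dotC dot0l. Qed.

Lemma dot_sumr (I : Type) (r : seq I) (f : I -> 'rV[R]_n) u :
  dot u (\sum_(i <- r) f i) = \sum_(i <- r) dot u (f i).
Proof.
by elim/big_rec2 : _ => [|i x y _ <-]; rewrite ?dot0r ?dotDr.
Qed.

Lemma dot_suml (I : Type) (r : seq I) (f : I -> 'rV[R]_n) u :
  dot (\sum_(i <- r) f i) u = \sum_(i <- r) dot (f i) u.
Proof. by rewrite dotC dot_sumr; apply: eq_bigr => i _; rewrite dotC. Qed.

Lemma coord_le_norm u i : `|u 0 i| <= `|u|.
Proof.
by rewrite [leRHS]/Num.norm /= mx_normrE; apply: (le_bigmax _ _ (0 : 'I_1, i)).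
Qed.

Lemma norm_le_coord u (e : R) : 0 <= e -> (forall i, `|u 0 i| <= e) -> `|u| <= e.
Proof.
move=> e0 h; rewrite [leLHS]/Num.norm /= mx_normrE.
by apply/bigmax_leP; split=> // -[i j] _ /=; rewrite (ord1 i).
Qed.

Lemma norm_lt_coord u (e : R) : 0 < e -> (forall i, `|u 0 i| < e) -> `|u| < e.
Proof.
move=> e0 h; rewrite [ltLHS]/Num.norm /= mx_normrE.
by apply/bigmax_ltP; split=> // -[i j] _ /=; rewrite (ord1 i).
Qed.

Lemma dot_le_norm u v : `|dot u v| <= n%:R * (`|u| * `|v|).
Proof.
apply: (le_trans (ler_norm_sum _ _ _)).
rewrite -[in n%:R](card_ord n) -sumr_const mulr_suml.
by apply: ler_sum => i _; rewrite mul1r normrM ler_pM// coord_le_norm.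
Qed.

Lemma lipschitz_rV_continuous (f : 'rV[R]_n -> R) (K : R) : 0 <= K ->
  (forall u v, `|f u - f v| <= K * `|u - v|) -> continuous f.
Proof.
move=> K0 fK u U /= /nbhs_ballP[e /= e0 eU].
have K1 : 0 < K + 1 by lra.
apply/nbhs_ballP; exists (e / (K + 1)); first exact: divr_gt0.
move=> v; rewrite -ball_normE /= ltr_pdivlMr// => uv; apply: eU.
rewrite -ball_normE /=; apply: le_lt_trans (fK _ _) _.
by apply: le_lt_trans uv; rewrite mulrC ler_wpM2l//; lra.
Qed.

Lemma dot_continuous u : continuous (dot u).
Proof.
apply: (@lipschitz_rV_continuous _ (n%:R * `|u|)) => [|v w]; first exact: mulr_ge0.
by rewrite -dotBr -mulrA dot_le_norm.
Qed.

End Dot.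

Section Norm.
Context {R : realType} {n : nat} (N : 'rV[R]_n -> R).
Hypothesis normN : is_norm N.
Implicit Types x g h : 'rV[R]_n.

Lemma is_norm0 : N 0 = 0.
Proof. by case: normN => _ NZ _; rewrite -(scale0r 0) NZ normr0 mul0r. Qed.

Lemma is_normN x : N (- x) = N x.
Proof. by case: normN => _ NZ _; rewrite -scaleN1r NZ normrN1 mul1r. Qed.

Lemma is_norm_ge0 x : 0 <= N x.
Proof.
case: normN => _ _ /(_ x (- x)); rewrite subrr is_norm0 is_normN; lra.
Qed.

Lemma is_norm_gt0 x : x != 0 -> 0 < N x.
Proof.
move=> x0; rewrite lt_neqAle is_norm_ge0 andbT eq_sym.
by apply: contra x0 => /eqP; case: normN => N0 _ _ /N0 ->.
Qed.

Lemma is_normB x x' : N (x - x') <= N x + N x'.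
Proof. by case: normN => _ _ /(_ x (- x')); rewrite is_normN. Qed.

Lemma is_norm_dist x x' : `|N x - N x'| <= N (x - x').
Proof.
case: normN => _ _ T; rewrite ler_norml.
have := T (x - x') x'; rewrite subrK.
have := T (x' - x) x; rewrite subrK -(is_normN (x' - x)) opprB; lra.
Qed.

Lemma is_norm_le_norm : exists2 K : R, 0 <= K & forall x, N x <= K * `|x|.
Proof.
case: normN => _ NZ T.
exists (\sum_i N (delta_mx 0 i)) => [|x].
  by apply: sumr_ge0 => i _; exact: is_norm_ge0.
rewrite [in N x](row_sum_delta x) mulr_suml.
elim/big_ind2 : _ => [|a b c d ab cd|i _]; first by rewrite is_norm0.
  exact: le_trans (T _ _) (lerD ab cd).
by rewrite NZ mulrC ler_wpM2l ?is_norm_ge0// coord_le_norm.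
Qed.

Lemma is_norm_continuous : continuous N.
Proof.
have [K K0 NK] := is_norm_le_norm; apply: lipschitz_rV_continuous K0 _ => x y.
exact: le_trans (is_norm_dist _ _) (NK _).
Qed.

(** [N] is continuous, so it has a positive minimum on the compact unit sphere of the sup norm; its
    inverse is the constant. The sphere is empty only in dimension zero. *)
Lemma norm_le_is_norm : exists2 K : R, 0 <= K & forall x, `|x| <= K * N x.
Proof.
pose S := [set x : 'rV[R]_n | `|x| = 1].
have [[x0 Sx0]|S0] := pselect (S !=set0); last first.
  exists 0 => // x; rewrite mul0r normr_le0; apply/negPn/negP => x0.
  apply: S0; exists (`|x|^-1 *: x).
  by rewrite /S /= normrZ normfV normr_id mulVf// normr_eq0.
have cS : compact S.
  apply: bounded_closed_compact.
    by exists 1; split=> // e e1 x /= ->; exact: ltW.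
  rewrite (_ : S = Num.norm @^-1` [set (1 : R)])//.
  by apply: closed_comp => [x _|]; [exact: norm_continuous|exact: closed_eq].
have [x1 + minx1] := EVT_min_rV (ex_intro _ x0 Sx0) cS
  (continuous_subspaceT is_norm_continuous).
rewrite inE /S /= => x11.
have Nx1 : 0 < N x1.
  by apply: is_norm_gt0; apply/eqP => x10; move: x11; rewrite x10 normr0; lra.
exists (N x1)^-1 => [|x]; first by rewrite invr_ge0 ltW.
have [->|x_neq0] := eqVneq x 0; first by rewrite normr0 is_norm0 mulr0.
have nx : 0 < `|x| by rewrite normr_gt0.
have /minx1 : `|x|^-1 *: x \in S.
  by rewrite inE /S /= normrZ normfV normr_id mulVf// gt_eqF.
case: normN => _ NZ _; rewrite NZ normfV normr_id => h.
by rewrite ler_pdivlMl// mulrC -ler_pdivlMl.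
Qed.

(** [dual_norm] is a real [sup], meaningful only for a nonempty set that is bounded above. *)
Lemma has_sup_dual g : has_sup [set dot g x | x in [set x | N x <= 1]].
Proof.
have [K K0 NK] := norm_le_is_norm; split.
  by exists 0, 0; rewrite ?dot0r//= is_norm0.
exists (n%:R * (`|g| * K)) => _ [x /= x1 <-].
apply: (le_trans (ler_norm _)); apply: (le_trans (dot_le_norm _ _)).
rewrite ler_wpM2l// ler_wpM2l//; apply: (le_trans (NK _)).
by rewrite -[leRHS]mulr1 ler_wpM2l.
Qed.

Lemma dual_norm_le g (c : R) : (forall h, N h <= 1 -> dot g h <= c) ->
  dual_norm N g <= c.
Proof.
move=> gc; apply: ge_sup; first by case: (has_sup_dual g).
by move=> _ [h /= h1 <-]; exact: gc.
Qed.

Lemma dual_norm_ge g h : N h <= 1 -> dot g h <= dual_norm N g.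
Proof.
by move=> h1; apply: ub_le_sup; [case: (has_sup_dual g)|exists h].
Qed.

Lemma dual_norm_ge0 g : 0 <= dual_norm N g.
Proof. by rewrite -(dot0r g) dual_norm_ge// is_norm0. Qed.

Lemma dot_le_dual g h : dot g h <= dual_norm N g * N h.
Proof.
have [->|h0] := eqVneq h 0; first by rewrite dot0r is_norm0 mulr0.
have Nh := is_norm_gt0 h0.
have /(dual_norm_ge g) : N ((N h)^-1 *: h) <= 1.
  by case: normN => _ NZ _; rewrite NZ gtr0_norm ?invr_gt0// mulVf ?gt_eqF.
by rewrite dotZr ler_pdivrMl// mulrC.
Qed.

Lemma normr_dot_le_dual g h : `|dot g h| <= dual_norm N g * N h.
Proof.
by rewrite ler_norml lerNl -dotNr -{1}(is_normN h) !dot_le_dual.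
Qed.

Lemma dual_normN g : dual_norm N (- g) = dual_norm N g.
Proof.
suff h k : dual_norm N (- k) <= dual_norm N k.
  by apply/eqP; rewrite eq_le h -{1}(opprK g) h.
by apply: dual_norm_le => x x1; rewrite dotNl -dotNr dual_norm_ge// is_normN.
Qed.

Lemma dual_normD g h : dual_norm N (g + h) <= dual_norm N g + dual_norm N h.
Proof.
by apply: dual_norm_le => x x1; rewrite dotDl lerD// dual_norm_ge.
Qed.

Lemma dual_norm_dist g h : `|dual_norm N g - dual_norm N h| <= dual_norm N (g - h).
Proof.
rewrite ler_norml.
have := dual_normD (g - h) h; rewrite subrK.
have := dual_normD (h - g) g; rewrite subrK -(dual_normN (h - g)) opprB; lra.
Qed.

Lemma dual_norm_le_norm : exists2 K : R, 0 <= K & forall g, dual_norm N g <= K * `|g|.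
Proof.
have [K K0 NK] := norm_le_is_norm.
exists (n%:R * K) => [|g]; first exact: mulr_ge0.
apply: dual_norm_le => x x1.
apply: (le_trans (ler_norm _)); apply: (le_trans (dot_le_norm _ _)).
rewrite -mulrA ler_wpM2l// mulrC ler_wpM2r//; apply: (le_trans (NK _)).
by rewrite -[leRHS]mulr1 ler_wpM2l.
Qed.

End Norm.

(** * Strong convexity and first-order optimality *)

Section StronglyConvex.
Context {R : realType} {n : nat}.
Implicit Types (A : set 'rV[R]_n) (x y g l : 'rV[R]_n).

(** Convexity with a plain real parameter, in place of the interval type used by [convex_set]. *)
Definition segment_closed A := forall x y (t : R), A x -> A y -> 0 <= t <= 1 ->
  A (t *: x + (1 - t) *: y).

Lemma convex_set_segment A : convex_set A -> segment_closed A.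
Proof.
move=> cA x y t Ax Ay /andP[t0 t1].
by have := cA x y (Itv01 t0 t1); rewrite !inE; apply.
Qed.

(* Minimality of [y] is tested on the segment from [y] to [x], whose parameter is
   then sent to 0. *)
Lemma argmin_strongly_convex N A (w : 'rV[R]_n -> R) (a c : R) l y :
  is_norm N -> segment_closed A -> strongly_convex N a A w -> 0 <= c ->
  is_argmin A (fun x => dot l x + c * w x) y ->
  forall x, A x -> dot l y + c * w y + c * a / 2 * N (x - y) ^+ 2 <=
                   dot l x + c * w x.
Proof.
move=> nN sA scw c0 [Ay miny] x Ax.
set D := dot l x + c * w x - (dot l y + c * w y); set k := c * a / 2 * N (x - y) ^+ 2.
suff : k <= D by rewrite /D; lra.
have key t : 0 < t -> t <= 1 -> (1 - t) * k <= D.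
  move=> t0 t1.
  have t01 : 0 <= t <= 1 by rewrite ltW.
  have := miny _ (sA _ _ _ Ax Ay t01).
  have := ler_wpM2l c0 (scw _ _ _ Ax Ay t01).
  rewrite dotDr !dotZr -(ler_pM2l t0 _ D) /D /k; move: (N _) => q; nra.
apply/ler_addgt0Pr => e e0.
have [kle|k0] := leP k 0.
  have := key 1 ltr01 (lexx _); lra.
pose t := Num.min 1 (e / k).
have t0 : 0 < t by rewrite lt_min ltr01 divr_gt0.
have t1 : t <= 1 by rewrite ge_min lexx.
have te : t * k <= e by rewrite -ler_pdivlMr// ge_min lexx orbT.
have := key t t0 t1; lra.
Qed.

(** A single parameter [t], as small as prescribed by [s], is enough for both uses below, so no
    limit is taken. Dividing [e] by [|u - x| + 1] turns the error [e * |x' - x|] into [t * e], also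
    when [u = x]. *)
Lemma gradient_within_segment A (w : 'rV[R]_n -> R) x g u :
  segment_closed A -> A x -> A u -> is_gradient_within A w x g ->
  forall e s : R, 0 < e -> 0 < s <= 1 -> exists2 t : R, 0 < t <= s &
    `|w (t *: u + (1 - t) *: x) - w x - t * dot g (u - x)| <= t * e.
Proof.
move=> sA Ax Au gw e s e0 /andP[s0 s1].
have q0 : 0 < `|u - x| + 1 by rewrite ltr_wpDl.
have /gw : 0 < e / (`|u - x| + 1) by exact: divr_gt0.
move=> /nbhs_ballP[r /= r0 rw].
pose t := Num.min s (r / (`|u - x| + 1) / 2).
have t0 : 0 < t by rewrite lt_min s0 /= !divr_gt0.
have ts : t <= s by rewrite ge_min lexx.
have t1 := le_trans ts s1.
have tr : t * (`|u - x| + 1) < r.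
  rewrite -ltr_pdivlMr// gt_min; apply/orP; right.
  rewrite ltr_pdivrMr// ltr_pMr ?divr_gt0//; lra.
exists t; first by rewrite t0.
have E : t *: u + (1 - t) *: x - x = t *: (u - x).
  by rewrite scalerBl scale1r scalerBr addrA addrAC addrK.
have := rw (t *: u + (1 - t) *: x).
rewrite -ball_normE /= -normrN opprB E normrZ gtr0_norm// dotZr.
move=> /(_ _ (sA _ _ _ Au Ax _)); rewrite ltW//= t1.
have -> : t * `|u - x| < r.
  by apply: le_lt_trans tr; rewrite ler_pM2l//; lra.
move=> /(_ isT isT) /le_trans; apply.
rewrite mulrCA ler_pM2l// -mulrA ler_piMr ?(ltW e0)//.
by rewrite mulrC ler_pdivrMr// mul1r; lra.
Qed.

(** The variational inequality: minimality is compared with the expansion of [w] along the segment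
    to [u] and divided by the parameter. The divisor [c + 1] keeps [c] times the error below [e]
    even for [c = 0]. *)
Lemma argmin_optimality A (w : 'rV[R]_n -> R) (c : R) l g y :
  segment_closed A -> 0 <= c -> is_gradient_within A w y g ->
  is_argmin A (fun x => dot l x + c * w x) y ->
  forall u, A u -> 0 <= dot l (u - y) + c * dot g (u - y).
Proof.
move=> sA c0 gw [Ay miny] u Au; apply/ler_addgt0Pr => e e0.
have q0 : 0 < c + 1 by lra.
have /(_ _ 1 (divr_gt0 e0 q0)) := gradient_within_segment sA Ay Au gw.
rewrite ltr01 lexx => /(_ isT)[t /andP[t0 t1]].
rewrite ler_norml => /andP[_ /(ler_wpM2l c0)].
have t01 : 0 <= t <= 1 by rewrite ltW.
have := miny _ (sA _ _ _ Au Ay t01).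
rewrite [dot l (_ *: _ + _)]dotDr !dotZr !dotBr => h1 h2.
have h3 : c * (t * (e / (c + 1))) <= t * e.
  rewrite mulrCA ler_pM2l// mulrCA ler_piMr ?(ltW e0)//.
  by rewrite ler_pdivrMr// mul1r; lra.
rewrite -(ler_pM2l t0) mulr0; lra.
Qed.

Lemma strongly_convex_gradient N A (w : 'rV[R]_n -> R) (a : R) x g u :
  is_norm N -> segment_closed A -> strongly_convex N a A w ->
  is_gradient_within A w x g -> A x -> A u ->
  w x + dot g (u - x) + a / 2 * N (u - x) ^+ 2 <= w u.
Proof.
move=> nN sA scw gw Ax Au.
set k := a / 2 * _; apply/ler_addgt0Pr => e e0.
have q0 : 0 < `|k| + 1 by rewrite ltr_wpDl.
(* Along the segment the quadratic term is [t * (1 - t) * k]; this [s] makes the loss of [t * k] at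
   most [e / 2], and the expansion of [w] takes the other half. *)
pose s := Num.min 1 (e / 2 / (`|k| + 1)).
have s0 : 0 < s by rewrite lt_min ltr01 !divr_gt0.
have s1 : s <= 1 by rewrite ge_min lexx.
have sk : s * `|k| <= e / 2.
  have : s * (`|k| + 1) <= e / 2 by rewrite -ler_pdivlMr// ge_min lexx orbT.
  by rewrite mulrDr; lra.
have e2 : 0 < e / 2 by lra.
have /(_ _ s e2) := gradient_within_segment sA Ax Au gw.
rewrite s0 s1 => /(_ isT)[t /andP[t0 ts]].
rewrite ler_norml => /andP[+ _].
have t01 : 0 <= t <= 1 by rewrite ltW//= (le_trans ts).
have := scw _ _ _ Au Ax t01.
have -> : a / 2 * t * (1 - t) * N (u - x) ^+ 2 = t * (1 - t) * k by rewrite /k; ring.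
have tk : t * k <= e / 2.
  apply: (le_trans _ sk); apply: (le_trans (ler_norm _)).
  by rewrite normrM gtr0_norm// ler_wpM2r.
move: (dot g _) (w (_ + _)) => D W h1 h2.
have := ler_wpM2l (ltW t0) tk; rewrite -(ler_pM2l t0 (w x + D + k)) => h3.
move: h1 h2 h3; clear. lra.
Qed.

End StronglyConvex.

Lemma young {R : realFieldType} (p q k : R) : 0 < k ->
  p * q <= p ^+ 2 / (2 * k) + k / 2 * q ^+ 2.
Proof.
move=> k0; rewrite -(ler_pM2l (_ : 0 < 2 * k)) ?mulr_gt0//.
have -> : 2 * k * (p ^+ 2 / (2 * k) + k / 2 * q ^+ 2) = p ^+ 2 + (k * q) ^+ 2.
  by field; rewrite gt_eqF.
by have := sqr_ge0 (p - k * q); lra.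
Qed.

(** * Mirror descent and dual averaging in one block *)

Section MirrorDescent.
Context {R : realType} {n : nat}.
Variables (A : set 'rV[R]_n) (N w : 'rV[R]_n -> R) (grad : 'rV[R]_n -> 'rV[R]_n) (a : R).
Hypotheses (nN : is_norm N) (sA : segment_closed A) (dgf : is_dgf N A w grad a).
Hypotheses (exmin : exists x, is_argmin A w x) (exmax : exists x, is_argmax A w x).
Let D := dgf_diam A w.
Hypothesis D_gt0 : 0 < D.
(** The weight of a block in [omegaz], chosen so that [c] times the range of [w] is at most 1/2. *)
Let c : R := (2 * D ^+ 2)^-1.
Implicit Types (x y u l z : 'rV[R]_n).

Let a_gt0 : 0 < a. Proof. by case: dgf. Qed.
Let scw : strongly_convex N a A w. Proof. by case: dgf. Qed.
Let c_gt0 : 0 < c. Proof. by rewrite invr_gt0 mulr_gt0// exprn_gt0. Qed.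

(** Existence of a minimum and a maximum makes the [sup] and [inf] genuine; [D > 0] excludes a
    negative argument, on which [Num.sqrt] is 0. *)
Lemma dgf_diam_sqr x y : A x -> A y -> w x - w y <= D ^+ 2.
Proof.
move=> Ax Ay; have [xm [Axm minxm]] := exmin; have [xM [AxM maxxM]] := exmax.
have h1 : w x <= sup (w @` A).
  apply: ub_le_sup; last by exists x.
  by exists (w xM) => _ [u Au <-]; exact: maxxM.
have h2 : inf (w @` A) <= w y.
  apply: ge_inf; last by exists y.
  by exists (w xm) => _ [u Au <-]; exact: minxm.
have [pos|neg] := leP 0 (sup (w @` A) - inf (w @` A)).
  by rewrite sqr_sqrtr//; lra.
by move: D_gt0; rewrite /D /dgf_diam ltr0_sqrtr// ltxx.
Qed.

(** Strong convexity at the minimizer of [w] bounds a N(u - xm)^2 by 2 D^2 for every u in A. Passing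
    through xm, with (r + s)^2 <= 2 r^2 + 2 s^2, gives the factor 8. *)
Lemma dgf_diam_norm x y : A x -> A y -> N (x - y) ^+ 2 <= 8 * D ^+ 2 / a.
Proof.
have [xm minxm] := exmin; have [Axm _] := minxm.
have near_min u : A u -> a * N (u - xm) ^+ 2 <= 2 * D ^+ 2.
  move=> Au.
  have : is_argmin A (fun x => dot 0 x + 1 * w x) xm.
    by split=> // v /(proj2 minxm); rewrite !dot0l !mul1r !add0r.
  move=> /(argmin_strongly_convex nN sA scw ler01)/(_ u Au).
  by rewrite !dot0l !mul1r; have := dgf_diam_sqr Au Axm; lra.
move=> Ax Ay; rewrite ler_pdivlMr// mulrC.
have := near_min _ Ax; have := near_min _ Ay.
have : N (x - y) <= N (x - xm) + N (y - xm).
  by have := is_normB nN (x - xm) (y - xm); rewrite opprB addrA subrK.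
move: (is_norm_ge0 nN (x - y)) a_gt0; move: (N _) (N _) (N _) => s r p p0 a0 h1 h2 h3.
have : p ^+ 2 <= 2 * r ^+ 2 + 2 * s ^+ 2.
  apply: (le_trans (_ : _ <= (r + s) ^+ 2)); last by have := sqr_ge0 (r - s); lra.
  by rewrite ler_sqr ?nnegrE//; lra.
by move=> /(ler_wpM2l (ltW a0)); lra.
Qed.

(** The Bregman distance of one block; [bregman] is the sum of the two block distances weighted by
    [cx] and [cy]. *)
Definition breg x u := w u - w x - dot (grad x) (u - x).

(** Minimality says that [- c^-1 *: l] is a subgradient of [w] at [y]. Every iterate thus lies where
    [grad] is the gradient. *)
Lemma argmin_dom_subdiff l y : is_argmin A (fun x => dot l x + c * w x) y ->
  dom_subdiff A w y.
Proof.
move=> [Ay miny]; split=> //; exists (- c^-1 *: l) => x Ax.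
rewrite dotZl mulNr -(ler_pM2l c_gt0) mulrDr mulrN mulVKf ?gt_eqF// dotBr.
have := miny _ Ax; lra.
Qed.


(** The three-point inequality: optimality of [y] against [u], strong convexity between [x] and [y],
    and Young's inequality with parameter [c * a], where 1/(2 c a) = D^2/a. *)
Lemma mirror_step x y z u : A x -> is_gradient_within A w x (grad x) ->
  is_argmin A (fun x1 => dot (z - c *: grad x) x1 + c * w x1) y -> A u ->
  dot z (x - u) <= c * breg x u - c * breg y u + D ^+ 2 / a * dual_norm N z ^+ 2.
Proof.
move=> Ax gx amin Au.
have [Ay _] := amin.
have gy := dgf_gradient dgf (argmin_dom_subdiff amin).
have := argmin_optimality sA (ltW c_gt0) gy amin Au.
have := ler_wpM2l (ltW c_gt0) (strongly_convex_gradient nN sA scw gx Ax Ay).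
have := dot_le_dual nN z (x - y).
have -> : N (x - y) = N (y - x) by rewrite -(is_normN nN) opprB.
have := young (dual_norm N z) (N (y - x)) (mulr_gt0 c_gt0 a_gt0).
have -> : dual_norm N z ^+ 2 / (2 * (c * a)) = D ^+ 2 / a * dual_norm N z ^+ 2.
  by rewrite /c; field; rewrite !gt_eqF.
rewrite /breg dotBl dotZl !dotBr; lra.
Qed.

Lemma breg_ge0 x u : A u -> dom_subdiff A w x -> 0 <= breg x u.
Proof.
move=> Au dx; have [Ax _] := dx.
have := strongly_convex_gradient nN sA scw (dgf_gradient dgf dx) Ax Au.
rewrite /breg.
have : 0 <= a / 2 * N (u - x) ^+ 2 by rewrite mulr_ge0 ?sqr_ge0//// divr_ge0// ltW.
lra.
Qed.

(** The Bregman terms telescope. As [x 0] minimizes [w], its linear term is nonnegative and the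
    initial distance is at most c D^2 = 1/2. *)
Lemma mirror_descent (x z : nat -> 'rV[R]_n) t :
  is_argmin A w (x 0) ->
  (forall s, (s < t)%N ->
    is_argmin A (fun x1 => dot (z s - c *: grad (x s)) x1 + c * w x1) (x s.+1)) ->
  (forall s, (s <= t)%N -> dom_subdiff A w (x s)) /\
  forall u, A u -> \sum_(s < t) dot (z s) (x s - u) <=
    1 / 2 + D ^+ 2 / a * \sum_(s < t) dual_norm N (z s) ^+ 2.
Proof.
move=> min0 run.
have argmin0 : is_argmin A (fun x => dot 0 x + c * w x) (x 0).
  split=> [|u Au]; first by case: min0.
  by rewrite !dot0l !add0r ler_pM2l//; case: min0 => _; exact.
have dom s : (s <= t)%N -> dom_subdiff A w (x s).
  by case: s => [_|s st]; [exact: argmin_dom_subdiff argmin0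
    |exact: argmin_dom_subdiff (run _ st)].
split=> // u Au.
have main s : (s <= t)%N -> \sum_(k < s) dot (z k) (x k - u) <=
    c * breg (x 0) u - c * breg (x s) u +
    D ^+ 2 / a * \sum_(k < s) dual_norm N (z k) ^+ 2.
  elim: s => [_|s IH st]; first by rewrite !big_ord0 mulr0 subrr addr0.
  rewrite !big_ord_recr /=.
  have ds := dom _ (ltnW st).
  have := mirror_step (proj1 ds) (dgf_gradient dgf ds) (run _ st) Au.
  have := IH (ltnW st); lra.
have := main _ (leqnn t).
have : 0 <= c * breg (x t) u by rewrite mulr_ge0 ?(ltW c_gt0)// breg_ge0//; exact: dom.
have : c * breg (x 0) u <= 1 / 2.
  have -> : (1 / 2 : R) = c * D ^+ 2 by rewrite /c; field; rewrite gt_eqF.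
  rewrite ler_pM2l// /breg.
  have d0 := dom _ (leq0n t).
  have := argmin_optimality sA (ltW c_gt0) (dgf_gradient dgf d0) argmin0 Au.
  rewrite dot0l add0r pmulr_rge0// => h.
  have := dgf_diam_sqr Au (proj1 d0); lra.
lra.
Qed.

(** The point [v s] minimizes a regularized function of the sum of [z k] for [k < s], so it is fixed
    by the past without a recursion through gradients of [w]. *)
Lemma dual_averaging (v z : nat -> 'rV[R]_n) :
  (forall s, is_argmin A (fun y => dot (- \sum_(k < s) z k) y + c * w y) (v s)) ->
  forall t u, A u -> \sum_(s < t) dot (z s) (u - v s) <=
    1 / 2 + D ^+ 2 / a * \sum_(s < t) dual_norm N (z s) ^+ 2.
Proof.
move=> vmin t u Au.
(* The potential is the optimal value of the regularized problem. By strong convexity at [v s] and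
   Young's inequality, step [s] lowers it by at most [dot (z s) (v s)] plus the squared dual norm
   term. *)
have main s : c * w (v 0) - \sum_(k < s) dot (z k) (v k)
     - D ^+ 2 / a * \sum_(k < s) dual_norm N (z k) ^+ 2 <=
    dot (- \sum_(k < s) z k) (v s) + c * w (v s).
  elim: s => [|s IH]; first by rewrite !big_ord0 mulr0 !subr0 oppr0 dot0l add0r.
  apply: (le_trans _ (_ : dot (- \sum_(k < s) z k) (v s) + c * w (v s)
     - dot (z s) (v s) - D ^+ 2 / a * dual_norm N (z s) ^+ 2 <= _)).
    by rewrite !big_ord_recr /=; lra.
  have := argmin_strongly_convex nN sA scw (ltW c_gt0) (vmin s) (proj1 (vmin s.+1)).
  rewrite big_ord_recr /= opprD dotDl (dotNl (z s)).
  have := dot_le_dual nN (z s) (v s.+1 - v s).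
  have := young (dual_norm N (z s)) (N (v s.+1 - v s)) (mulr_gt0 c_gt0 a_gt0).
  have -> : dual_norm N (z s) ^+ 2 / (2 * (c * a)) = D ^+ 2 / a * dual_norm N (z s) ^+ 2.
    by rewrite /c; field; rewrite !gt_eqF.
  rewrite dotBr; lra.
have := main t; have := proj2 (vmin t) _ Au.
rewrite !dotNl (dot_suml _ _ u).
under [in X in _ -> _ -> X <= _]eq_bigr do rewrite dotBr.
rewrite sumrB.
have : c * w u - c * w (v 0) <= 1 / 2.
  have -> : (1 / 2 : R) = c * D ^+ 2 by rewrite /c; field; rewrite gt_eqF.
  by rewrite -mulrBr ler_pM2l// dgf_diam_sqr//; case: (vmin 0).
lra.
Qed.

(** Adding the strong convexity inequalities at [y] and at [y'] gives c a N(y - y')^2 <= dot (l' -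
    l) (y - y'). Uniqueness of the minimizer and measurability of the iterates both come from
    this. *)
Lemma argmin_lipschitz : exists2 K : R, 0 <= K & forall l l' y y',
  is_argmin A (fun x => dot l x + c * w x) y ->
  is_argmin A (fun x => dot l' x + c * w x) y' -> `|y - y'| <= K * `|l - l'|.
Proof.
have [K1 K10 NK1] := norm_le_is_norm nN.
have [K2 K20 NK2] := dual_norm_le_norm nN.
have ca0 : 0 < c * a by rewrite mulr_gt0.
exists (K1 * ((c * a)^-1 * K2)) => [|l l' y y' my my'].
  by rewrite !mulr_ge0// invr_ge0 ltW.
apply: (le_trans (NK1 _)); rewrite -mulrA ler_wpM2l// -mulrA.
rewrite -ler_pdivrMl ?invr_gt0// invrK; apply: le_trans (NK2 _).
have [yy'|yy'] := eqVneq (y - y') 0.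
  by rewrite yy' is_norm0// mulr0; exact: dual_norm_ge0.
rewrite -(ler_pM2r (is_norm_gt0 nN yy')).
have := argmin_strongly_convex nN sA scw (ltW c_gt0) my (proj1 my').
have := argmin_strongly_convex nN sA scw (ltW c_gt0) my' (proj1 my).
rewrite -(is_normN nN (y' - y)) opprB.
have := dot_le_dual nN (l' - l) (y - y').
rewrite -(dual_normN nN (l' - l)) opprB dotBl !dotBr; lra.
Qed.

Lemma argmin_exists l : compact A -> exists y, is_argmin A (fun x => dot l x + c * w x) y.
Proof.
move=> cA; have [xm [Axm _]] := exmin.
have [] := @EVT_min_rV _ _ (fun x => dot l x + c * w x) _ (ex_intro _ xm Axm) cA.
  have cw := dgf_continuous dgf.
  move=> x; apply: cvgD; last by apply: cvgM; [exact: cvg_cst|exact: cw].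
  exact: (continuous_subspaceT (@dot_continuous _ _ l)).
move=> y /set_mem Ay miny; exists y; split=> // x Ax.
by apply: miny; rewrite inE.
Qed.

End MirrorDescent.

(** * Numerical estimates *)

Section Numerics.
Context {R : realType}.

Lemma harmonic_le_ln t : \sum_(s < t.+1) (s.+1%:R : R)^-1 <= 1 + ln t.+1%:R.
Proof.
elim: t => [|t IH]; first by rewrite big_ord1 invr1 ln1 addr0.
rewrite big_ord_recr /=; apply: (le_trans (lerD IH (lexx _))).
rewrite -addrA lerD2l.
have t1 : 0 < (t.+1%:R : R) by [].
have t2 : 0 < (t.+2%:R : R) by [].
(* ln(1 + u) <= u at u = -1/(t+2) bounds 1/(t+2) by ln(t+2) - ln(t+1). *)
have := @le_ln1Dx R (t.+1%:R / t.+2%:R - 1).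
rewrite [1 + (_ - 1)]addrC subrK ln_div ?posrE//.
have -> : t.+1%:R / t.+2%:R - 1 = - t.+2%:R^-1 :> R.
  have -> : t.+1%:R = t.+2%:R - 1 :> R by rewrite -[t.+2%:R]natr1 addrK.
  by move: (t.+2%:R) t2 => p p0; field; exact: lt0r_neq0.
move=> h; have : - t.+2%:R^-1 > -1 :> R.
  by rewrite ltrN2 invf_lt1// ltr1n.
move=> /h; move: (ln _) (ln _) (_^-1) => p q r; lra.
Qed.

Lemma sum_invsqrt_ge t :
  Num.sqrt t.+1%:R <= \sum_(s < t.+1) (Num.sqrt s.+1%:R : R)^-1.
Proof.
have s0 : 0 < Num.sqrt (t.+1%:R : R) by rewrite sqrtr_gt0.
have -> : Num.sqrt (t.+1%:R : R) = \sum_(s < t.+1) (Num.sqrt t.+1%:R)^-1.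
  have e : Num.sqrt t.+1%:R * Num.sqrt t.+1%:R = t.+1%:R :> R by rewrite -expr2 sqr_sqrtr.
  rewrite sumr_const card_ord -[RHS]mulr_natr.
  by move: (Num.sqrt _) s0 e => s s0 <-; rewrite mulKf ?gt_eqF.
apply: ler_sum => s _; rewrite lef_pV2 ?posrE ?sqrtr_gt0//.
by rewrite ler_wsqrtr// ler_nat.
Qed.

(** The concave [ln] lies below its tangent at 2a, and ln 2 <= 1 absorbs the constant. *)
Lemma lnM_le (a x : R) : 0 < a -> 0 < x -> 2 * a * ln a <= x -> a * ln x <= x.
Proof.
move=> a0 x0 ax.
have y0 : 0 < 2 * a by rewrite mulr_gt0.
have := @le_ln1Dx R (x / (2 * a) - 1).
have xy : 0 < x / (2 * a) by rewrite divr_gt0.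
rewrite [1 + (_ - 1)]addrC subrK ln_div ?posrE// lnM ?posrE// => h.
have {h}h : ln x - (ln 2 + ln a) <= x / (2 * a) - 1 by apply: h; lra.
have l2 : ln 2 <= (1 : R).
  have := @le_ln1Dx R 1; rewrite (_ : 1 + 1 = 2 :> R) //; apply; lra.
have := ler_wpM2l (ltW a0) h.
have -> : a * (x / (2 * a) - 1) = x / 2 - a by field; rewrite gt_eqF.
have := ler_wpM2l (ltW a0) l2; lra.
Qed.

Lemma ln_ge1 (x : R) : 4 <= x -> 1 <= ln x.
Proof.
move=> x4; have x0 : 0 < x by lra.
have e : 1 / 2 <= expR (- (1 / 2)) :> R.
  by have := expR_ge1Dx (- (1 / 2) : R); lra.
rewrite -[leLHS](expRK 1) ler_ln ?posrE ?expR_gt0//.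
apply: le_trans x4.
have : expR 1 * expR (- (1 / 2)) ^+ 2 = 1 :> R.
  by rewrite -expRM_natl -expRD -expR0; congr expR; field.
have := expR_gt0 (1 : R).
move: (expR 1) (expR (- _)) e => p q q2 p0 pq.
have : (1 / 2) ^+ 2 <= q ^+ 2 by rewrite ler_sqr ?nnegrE; lra.
by move=> /(ler_wpM2l (ltW p0)); lra.
Qed.

(** With x = sqrt(t+2) and a = 8C/eps the assumption on [t] reads 2 a ln a <= x, the -2 of the
    iteration bound being the shift from t to t+2. Hence 4 C ln(t+2) <= eps x, and every term on the
    left is compared with ln(t+2) >= 1. The left side is M times the sum of the two error bounds
    obtained on the good event. *)
Lemma rate_bound (Q M L W eps h : R) (t : nat) :
  0 < Q -> 0 < M -> 0 <= L -> 0 < W -> 4 / 3 * L <= W -> 0 < eps ->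
  let C := Q * W + 10 * M * W + 9 / 2 * M in
  (6 <= t)%N -> (16 * C / eps * ln (8 * C / eps)) ^+ 2 - 2 <= t%:R ->
  0 <= h -> h <= 1 + ln t.+1%:R ->
  M * (3 / 2 + (5 / 2 + 3 / 2 * L) * h + 2 * (W * Q * Num.sqrt h / M)
    + 4 * W * Num.sqrt h) <= eps * Num.sqrt t.+1%:R.
Proof.
move=> Q0 M0 L0 W0 LW eps0 C t6 hT h0 hh.
have C0 : 0 < C by rewrite !addr_gt0// !mulr_gt0.
have n0 : 0 < (t.+2%:R : R) by [].
have tE : t.+2%:R = t%:R + 2 :> R by rewrite -addn2 natrD.
set x : R := Num.sqrt t.+2%:R.
have x0 : 0 < x by rewrite sqrtr_gt0.
have x2 : x ^+ 2 = t.+2%:R by rewrite sqr_sqrtr.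
set a := 8 * C / eps.
have a0 : 0 < a by rewrite divr_gt0// mulr_gt0.
have ax : 2 * a * ln a <= x.
  apply: (le_trans (ler_norm _)); rewrite -(@ler_sqr _ _ x) ?nnegrE ?normr_ge0 ?(ltW x0)//.
  rewrite real_normK ?num_real// x2.
  have -> : 2 * a = 16 * C / eps by rewrite /a; field; rewrite gt_eqF.
  by rewrite tE; move: hT; rewrite -/a; move: (_ ^+ 2) => p; lra.
have := lnM_le a0 x0 ax.
set l := ln (t.+2%:R : R).
have -> : ln x = l / 2.
  by rewrite /l -x2 lnXn//; lra.
have -> : a * (l / 2) = 4 * C * l / eps by rewrite /a; field; rewrite gt_eqF.
rewrite ler_pdivrMr// => main.
have l1 : 1 <= l by rewrite ln_ge1// ler_nat !ltnS (leq_trans _ t6).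
have hl : h <= 2 * l.
  apply: (le_trans hh); have : ln (t.+1%:R : R) <= l by rewrite ler_ln ?posrE// ler_nat.
  lra.
have sh : Num.sqrt h <= 3 / 2 * l.
  rewrite -ler_sqr ?nnegrE ?sqrtr_ge0//; last lra.
  rewrite sqr_sqrtr//; apply: (le_trans hl); nra.
(* The passage from t+2 back to t+1 costs a factor 9/10, which [6 <= t] allows. *)
have xs : 9 / 10 * x <= Num.sqrt t.+1%:R.
  rewrite -ler_sqr ?nnegrE ?sqrtr_ge0//; last by rewrite mulr_ge0// ltW.
  rewrite exprMn x2 sqr_sqrtr// tE -natr1.
  have : (6 : R) <= t%:R by rewrite (ler_nat R 6).
  lra.
apply: (@le_trans _ _ (eps * (9 / 10 * x))); last by rewrite ler_pM2l.
apply: (@le_trans _ _ (9 / 10 * (4 * C * l))); last lra.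
have -> : M * (3 / 2 + (5 / 2 + 3 / 2 * L) * h + 2 * (W * Q * Num.sqrt h / M)
    + 4 * W * Num.sqrt h) = M * (3 / 2) + (M * (5 / 2 + 3 / 2 * L)) * h
   + (2 * W * Q + 4 * M * W) * Num.sqrt h by field; rewrite gt_eqF.
have c1 : 0 <= M * (5 / 2 + 3 / 2 * L) by rewrite mulr_ge0 ?(ltW M0)//; lra.
have c2 : 0 <= 2 * W * Q + 4 * M * W by rewrite addr_ge0// !mulr_ge0// ltW.
have := ler_wpM2l c1 hl; have := ler_wpM2l c2 sh.
have l0 : 0 <= l by lra.
have := ler_wpM2l (ltW M0) l1.
have := ler_wpM2l l0 (ler_wpM2l (ltW M0) LW).
have : 0 <= l * (Q * W) by rewrite !mulr_ge0// ltW.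
have : 0 <= l * (M * W) by rewrite !mulr_ge0// ltW.
rewrite /C; lra.
Qed.

End Numerics.

(** * Measurability of vector-valued maps *)

Section VectorMeasurability.
Context {R : realType}.

Lemma rat_vector_dense n (x : 'rV[R]_n) (e : R) : 0 < e ->
  exists q : 'rV[rat]_n, `|x - map_mx ratr q| < e.
Proof.
move=> e0.
have h i : exists q : rat, `|x 0 i - ratr q| < e.
  have /rat_in_itvoo[q] : x 0 i - e < x 0 i + e by lra.
  by rewrite in_itv/= => /andP[h1 h2]; exists q; rewrite ltr_norml; lra.
exists (\row_i projT1 (cid (h i))); apply: norm_lt_coord => // i.
by rewrite !mxE; case: cid.
Qed.

(** Working by coordinates lets the real-valued measurability lemmas apply directly;
    [rV_measurable_borel] and [borel_rV_measurable] translate to and from the Borel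
    sigma-algebra. *)
Definition rV_measurable {d} {T : measurableType d} {n} (D : set T) (f : T -> 'rV[R]_n) :=
  forall j, measurable_fun D (fun t => f t 0 j).

Section OneDomain.
Context {d} {T : measurableType d} {n : nat}.
Variables (D : set T) (mD : measurable D).

Lemma rV_measurable_ball (f : T -> 'rV[R]_n) (x : 'rV[R]_n) (e : R) : 0 < e ->
  rV_measurable D f -> measurable (D `&` [set t | `|x - f t| < e]).
Proof.
move=> e0 mf.
rewrite (_ : _ `&` _ = D `&` \bigcap_(i in [set: 'I_n]) (D `&` [set t | `|x 0 i - f t 0 i| < e])).
  apply: measurableI => //; apply: fin_bigcap_measurable => // i _.
  have mfi : measurable_fun D (fun t => `|x 0 i - f t 0 i|).
    by apply: measurableT_comp => //; apply: measurable_funB => //; exact: mf.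
  have := mfi mD _ (measurable_itv `]-oo, e[).
  by congr (measurable (_ `&` _)); apply/seteqP; split=> t /=; rewrite in_itv.
apply/seteqP; split=> t [Dt] /= xft; split=> //.
  move=> i _; split=> //=; apply: le_lt_trans xft.
  by have := coord_le_norm (x - f t) i; rewrite !mxE.
by apply: norm_lt_coord => // i; rewrite !mxE; case: (xft i I).
Qed.

(** An open set is the countable union of the balls with rational center and radius 1/(k+1) that it
    contains. *)
Lemma rV_measurable_open (f : T -> 'rV[R]_n) (U : set 'rV[R]_n) :
  rV_measurable D f -> open U -> measurable (D `&` f @^-1` U).
Proof.
move=> mf oU.
pose B (p : 'rV[rat]_n * nat) := [set x : 'rV[R]_n | `|map_mx ratr p.1 - x| < p.2.+1%:R^-1].
pose E p := if `[< B p `<=` U >] then D `&` f @^-1` B p else set0.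
rewrite (_ : _ `&` _ = \bigcup_p E p).
  apply: countable_bigcupT_measurable => [|p]; first exact: countableP.
  rewrite /E; case: ifPn => // _.
  by apply: (@rV_measurable_ball f (map_mx ratr p.1) p.2.+1%:R^-1); rewrite ?invr_gt0.
apply/seteqP; split=> [t [Dt Ut]|t [p _]]; last first.
  by rewrite /E; case: asboolP => // BU [Dt Bt]; split=> //; exact: BU.
have /nbhs_ballP[e /= e0 eU] : nbhs (f t) U by exact: open_nbhs_nbhs.
have [k] : exists k, 0 + k.+1%:R^-1 < e / 2 by apply: ltr_add_invr; lra.
rewrite add0r => ke.
have k0 : (0 : R) < k.+1%:R^-1 by rewrite invr_gt0.
have [q fq] := rat_vector_dense (f t) k0.
exists (q, k) => //; rewrite /E; case: asboolP => [_|[]].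
  by split=> //; rewrite /B /= -normrN opprB.
move=> x; rewrite /B /= => qx; apply: eU; rewrite -ball_normE /=.
have := ler_normD (f t - map_mx ratr q) (map_mx ratr q - x).
rewrite addrA subrK => /le_lt_trans; apply.
by rewrite [ltRHS]splitr ltrD// (lt_trans _ ke).
Qed.

(** Here [g] depends continuously on the value of [f], although no function on the whole vector
    space is given. This is the form in which minimizers and gradients, defined only along the
    iterates, are shown measurable. *)
Lemma measurable_fun_factor (f : T -> 'rV[R]_n) (g : T -> R) :
  rV_measurable D f ->
  (forall t, D t -> forall e : R, 0 < e -> exists2 r : R, 0 < r &
     forall t', D t' -> `|f t - f t'| < r -> `|g t - g t'| < e) ->
  measurable_fun D g.
Proof.
move=> mf cg; apply: (measurability _ (RGenInftyO.measurableE R)).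
move=> _ [_ [a ->] <-].
(* The union of the balls around points [f t] on whose preimages [g < a]; it is open, and its
   preimage is exactly the sublevel set. *)
pose V := [set y : 'rV[R]_n | exists t, exists r : R, [/\ D t, `|f t - y| < r &
  forall t', D t' -> `|f t - f t'| < r -> g t' < a]].
have oV : open V.
  rewrite openE => y [t [r [Dt tr h]]]; apply/nbhs_ballP.
  exists (r - `|f t - y|); first by rewrite /= subr_gt0.
  move=> y'; rewrite -ball_normE /= ltrBrDl => yy'; exists t, r; split=> //.
  apply: le_lt_trans yy'; have := ler_normD (f t - y) (y - y').
  by rewrite addrA subrK.
rewrite (_ : _ `&` _ = D `&` f @^-1` V); first exact: rV_measurable_open.
apply/seteqP; split=> t [Dt] /=; rewrite in_itv/=.
  move=> ga; split=> //.
  have /(cg _ Dt)[r r0 h] : 0 < a - g t by rewrite subr_gt0.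
  exists t, r; split=> //; first by rewrite subrr normr0.
  by move=> t' Dt' /(h _ Dt'); rewrite ltr_norml; lra.
by move=> [t0 [r [Dt0 t0r]]] /(_ _ Dt t0r) ?; split.
Qed.

End OneDomain.

Lemma rV_measurable_borel d (T : measurableType d) n (f : T -> 'rV[R]_n) :
  rV_measurable setT f -> measurable_fun setT (f : T -> borel R n).
Proof.
move=> mf; apply: (@measurability _ _ T (borel R n) setT f open) => //.
move=> _ [U oU <-]; exact: rV_measurable_open.
Qed.

Lemma measurable_coord n (j : 'I_n) : measurable_fun setT (fun x : borel R n => x 0 j).
Proof.
apply: (measurability _ (RGenInftyO.measurableE R)).
move=> _ [_ [a ->] <-]; rewrite setTI; apply: sub_sigma_algebra.
apply: open_comp => [x _|]; first exact: coord_continuous.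
exact: interval_open.
Qed.

Lemma borel_rV_measurable d (T : measurableType d) n (D : set T) (f : T -> borel R n) :
  measurable_fun D f -> rV_measurable D f.
Proof. by move=> mf j; exact: (measurableT_comp (measurable_coord j) mf). Qed.

Lemma measurable_dot d (T : measurableType d) n (D : set T) (f g : T -> 'rV[R]_n) :
  rV_measurable D f -> rV_measurable D g -> measurable_fun D (fun t => dot (f t) (g t)).
Proof.
by move=> mf mg; apply: measurable_sum => i; apply: measurable_funM.
Qed.

Lemma measurable_dual_norm d (T : measurableType d) n (D : set T) N (f : T -> 'rV[R]_n) :
  measurable D -> is_norm N -> rV_measurable D f ->
  measurable_fun D (fun t => dual_norm N (f t)).
Proof.
move=> mD nN mf; have [K K0 NK] := dual_norm_le_norm nN.
apply: (measurable_fun_factor mD mf) => t Dt e e0.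
have K1 : 0 < K + 1 by lra.
exists (e / (K + 1)) => [|t' _]; first exact: divr_gt0.
rewrite ltr_pdivlMr// => tt'.
apply: le_lt_trans (dual_norm_dist nN _ _) _; apply: le_lt_trans (NK _) _.
by apply: le_lt_trans tt'; rewrite mulrC ler_wpM2l//; lra.
Qed.

End VectorMeasurability.

Section Caratheodory.
Context {R : realType} {n : nat}.
Variable X : set 'rV[R]_n.

Lemma within_continuous_eps (V : normedModType R) (g : 'rV[R]_n -> V) x :
  {within X, continuous g} -> X x ->
  forall e : R, 0 < e -> exists2 r : R, 0 < r &
    forall x', X x' -> `|x - x'| < r -> `|g x - g x'| < e.
Proof.
move=> /subspace_continuousP cg Xx e e0.
have /cvgrPdist_lt/(_ e e0) := cg x Xx.
move=> /nbhs_ballP[r /= r0 rX]; exists r => // x' Xx' xx'.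
by apply: rX => //; rewrite -ball_normE.
Qed.

Context {d1 d2} {T1 : measurableType d1} {T2 : measurableType d2}.
Variables (x : T1 -> 'rV[R]_n) (f : 'rV[R]_n -> T2 -> R).
Hypotheses (mx : rV_measurable setT x) (Xx : forall t, X (x t)).
Hypothesis mf : forall v, X v -> measurable_fun setT (f v).
Hypothesis cf : forall s, {within X, continuous (f ^~ s)}.

(* The value of [x] is replaced by a point of [X] in the same cell of a
   countable cover by balls of radius [k.+1%:R^-1]. *)
Let inball k (v : 'rV[R]_n) i := if (choice.unpickle i : option 'rV[rat]_n) is Some q
  then `|map_mx ratr q - v| < k.+1%:R^-1 else false.

Let inballP k v : exists i, inball k v i.
Proof.
have k0 : (0 : R) < k.+1%:R^-1 by rewrite invr_gt0.
have [q qv] := rat_vector_dense v k0.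
by exists (choice.pickle q); rewrite /inball choice.pickleK -normrN opprB.
Qed.

Let cell k v := ex_minn (inballP k v).

(** The default [x point] keeps the representative in [X] when the cell does not meet [X]. *)
Let cellpt k i : 'rV[R]_n := xget (x point) [set v | X v /\ inball k v i].

Let Xcellpt k i : X (cellpt k i).
Proof. by rewrite /cellpt; case: xgetP => [v _ []|_]. Qed.

Let point_close k v : X v -> `|v - cellpt k (cell k v)| < 2 / k.+1%:R.
Proof.
move=> Xv; rewrite /cell; case: ex_minnP => i vi _.
rewrite /cellpt; case: xgetP => [w _ [_ wi]|/(_ v)[]//].
move: vi wi; rewrite /inball; case: choice.unpickle => // q vq wq.
have := ler_normD (v - map_mx ratr q) (map_mx ratr q - w).
rewrite addrA subrK => /le_lt_trans; apply.
by rewrite mulrDl mul1r ltrD// -normrN opprB.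
Qed.

Let measurable_cell k i : measurable [set t | cell k (x t) = i].
Proof.
have mb j : measurable [set t | inball k (x t) j].
  rewrite /inball; case: choice.unpickle => [q|].
    rewrite -[X in measurable X]setTI.
    by apply: rV_measurable_ball; rewrite ?invr_gt0.
  by rewrite (_ : [set _ | _] = set0)//; apply/seteqP; split.
rewrite (_ : [set _ | _] = [set t | inball k (x t) i] `\`
  \bigcup_(j in `I_i) [set t | inball k (x t) j]).
  by apply: measurableD => //; apply: bigcup_measurable.
apply/seteqP; split=> t /=; rewrite /cell; case: ex_minnP => j tj minj.
  move=> <-; split=> // -[l /= lj /minj]; rewrite leqNgt; lia.
move=> [ti tN]; apply/eqP; rewrite eqn_leq minj//= leqNgt; apply/negP => ji.
by apply: tN; exists j.
Qed.

(** On each of countably many measurable cells the approximation [h k] depends on the second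
    variable only; continuity in the first gives pointwise convergence. *)
Lemma measurable_fun_Caratheodory : measurable_fun setT (fun p : T1 * T2 => f (x p.1) p.2).
Proof.
pose h k (p : T1 * T2) := f (cellpt k (cell k (x p.1))) p.2.
apply: (@measurable_fun_cvg _ _ _ _ h) => [k|[t s] _].
  pose E i := [set p : T1 * T2 | cell k (x p.1) = i].
  have mE i : measurable (E i).
    rewrite (_ : E i = [set t | cell k (x t) = i] `*` setT).
      exact: measurableX.
    by apply/seteqP; split=> p //= [].
  rewrite (_ : setT = \bigcup_i E i); last first.
    by apply/seteqP; split=> p // _; exists (cell k (x p.1)).
  apply/measurable_fun_bigcup => // i.
  apply: (@eq_measurable_fun _ _ _ _ _ (fun p => f (cellpt k i) p.2)).
    by move=> p; rewrite inE /E /= /h => ->.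
  apply: measurable_funTS.
  by apply: measurableT_comp; [exact: mf|exact: measurable_snd].
apply/cvgrPdist_lt => e e0.
have [r r0 hr] := within_continuous_eps (@cf s) (Xx t) e0.
have [k] : exists k, 0 + k.+1%:R^-1 < r / 2 by apply: ltr_add_invr; rewrite divr_gt0.
rewrite add0r => kr; exists k => // l /= kl; apply: hr => //.
apply: lt_le_trans (point_close _ (Xx t)) _.
apply: (@le_trans _ _ (2 / k.+1%:R)).
  by rewrite ler_pM2l// lef_pV2 ?posrE// ler_nat ltnS.
by rewrite mulrC -ler_pdivlMr// ltW.
Qed.

End Caratheodory.

Section SectionIntegral.
Context {R : realType} {d1 d2} {T1 : measurableType d1} {T2 : measurableType d2}.
Variable mu : {sigma_finite_measure set T2 -> \bar R}.

(** Tonelli's theorem is applied to the positive and the negative part separately. *)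
Lemma measurable_Rintegral_section (g : T1 * T2 -> R) : measurable_fun setT g ->
  measurable_fun setT (fun t => \int[mu]_s g (t, s)).
Proof.
move=> mg.
have mp : measurable_fun setT (fun p => ((EFin \o g)^\+ p)%E).
  by apply: measurable_funepos; exact: measurableT_comp.
have mn : measurable_fun setT (fun p => ((EFin \o g)^\- p)%E).
  by apply: measurable_funeneg; exact: measurableT_comp.
rewrite /Rintegral; under eq_fun do rewrite integralE.
apply: measurableT_comp => //; apply: emeasurable_funB.
  have h := measurable_fun_fubini_tonelli_F (m2 := mu) _ mp (fun p => funepos_ge0 _ _).
  apply: eq_measurable_fun h => t _; rewrite /fubini_F.
  by apply: eq_integral => s _; rewrite !funeposE.
have h := measurable_fun_fubini_tonelli_F (m2 := mu) _ mn (fun p => funeneg_ge0 _ _).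
apply: eq_measurable_fun h => t _; rewrite /fubini_F.
by apply: eq_integral => s _; rewrite !funenegE.
Qed.

End SectionIntegral.

(** * Independence of a sample from the past *)

Section History.
Context {R : realType} {dO dT : measure_display} {Om : measurableType dO}
  {T : measurableType dT} {P : probability Om R}.
Variables (mu : probability T R) (xi : nat -> {RV P >-> T}).

(** Rectangles in the samples of index below [t]: a pi-system, as uniqueness of measures requires.
    The type [history t] is [Om] with the sigma-algebra they generate, so being adapted is
    measurability on [history t]. *)
Definition history_sets (t : nat) : set (set Om) :=
  [set E | exists2 A : nat -> set T, (forall s, measurable (A s)) &
     E = \bigcap_(s in `I_t) (xi s @^-1` A s)].

Definition history (t : nat) := g_sigma_algebraType (history_sets t).

HB.instance Definition _ t := Measurable.on (history t).

Lemma measurable_preimage_RV t (A : set T) : measurable A -> measurable (xi t @^-1` A).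
Proof. by move=> mA; exact: measurable_funPTI. Qed.

Lemma history_sets_measurable t : history_sets t `<=` @measurable _ Om.
Proof.
move=> _ [A mA ->]; have [->|/set0P t0] := eqVneq `I_t (set0 : set nat).
  by rewrite bigcap_set0.
by apply: bigcap_measurable => // s _; exact: measurable_preimage_RV.
Qed.

Lemma history_setI_closed t : setI_closed (history_sets t).
Proof.
move=> _ _ [A mA ->] [B mB ->]; exists (fun s => A s `&` B s).
  by move=> s; exact: measurableI.
by rewrite -bigcapI.
Qed.

Lemma history_setT t : history_sets t setT.
Proof. by exists (fun=> setT) => //; rewrite bigcapT. Qed.

Lemma measurable_to_history t : measurable_fun setT (id : Om -> history t).
Proof.
apply: (@measurability _ _ Om (history t) setT id (history_sets t)) => //.
by move=> _ [E hE <-]; rewrite setTI; exact: history_sets_measurable hE.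
Qed.

Lemma measurable_history_prev t :
  measurable_fun setT (id : history t.+1 -> history t).
Proof.
apply: (@measurability _ _ (history t.+1) (history t) setT id (history_sets t)) => //.
move=> _ [_ [A mA ->] <-]; rewrite setTI; apply: sub_sigma_algebra.
exists (fun s => if (s < t)%N then A s else setT); first by move=> s; case: ifP.
apply/seteqP; split=> o /= h s /= st; first by case: ifPn => // {}st; exact: h.
by have := h s (ltnW st); rewrite /= st.
Qed.

Lemma measurable_history_last t : measurable_fun setT (xi t : history t.+1 -> T).
Proof.
move=> _ B mB; rewrite setTI; apply: sub_sigma_algebra.
exists (fun s => if s == t then B else setT); first by move=> s; case: ifP.
apply/seteqP; split=> o /= h; first by move=> s /= st; case: eqP => // ->.
by have := h t (ltnSn t); rewrite /= eqxx.
Qed.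

Hypothesis iid_xi : iid mu xi.

Lemma history_indep_rect t (A : nat -> set T) B : (forall s, measurable (A s)) ->
  measurable B ->
  P (\bigcap_(s in `I_t) (xi s @^-1` A s) `&` xi t @^-1` B) =
  (P (\bigcap_(s in `I_t) (xi s @^-1` A s)) * mu B)%E.
Proof.
move=> mA mB; case: iid_xi => law indep.
pose A' s := if s == t then B else A s.
have mA' s : measurable (A' s) by rewrite /A'; case: ifP.
pose I := [fset s in iota 0 t]%fset.
have IE : [set` I] = `I_t.
  by apply/seteqP; split=> s; rewrite /= in_fset /= mem_iota.
have tI : t \notin I by rewrite in_fset /= mem_iota; lia.
have A'E s : s \in I -> A' s = A s.
  by rewrite /A' in_fset /= mem_iota; case: eqP => // ->; lia.
have -> : \bigcap_(s in `I_t) (xi s @^-1` A s) `&` xi t @^-1` B =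
    \bigcap_(s in [set` (t |` I)%fset]) (xi s @^-1` A' s).
  rewrite -IE; apply/seteqP; split=> o /=.
    move=> [h hB] s /=; rewrite in_fset1U => /predU1P[->|sI].
      by rewrite /A' eqxx.
    by rewrite /= A'E//; exact: h.
  move=> h; split=> [s /= sI|].
    by have := h s; rewrite /= in_fset1U sI orbT A'E//; exact.
  by have := h t; rewrite /= in_fset1U eqxx /A' eqxx; exact.
rewrite indep// big_fsetU1//= {1}/A' eqxx muleC -(law t)//; congr (_ * _)%E.
by rewrite -IE indep//; apply: eq_big_seq => s sI; rewrite A'E.
Qed.

(** Both sides are finite measures in [E] that agree on the pi-system of rectangles, hence on the
    sigma-algebra it generates. *)
Lemma history_indep t (E : set Om) B : <<s history_sets t >> E -> measurable B ->
  P (E `&` xi t @^-1` B) = (P E * mu B)%E.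
Proof.
move=> mE mB.
have mxB : measurable (xi t @^-1` B) by exact: measurable_preimage_RV.
pose m1 : {measure set Om -> \bar R} := mrestr P mxB.
pose b := NngNum (fine_ge0 (measure_ge0 mu B)).
pose m2 : {measure set Om -> \bar R} := mscale b P.
have m2E C : m2 C = (P C * mu B)%E.
  by rewrite /m2 /= /mscale /= muleC fineK// fin_num_measure.
suff : m1 E = m2 E by rewrite m2E.
apply: (g_sigma_algebra_measure_unique (history_sets t)
  (@history_sets_measurable t) (fun=> setT)) => //.
- by move=> _; exact: history_setT.
- by rewrite bigcup_const.
- exact: history_setI_closed.
- move=> _ [A mA ->]; rewrite m2E.
  exact: history_indep_rect.
- move=> _; rewrite /m1 /mrestr /=; apply: le_lt_trans (probability_le1 P _) (ltry 1).
  exact: measurableI.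
Qed.

(* The law of (history, xi t) is a product, so that a function of both can be
   averaged over [xi t] first. *)
Lemma integral_history_split t (h : history t * T -> \bar R) :
  measurable_fun setT h -> (forall p, 0 <= h p)%E ->
  (\int[P]_o h (o, xi t o) = \int[P]_o \int[mu]_s h (o, s))%E.
Proof.
move=> mh h0.
pose idM := isMeasurableFun.Build _ _ _ _ _ (@measurable_to_history t).
pose idRV : {RV P >-> history t} := HB.pack (id : Om -> history t) idM.
have mpair : measurable_fun setT (fun o : Om => (o : history t, xi t o)).
  by apply: measurable_fun_pair => //; exact: measurable_to_history.
pose pairM := isMeasurableFun.Build _ _ _ _ _ mpair.
pose pairRV : {RV P >-> (history t * T)%type} :=
  HB.pack (fun o : Om => (o : history t, xi t o)) pairM.
pose Ph := distribution P idRV.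
pose Pp := distribution P pairRV.
have PpE A : measurable A -> (Ph \x mu)%E A = Pp A.
  apply: product_measure_unique => E B mE mB.
  exact: (history_indep mE mB).
transitivity (\int[Pp]_p h p)%E.
  by rewrite ge0_integral_pushforward.
transitivity (\int[(Ph \x mu)%E]_p h p)%E.
  by apply: eq_measure_integral => A mA _; exact/esym/PpE.
rewrite fubini_tonelli1// ge0_integral_pushforward//.
  exact: measurable_fun_fubini_tonelli_F.
by move=> o _; apply: integral_ge0.
Qed.

End History.

(** * Light tails and martingales *)

Section ExpInequalities.
Context {R : realType}.
Implicit Types x p q u : R.

(** The chord of exp between 0 and [q], obtained by averaging at these two points the tangent
    inequality at [p * q]. *)
Lemma expR_convex_tangent p q : 0 <= p <= 1 -> expR (p * q) <= 1 + p * (expR q - 1).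
Proof.
move=> /andP[p0 p1].
have [->|p_neq0] := eqVneq p 0; first by rewrite !mul0r expR0 addr0.
have h1 := expR_ge1Dx (q - p * q); have h2 := expR_ge1Dx (- (p * q)).
have e1 : expR (p * q) * expR (q - p * q) = expR q by rewrite -expRD addrC subrK.
have e2 : expR (p * q) * expR (- (p * q)) = 1 by rewrite -expRD subrr expR0.
have := expR_gt0 (p * q); move: h1 h2 e1 e2.
move: (expR (p * q)) (expR q) (expR _) (expR _) => A B C D h1 h2 e1 e2 A0.
have H1 : p * (A * (1 + (q - p * q))) <= p * B.
  by rewrite ler_wpM2l// -e1 ler_pM2l.
have H2 : (1 - p) * (A * (1 - p * q)) <= 1 - p.
  rewrite -[leRHS]mulr1 ler_wpM2l ?subr_ge0//.
  by rewrite -[leRHS]e2 ler_pM2l.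
by move: H1 H2; lra.
Qed.

(** The factor 2 keeps the proof elementary: x <= 2 x^2 for x >= 1/2, and below that exp(-x/2) >= 1
    - x/2 > 0 bounds exp x by a rational function. It is the 2 of the exponential moment bound. *)
Lemma expR_le_xDexp_sqr x : expR x <= x + expR (2 * x ^+ 2).
Proof.
have [xlt|xge] := ltP x (1 / 2).
  have y0 : 0 < 1 - x / 2 by lra.
  have h1 : 1 - x / 2 <= expR (- (x / 2)) by have := expR_ge1Dx (- (x / 2)).
  have h2 : expR x * expR (- (x / 2)) ^+ 2 = 1.
    by rewrite -expRM_natl -expRD -expR0; congr expR; field.
  have h3 : expR x * (1 - x / 2) ^+ 2 <= 1.
    by rewrite -[leRHS]h2 ler_pM2l ?expR_gt0// ler_sqr ?nnegrE ?expR_ge0// ltW.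
  have := expR_ge1Dx (2 * x ^+ 2).
  suff : expR x <= 1 + x + 2 * x ^+ 2 by lra.
  rewrite -(ler_pM2r (exprn_gt0 2 y0)); apply: (le_trans h3).
  have : 0 <= x ^+ 2 * ((1 - x) * (5 / 2 - x)).
    by rewrite mulr_ge0 ?sqr_ge0// mulr_ge0; lra.
  lra.
have : expR x <= expR (2 * x ^+ 2) by rewrite ler_expR; nra.
lra.
Qed.

(** |u| <= (1 + u^2)/2 and u^2 <= exp(u^2 - 1). The constants are such that E exp(u^2) <= e yields
    E|u| <= 1. *)
Lemma abs_le_exp_sqr u : `|u| <= 1 / 2 + 1 / 2 / expR 1 * expR (u ^+ 2).
Proof.
have := expR_ge1Dx (u ^+ 2 - 1); rewrite expRD expRN => h.
have -> : 1 / 2 / expR 1 * expR (u ^+ 2) = (expR (u ^+ 2) / expR 1) / 2 :> R by lra.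
have := sqr_ge0 (`|u| - 1); rewrite sqrrB mulr1 expr1n real_normK ?num_real//; lra.
Qed.

End ExpInequalities.

Section LightTail.
Context {R : realType} {d : measure_display} {T : measurableType d}.
Variable mu : probability T R.
Implicit Types (h X Y g a : T -> R).

(** The device behind all light-tail estimates: a pointwise bound, affine in a centered [X] and in
    an exponential [Y] of mean at most e, is integrated. *)
Lemma integral_le_affine h X Y (a b c : R) :
  measurable_fun setT h -> (forall s, 0 <= h s) ->
  mu.-integrable setT (EFin \o X) -> \int[mu]_s X s = 0 ->
  measurable_fun setT Y -> (forall s, 0 <= Y s) ->
  (\int[mu]_s (Y s)%:E <= (expR 1)%:E)%E -> 0 <= c ->
  (forall s, h s <= a * X s + b + c * Y s) ->
  (\int[mu]_s (h s)%:E <= (b + c * expR 1)%:E)%E.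
Proof.
move=> mh h0 iX X0 mY Y0 Ye c0 hle.
have iY : mu.-integrable setT (EFin \o Y).
  apply/integrableP; split; first exact: measurableT_comp.
  apply: le_lt_trans (ltry (expR 1)); apply: le_trans Ye.
  under eq_integral do rewrite /= ger0_norm//.
  exact: lexx.
have iaX : mu.-integrable setT (EFin \o (fun s => a * X s)).
  exact: (integrableZl measurableT a iX).
have icY : mu.-integrable setT (EFin \o (fun s => c * Y s)).
  exact: (integrableZl measurableT c iY).
have ib : mu.-integrable setT (EFin \o (fun=> b)).
  exact: finite_measure_integrable_cst.
have iaXb : mu.-integrable setT (EFin \o (fun s => a * X s + b)).
  exact: (integrableD measurableT iaX ib).
apply: (@le_trans _ _ (\int[mu]_s (a * X s + b + c * Y s)%:E)%E).
  apply: ge0_le_integral => //=.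
  - by move=> s _; rewrite lee_fin.
  - exact: measurableT_comp.
  - by apply/measurable_EFinP; apply: measurable_funD;
      [apply/measurable_EFinP; exact: measurable_int iaXb|exact: measurable_funM].
  - by move=> s _; rewrite lee_fin.
rewrite (integralD_EFin measurableT iaXb icY) (integralD_EFin measurableT iaX ib).
rewrite /=; under eq_integral do rewrite EFinM.
rewrite integralZl// integral_cst//= probability_setT mule1.
under [X in (_ + X)%E]eq_integral do rewrite EFinM.
rewrite ge0_integralZl//; last 2 first.
- exact: measurableT_comp.
- by move=> s _; rewrite lee_fin.
have -> : (\int[mu]_s (X s)%:E = 0)%E.
  by rewrite -(fineK (integrable_fin_num measurableT iX)) [fine _]X0.
rewrite mule0 add0e EFinD EFinM leeD2l// lee_pmul//.
by apply: integral_ge0 => s _; rewrite lee_fin.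
Qed.

Lemma le_normr_Rintegral_tail g a (K : R) : 0 <= K ->
  measurable_fun setT g -> measurable_fun setT a ->
  (forall s, `|g s| <= K * a s) ->
  (\int[mu]_s (expR (a s ^+ 2))%:E <= (expR 1)%:E)%E ->
  mu.-integrable setT (EFin \o g) /\ `|\int[mu]_s g s| <= K.
Proof.
move=> K0 mg ma ga ta.
have : (\int[mu]_s `|g s|%:E <= (K / 2 + K / 2 / expR 1 * expR 1)%:E)%E.
  apply: (@integral_le_affine _ (fun=> 0) (fun s => expR (a s ^+ 2)) 0) => //.
  - exact: measurableT_comp.
  - exact: integrable0.
  - by rewrite /Rintegral integral0.
  - by apply: measurableT_comp => //; exact: measurable_funX.
  - by apply: divr_ge0; [exact: divr_ge0|exact: expR_ge0].
  - move=> s; apply: le_trans (ga s) _.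
    apply: le_trans (ler_wpM2l K0 (le_trans (ler_norm _) (abs_le_exp_sqr _))) _.
    by rewrite mulr0 add0r; lra.
rewrite divfK ?gt_eqF ?expR_gt0// -splitr => gK.
have ig : mu.-integrable setT (EFin \o g).
  apply/integrableP; split; first exact: measurableT_comp.
  exact: le_lt_trans gK (ltry K).
split=> //; rewrite -lee_fin; apply: le_trans gK.
by rewrite EFin_normr_Rintegral//; apply: le_abse_integral => //; exact: measurableT_comp.
Qed.

(** Centering doubles the scale: (g - c)^2 <= 2 g^2 + 2 c^2 <= 2 K^2 (a^2 + 1), which divided by 4
    K^2 is 1 + (a^2 - 1)/2. The chord inequality with p = 1/2 restores the bound e. *)
Lemma centered_tail g a (K : R) : 0 < K ->
  measurable_fun setT g -> measurable_fun setT a ->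
  (forall s, `|g s| <= K * a s) ->
  (\int[mu]_s (expR (a s ^+ 2))%:E <= (expR 1)%:E)%E ->
  (\int[mu]_s (expR ((g s - \int[mu]_s g s) ^+ 2 / (2 * K) ^+ 2))%:E <= (expR 1)%:E)%E.
Proof.
move=> K0 mg ma ga ta.
have [ig cK] := le_normr_Rintegral_tail (ltW K0) mg ma ga ta.
set c := \int[mu]_s g s in cK *.
have e0 := expR_gt0 (1 : R).
have -> : (expR 1 = expR 1 / 2 + 1 / 2 * expR 1 :> R) by lra.
apply: (@integral_le_affine _ (fun=> 0) (fun s => expR (a s ^+ 2)) 0) => //.
- apply: measurableT_comp => //; apply: measurable_funM => //.
  by apply: measurable_funX; apply: measurable_funB.
- exact: integrable0.
- by rewrite /Rintegral integral0.
- by apply: measurableT_comp => //; exact: measurable_funX.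
move=> s; rewrite mulr0 add0r.
have h1 : (g s - c) ^+ 2 / (2 * K) ^+ 2 <= 1 + 1 / 2 * (a s ^+ 2 - 1).
  rewrite ler_pdivrMr ?exprn_gt0 ?mulr_gt0//.
  have : g s ^+ 2 <= (K * a s) ^+ 2.
    by rewrite -[g s ^+ 2]real_normK ?num_real// ler_sqr ?nnegrE// (le_trans _ (ga s)).
  have : c ^+ 2 <= K ^+ 2.
    by rewrite -[c ^+ 2]real_normK ?num_real// ler_sqr ?nnegrE// ltW.
  have := sqr_ge0 (g s + c); nra.
apply: (@le_trans _ _ (expR (1 + 1 / 2 * (a s ^+ 2 - 1)))); first by rewrite ler_expR.
rewrite expRD.
have /(expR_convex_tangent (a s ^+ 2 - 1)) : 0 <= (1 / 2 : R) <= 1 by lra.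
rewrite -(ler_pM2l e0) => /le_trans; apply.
have : expR 1 * expR (a s ^+ 2 - 1) = expR (a s ^+ 2) by rewrite -expRD addrC subrK.
lra.
Qed.

Lemma mgf_light_tail X (sg lam : R) : 0 < sg ->
  mu.-integrable setT (EFin \o X) -> \int[mu]_s X s = 0 ->
  (\int[mu]_s (expR (X s ^+ 2 / sg ^+ 2))%:E <= (expR 1)%:E)%E ->
  (\int[mu]_s (expR (lam * X s))%:E <= (expR (2 * lam ^+ 2 * sg ^+ 2))%:E)%E.
Proof.
move=> sg0 iX X0 tX; set p := 2 * lam ^+ 2 * sg ^+ 2.
have mX : measurable_fun setT X by apply/measurable_EFinP; exact: measurable_int iX.
have p0 : 0 <= p by rewrite /p mulr_ge0 ?sqr_ge0// mulr_ge0 ?sqr_ge0.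
have e0 := expR_gt0 (1 : R).
pose Y s := expR (X s ^+ 2 / sg ^+ 2).
have mY : measurable_fun setT Y.
  by apply: measurableT_comp => //; apply: measurable_funM => //; exact: measurable_funX.
have mE : measurable_fun setT (fun s => expR (lam * X s)).
  by apply: measurableT_comp => //; exact: measurable_funM.
have Ye s : expR (X s ^+ 2 / sg ^+ 2 - 1) = Y s / expR 1 by rewrite expRD expRN.
have Y0 s : 0 <= Y s by exact: expR_ge0.
(* For [p <= 1], exp(lam X) <= lam X + exp(p X^2/sg^2): the linear part has mean zero and the chord
   inequality bounds the other mean by exp p. For [p > 1] the bound lam X <= p/4 + X^2/(2 sg^2) is
   enough, as p/4 + 1/2 <= p. *)
have [p1|p1] := leP p 1.
  have -> : expR p = expR p * (1 - p) + expR p * p / expR 1 * expR 1.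
    by rewrite divfK ?gt_eqF//; ring.
  apply: (@integral_le_affine _ X Y lam) => //.
  - by rewrite divr_ge0 ?expR_ge0// mulr_ge0 ?expR_ge0.
  - move=> s; apply: le_trans (expR_le_xDexp_sqr _) _; rewrite -addrA lerD2l.
    have -> : 2 * (lam * X s) ^+ 2 = p + p * (X s ^+ 2 / sg ^+ 2 - 1).
      by rewrite /p; field; rewrite gt_eqF.
    have /(expR_convex_tangent (X s ^+ 2 / sg ^+ 2 - 1)) : 0 <= p <= 1 by rewrite p0.
    rewrite Ye -(ler_pM2l (expR_gt0 p)) -expRD => /le_trans; apply.
    by rewrite -subr_ge0 le_eqVlt; apply/orP; left; apply/eqP; ring.
apply: (@le_trans _ _ (expR (p / 4 + 1 / 2))%:E); last first.
  by rewrite lee_fin ler_expR; lra.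
set C := expR _.
have -> : C = C / 2 + C / 2 / expR 1 * expR 1 by rewrite divfK ?gt_eqF//; lra.
apply: (@integral_le_affine _ X Y 0) => //.
- by rewrite divr_ge0 ?expR_ge0// divr_ge0 ?expR_ge0.
move=> s; rewrite mul0r add0r.
have h : lam * X s <= p / 4 + 1 / 2 + 1 / 2 * (X s ^+ 2 / sg ^+ 2 - 1).
  have := sqr_ge0 (lam * sg - X s / sg).
  have -> : (lam * sg - X s / sg) ^+ 2 = p / 2 - 2 * (lam * X s) + X s ^+ 2 / sg ^+ 2.
    by rewrite /p; field; rewrite gt_eqF.
  lra.
move: h; rewrite -ler_expR => /le_trans; apply.
rewrite expRD -/C.
have /(expR_convex_tangent (X s ^+ 2 / sg ^+ 2 - 1)) : 0 <= (1 / 2 : R) <= 1 by lra.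
rewrite Ye -(ler_pM2l (expR_gt0 _ : 0 < C)) => /le_trans; apply.
lra.
Qed.

End LightTail.

Lemma le_markov {R : realType} {d} {Om : measurableType d} (P : probability Om R)
    (f : Om -> R) (b c : R) :
  measurable_fun setT f -> (forall o, 0 <= f o) -> 0 < b ->
  (\int[P]_o (f o)%:E <= c%:E)%E -> (P [set o | (b <= f o)%R] <= (c / b)%:E)%E.
Proof.
move=> mf f0 b0 fc; set A := [set o | b <= f o].
have mA : measurable A.
  rewrite (_ : A = f @^-1` `[b, +oo[); last first.
    by apply/seteqP; split=> o /=; rewrite in_itv/= andbT.
  by rewrite -[X in measurable X]setTI; exact: mf.
have mfA : measurable_fun A (EFin \o f).
  by apply: measurable_funTS; exact: measurableT_comp.
rewrite mulrC EFinM lee_pdivlMl//; apply: le_trans fc.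
apply: (@le_trans _ _ (\int[P]_(o in A) (f o)%:E)%E); last first.
  apply: ge0_subset_integral => //; first exact: measurableT_comp.
  by move=> o _; rewrite lee_fin.
rewrite -integral_cst//; apply: ge0_le_integral => //.
by move=> o _; rewrite lee_fin ltW.
Qed.

(** * Exponential bound for martingales driven by the samples *)

Section MartingaleTail.
Context {R : realType} {dO dT : measure_display} {Om : measurableType dO}
  {T : measurableType dT} {P : probability Om R}.
Variables (mu : probability T R) (xi : nat -> {RV P >-> T}).
Hypothesis iid_xi : iid mu xi.

Lemma measurable_history_le s t : (s <= t)%N ->
  measurable_fun setT (id : history xi t -> history xi s).
Proof.
move=> /subnK <-; elim: (t - s)%N => [|k IH]; first exact: measurable_id.
rewrite addSn.
exact: (measurableT_comp IH (@measurable_history_prev _ _ _ _ _ _ xi (k + s))).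
Qed.

Lemma measurable_history_sample s t : (s < t)%N ->
  measurable_fun setT (xi s : history xi t -> T).
Proof.
move=> st.
exact: (measurableT_comp (@measurable_history_last _ _ _ _ _ _ xi s) (measurable_history_le st)).
Qed.

Lemma measurable_history_pair s t : (s < t)%N ->
  measurable_fun setT (fun o : history xi t => (o : history xi s, xi s o)).
Proof.
move=> st; apply: measurable_fun_pair; last exact: measurable_history_sample.
exact: measurable_history_le (ltnW st).
Qed.

Lemma measurable_history_Om t d' (S : measurableType d') (f : history xi t -> S) :
  measurable_fun setT f -> measurable_fun setT (f : Om -> S).
Proof. by move=> mf; exact: (measurableT_comp mf (@measurable_to_history _ _ _ _ _ _ xi t)). Qed.

Variables (g : forall s, history xi s * T -> R) (sg : nat -> R).
Hypotheses (mg : forall s, measurable_fun setT (@g s))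
  (ig : forall s o, mu.-integrable setT (fun v => (@g s (o, v))%:E))
  (sg0 : forall s, 0 < sg s).
(** The conditional mean of the increment given the past. *)
Let c s (o : history xi s) := \int[mu]_v @g s (o, v).
Hypothesis tg : forall s o,
  (\int[mu]_v (expR ((@g s (o, v) - @c s o) ^+ 2 / sg s ^+ 2))%:E <= (expR 1)%:E)%E.

Let S t (o : Om) := \sum_(s < t) (@g s (o, xi s o) - @c s o).

Let mincr s : measurable_fun setT (fun p : history xi s * T => @g s p - @c s p.1).
Proof.
apply: measurable_funB => //.
exact: (measurableT_comp (measurable_Rintegral_section mu (@mg s)) measurable_fst).
Qed.

Let mS t : measurable_fun setT (S t : history xi t -> R).
Proof.
apply: measurable_sum => -[s /= st].
exact: (measurableT_comp (@mincr s) (measurable_history_pair st)).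
Qed.

(** The last increment is averaged over the fresh sample while the past is frozen, and
    [mgf_light_tail] applies to it uniformly in the past. *)
Let mgfS lam t :
  (\int[P]_o (expR (lam * S t o))%:E <= (expR (2 * lam ^+ 2 * \sum_(s < t) sg s ^+ 2))%:E)%E.
Proof.
elim: t => [|t IH].
  rewrite big_ord0 mulr0 expR0.
  under eq_integral do rewrite /S big_ord0 mulr0 expR0.
  by rewrite integral_cst//= probability_setT mule1.
pose h (p : history xi t * T) :=
  (expR (lam * S t p.1) * expR (lam * (@g t p - @c t p.1)))%:E.
have mexp : measurable_fun setT (fun o : history xi t => expR (lam * S t o)).
  by apply: measurableT_comp => //; apply: measurable_funM.
have mh : measurable_fun setT h.
  apply: measurableT_comp => //; apply: measurable_funM.
    exact: (measurableT_comp mexp measurable_fst).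
  by apply: measurableT_comp => //; apply: measurable_funM.
have h0 p : (0 <= h p)%E by rewrite lee_fin mulr_ge0 ?expR_ge0.
have -> : (\int[P]_o (expR (lam * S t.+1 o))%:E = \int[P]_o h (o, xi t o))%E.
  by apply: eq_integral => o _; rewrite /h /S big_ord_recr /= mulrDr expRD.
rewrite (integral_history_split iid_xi mh h0).
set B := expR (2 * lam ^+ 2 * sg t ^+ 2).
apply: (@le_trans _ _ (\int[P]_o (expR (lam * S t o) * B)%:E)%E).
  apply: ge0_le_integral => //.
  - by move=> o _; apply: integral_ge0.
  - apply: measurable_history_Om.
    exact: measurable_fun_fubini_tonelli_F.
  - apply: measurableT_comp => //; apply: measurable_funM => //.
    exact: measurable_history_Om mexp.
  - move=> o _; rewrite /h /=; under eq_integral do rewrite EFinM.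
    have mv : measurable_fun setT (fun v => expR (lam * (@g t (o, v) - @c t o))).
      apply: measurableT_comp => //; apply: measurable_funM => //.
      apply: measurable_funB => //.
      exact: (measurableT_comp (@mg t) (@pair1_measurable _ _ _ _ (o : history xi t))).
    rewrite ge0_integralZl//; last exact: measurableT_comp.
    rewrite EFinM lee_pmul2l ?lte_fin ?expR_gt0//.
    have ic : mu.-integrable setT (EFin \o (fun=> @c t o)).
      exact: finite_measure_integrable_cst.
    apply: mgf_light_tail => //.
    - exact: (integrableB measurableT (@ig t o) ic).
    - rewrite RintegralB//; last exact: ig.
      by rewrite Rintegral_cst//= probability_setT mulr1 subrr.
under eq_integral do rewrite mulrC EFinM.
rewrite ge0_integralZl ?lee_fin ?expR_ge0//; last first.
  by apply: measurableT_comp => //; exact: measurable_history_Om mexp.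
rewrite big_ord_recr /= mulrDr [in leRHS]addrC expRD EFinM.
by rewrite lee_pmul2l ?lte_fin ?expR_gt0.
Qed.

Lemma martingale_tail t (u : R) : 0 < \sum_(s < t) sg s ^+ 2 ->
  0 < u ->
  (P [set o | (u <= \sum_(s < t) (@g s (o, xi s o) - \int[mu]_v @g s (o, v)))%R] <=
    (expR (- (u ^+ 2 / (8 * \sum_(s < t) sg s ^+ 2))))%:E)%E.
Proof.
set V := \sum_(s < t) sg s ^+ 2 => V0 u0.
(* The minimizer of 2 lam^2 V - lam u, whose minimum is -u^2/(8V). *)
pose lam := u / (4 * V).
have lam0 : 0 < lam by rewrite divr_gt0 ?mulr_gt0.
have mf : measurable_fun setT (fun o : Om => expR (lam * S t o)).
  apply: measurableT_comp => //; apply: measurable_funM => //.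
  exact: measurable_history_Om (@mS t).
have := le_markov mf (fun o => expR_ge0 _) (expR_gt0 (lam * u)) (mgfS lam t).
rewrite -/V -expRN -expRD.
have -> : 2 * lam ^+ 2 * V - lam * u = - (u ^+ 2 / (8 * V)).
  by rewrite /lam; field; rewrite gt_eqF.
apply: le_trans; rewrite le_eqVlt; apply/orP; left; apply/eqP; congr (P _).
by apply/seteqP; split=> o /=; rewrite ler_expR ler_pM2l.
Qed.

Lemma measurable_martingale t : measurable_fun setT
  (fun o : Om => \sum_(s < t) (@g s (o, xi s o) - \int[mu]_v @g s (o, v))).
Proof. exact: measurable_history_Om (@mS t). Qed.

End MartingaleTail.

Section WeightedTail.
Context {R : realType} {dO dT : measure_display} {Om : measurableType dO}
  {T : measurableType dT} {P : probability Om R}.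
Variables (mu : probability T R) (xi : nat -> {RV P >-> T}).
Hypothesis iid_xi : iid mu xi.
Variables (g : forall s, history xi s * T -> R) (w : nat -> R).
Hypotheses (mg : forall s, measurable_fun setT (@g s)) (w0 : forall s, 0 <= w s).
Hypothesis tg : forall s o,
  (\int[mu]_v (expR (@g s (o, v)))%:E <= (expR 1)%:E)%E.

Let mE s : measurable_fun setT (fun o : Om => expR (@g s (o, xi s o))).
Proof.
apply: measurableT_comp => //.
apply: measurable_history_Om.
exact: (measurableT_comp (@mg s) (measurable_history_pair (ltnSn s))).
Qed.

(* Jensen's inequality for [expR] bounds the exponential of the weighted mean
   by the mean of the exponentials, so no independence is used across terms. *)
Lemma weighted_mean_tail t (l : R) : 0 < \sum_(s < t) w s ->
  (P [set o | ((1 + l) * \sum_(s < t) w s < \sum_(s < t) w s * @g s (o, xi s o))%R] <=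
     (expR (- l))%:E)%E.
Proof.
set W := \sum_(s < t) w s => W0.
pose f o := \sum_(s < t) w s / W * expR (@g s (o, xi s o)).
have mf : measurable_fun setT (f : Om -> R).
  by apply: measurable_sum => s; apply: measurable_funM => //; exact: mE.
have f0 o : 0 <= f o.
  by apply: sumr_ge0 => s _; rewrite mulr_ge0 ?expR_ge0// divr_ge0// ltW.
have intf : (\int[P]_o (f o)%:E <= (expR 1)%:E)%E.
  under eq_integral do rewrite /f -sumEFin.
  rewrite ge0_integral_sum//; last 2 first.
  - by move=> s; apply: measurableT_comp => //; apply: measurable_funM => //; exact: mE.
  - by move=> s o _; rewrite lee_fin mulr_ge0 ?expR_ge0// divr_ge0// ltW.
  apply: (@le_trans _ _ (\sum_(s < t) (w s / W)%:E * (expR 1)%:E)%E).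
    apply: lee_sum => s _; under eq_integral do rewrite EFinM.
    rewrite ge0_integralZl//; last 2 first.
    - by apply: measurableT_comp => //; exact: mE.
    - by rewrite lee_fin divr_ge0// ltW.
    apply: lee_wpmul2l; first by rewrite lee_fin divr_ge0// ltW.
    pose h (p : history xi s * T) := (expR (@g s p))%:E.
    have mh : measurable_fun setT h by do 2 apply: measurableT_comp => //.
    rewrite (_ : (\int[P]_o _)%E = (\int[P]_o h (o, xi s o))%E)//.
    rewrite (integral_history_split iid_xi mh); last by move=> p; rewrite lee_fin expR_ge0.
    rewrite -[leRHS]mule1 -(probability_setT P) -integral_cst//.
    apply: ge0_le_integral => //.
    - by move=> o _; apply: integral_ge0 => v _; rewrite lee_fin expR_ge0.
    - apply: measurable_history_Om; apply: measurable_fun_fubini_tonelli_F => //.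
      by move=> p; rewrite lee_fin expR_ge0.
    - by move=> o _; exact: tg.
  rewrite -ge0_sume_distrl; last by move=> s _; rewrite lee_fin divr_ge0// ltW.
  by rewrite sumEFin -mulr_suml -/W mulfV ?gt_eqF// mul1e.
have := le_markov mf f0 (expR_gt0 (1 + l)) intf.
rewrite -expRN -expRD opprD addrA subrr add0r; apply: le_trans.
apply: le_measure.
- rewrite inE (_ : [set _ | _] = (fun o : Om => \sum_(s < t) w s * @g s (o, xi s o)) @^-1`
      `](1 + l) * W, +oo[); last by apply/seteqP; split=> o /=; rewrite in_itv/= andbT.
  rewrite -[X in measurable X]setTI; apply: (measurable_sum _ _) => //= s.
  apply: measurable_funM => //; apply: measurable_history_Om.
  exact: (measurableT_comp (@mg s) (measurable_history_pair (ltnSn s))).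
- rewrite inE (_ : [set _ | _] = f @^-1` `[expR (1 + l), +oo[); last first.
    by apply/seteqP; split=> o /=; rewrite in_itv/= andbT.
  by rewrite -[X in measurable X]setTI; exact: mf.
move=> o /= lo; apply: (@le_trans _ _ (expR ((\sum_(s < t) w s * @g s (o, xi s o)) / W))).
  by rewrite ler_expR ler_pdivlMr// ltW.
set m := _ / W.
have h : \sum_(s < t) w s / W * (expR m * (1 + (@g s (o, xi s o) - m))) = expR m.
  transitivity (\sum_(s < t) (expR m * (1 - m) / W * w s
      + expR m / W * (w s * @g s (o, xi s o)))).
    by apply: eq_bigr => s _; field; exact: lt0r_neq0.
  rewrite big_split /= -!mulr_sumr -/W.
  have -> : \sum_(s < t) w s * @g s (o, xi s o) = m * W by rewrite divfK ?lt0r_neq0.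
  by field; exact: lt0r_neq0.
rewrite -[leLHS]h; apply: ler_sum => s _; rewrite ler_wpM2l ?divr_ge0// ?(ltW W0)//.
rewrite -ler_pdivlMl ?expR_gt0// -expRN -expRD [- m + _]addrC; exact: expR_ge1Dx.
Qed.

End WeightedTail.

(** * The stochastic program *)

Section Simplex.
Context {R : realType} {n : nat}.

Lemma simplex_segment : segment_closed (simplex n : set 'rV[R]_n).
Proof.
move=> x y t [x0 x1] [y0 y1] /andP[t0 t1]; split=> [i|].
  by rewrite !mxE addr_ge0// mulr_ge0// subr_ge0.
under eq_bigr do rewrite !mxE.
by rewrite big_split /= -!mulr_sumr x1 y1 !mulr1 addrC subrK.
Qed.

Lemma simplex_compact : compact (simplex n : set 'rV[R]_n).
Proof.
apply: bounded_closed_compact.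
  exists 1; split=> // e e1 y [y0 y1] /=; apply: norm_le_coord => [|i]; first lra.
  rewrite ger0_norm//; apply: (@le_trans _ _ 1); last exact: ltW.
  by rewrite -y1 (bigD1 i)//= lerDl sumr_ge0.
have -> : (simplex n : set 'rV[R]_n) =
    \bigcap_(i in [set: 'I_n]) [set y : 'rV[R]_n | 0 <= y 0 i]
    `&` [set y : 'rV[R]_n | dot (const_mx 1) y = 1].
  have E (y : 'rV[R]_n) : dot (const_mx 1) y = \sum_i y 0 i.
    by apply: eq_bigr => i _; rewrite mxE mul1r.
  apply/seteqP; split=> y /=; rewrite E => -[h1 h2]; split=> //.
    by move=> i _; exact: h1.
  by move=> i; exact: h1.
apply: closedI.
  apply: closed_bigI => i _.
  rewrite (_ : [set _ | _] = (fun y : 'rV[R]_n => y 0 i) @^-1` [set x | 0 <= x])//.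
  by apply: closed_comp => [y _|]; [exact: coord_continuous|exact: closed_ge].
rewrite (_ : [set _ | _] = dot (const_mx 1) @^-1` [set (1 : R)])//.
by apply: closed_comp => [y _|]; [exact: dot_continuous|exact: closed_eq].
Qed.

Lemma simplex_delta (i : 'I_n) : simplex n (delta_mx 0 i : 'rV[R]_n).
Proof.
split=> [j|]; first by rewrite mxE /= ler0n.
rewrite (bigD1 i)//= big1 ?addr0 => [|j /negPf ji]; last by rewrite mxE ji.
by rewrite mxE !eqxx.
Qed.

Lemma dot_delta (u : 'rV[R]_n) i : dot u (delta_mx 0 i) = u 0 i.
Proof.
rewrite /dot (bigD1 i)//= big1 ?addr0 => [|j /negPf ji].
  by rewrite mxE !eqxx mulr1.
by rewrite mxE ji mulr0.
Qed.

Lemma dot_simplex_le (u y : 'rV[R]_n) (c : R) : simplex n y ->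
  (forall i, u 0 i <= c) -> dot u y <= c.
Proof.
move=> [y0 y1] uc; rewrite -[leRHS]mulr1 -y1 mulr_sumr.
by apply: ler_sum => i _; rewrite ler_wpM2r.
Qed.

End Simplex.

Section VectorIntegral.
Context {R : realType} {d : measure_display} {T : measurableType d}.
Variable mu : probability T R.

Lemma eq_integrableT (f g : T -> \bar R) : f =1 g ->
  mu.-integrable setT f -> mu.-integrable setT g.
Proof. by move=> fg; apply: eq_integrable => // v _. Qed.

Lemma Rintegral_dot n (f : T -> 'rV[R]_n) (h : 'rV[R]_n) :
  (forall i, mu.-integrable setT (fun v => (f v 0 i)%:E)) ->
  mu.-integrable setT (fun v => (dot (f v) h)%:E) /\
  \int[mu]_v dot (f v) h = dot (\row_i \int[mu]_v f v 0 i) h.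
Proof.
move=> fi.
have fih i : mu.-integrable setT (fun v => (f v 0 i * h 0 i)%:E).
  apply: eq_integrableT (integrableZl measurableT (h 0 i) (fi i)) => v.
  by rewrite -EFinM mulrC.
have -> : dot (\row_i \int[mu]_v f v 0 i) h = \sum_i \int[mu]_v (f v 0 i * h 0 i).
  by apply: eq_bigr => i _; rewrite mxE RintegralZr//; exact: fi.
rewrite /dot; elim: (index_enum _) => [|i r [IH1 IH2]].
  under eq_fun do rewrite big_nil.
  split; first exact: integrable0.
  by under eq_Rintegral do rewrite big_nil; rewrite big_nil /Rintegral integral0.
have E : (fun v => \sum_(j <- i :: r) f v 0 j * h 0 j) =
         (fun v => f v 0 i * h 0 i + \sum_(j <- r) f v 0 j * h 0 j).
  by apply/funext => v; rewrite big_cons.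
split.
  by apply: eq_integrableT (integrableD measurableT (fih i) IH1) => v; rewrite big_cons.
rewrite E RintegralD//; last exact: fih.
by rewrite big_cons IH2.
Qed.

End VectorIntegral.

Section SOECFacts.
Context {R : realType} {d m : nat} {q : 'I_m.+1 -> nat}.
Variables (X : set 'rV[R]_d) (mu : probability (samples R q) R)
  (F : forall i : 'I_m.+1, 'rV[R]_d -> 'rV[R]_(q i) -> R) (rc : 'I_m -> R)
  (F' : forall i : 'I_m.+1, 'rV[R]_d -> 'rV[R]_(q i) -> 'rV[R]_d)
  (Xi : forall i : 'I_m.+1, set 'rV[R]_(q i)) (r : R).
Hypothesis soec : soec_assumptions X mu F rc Xi.

Local Notation Phi := (Phi F rc r).
Local Notation phi := (phi mu F rc r).
Local Notation Gy := (Gy F rc r).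
Local Notation gy := (gy mu F rc r).
Local Notation P := (Plevel mu F rc r).

Lemma PhiE x y v : Phi x y v = dot (Gy x v) y.
Proof. by apply: eq_bigr => i _; rewrite mxE mulrC. Qed.

Lemma Gy_integrable x i : X x -> mu.-integrable setT (fun v => (Gy x v 0 i)%:E).
Proof.
move=> Xx.
apply: eq_integrableT (integrableB measurableT (soec_F_integrable soec i Xx)
  (finite_measure_integrable_cst mu (level rc r i) measurableT)) => v.
by rewrite mxE.
Qed.

Lemma phiE x y : X x -> phi x y = dot (gy x) y.
Proof.
move=> Xx; have [_ <-] := Rintegral_dot y (fun i => Gy_integrable i Xx).
by apply: eq_Rintegral => v _; rewrite PhiE.
Qed.

Lemma gyE x i : X x -> gy x 0 i = fmean mu F i x - level rc r i.
Proof.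
move=> Xx; rewrite mxE.
under eq_Rintegral do rewrite mxE.
rewrite RintegralB//; last 2 first.
- exact: (soec_F_integrable soec i Xx).
- exact: finite_measure_integrable_cst.
by rewrite Rintegral_cst//= probability_setT mulr1.
Qed.

Lemma level0 : level rc r ord0 = r.
Proof. by rewrite /level unlift_none. Qed.

Lemma levelS j : level rc r (lift ord0 j) = rc j.
Proof. by rewrite /level liftK. Qed.

Lemma gy_le_Plevel x i : X x -> gy x 0 i <= P x.
Proof.
move=> Xx; rewrite gyE//; case: (unliftP ord0 i) => [j|] ->.
  by rewrite levelS; apply: (le_bigmax _ (fun j => fmean mu F (lift ord0 j) x - rc j)).
by rewrite level0; exact: bigmax_ge_id.
Qed.

(** The maximum over the simplex is attained at a vertex, so one vertex serves as the test point
    y. *)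
Lemma Plevel_vertex x : X x -> exists i, P x = gy x 0 i.
Proof.
move=> Xx; rewrite /Plevel; elim/big_rec : _ => [|j v _ [i ->]].
  by exists ord0; rewrite gyE// level0.
have [_|_] := leP (fmean mu F (lift ord0 j) x - rc j) (gy x 0 i); first by exists i.
by exists (lift ord0 j); rewrite gyE// levelS.
Qed.

Lemma H_argmin : exists2 x, X x & H X mu F rc r = P x /\ (forall x', X x' -> P x <= P x').
Proof.
have [x [Xx minx]] := soec_H_attained soec r; exists x => //; split=> //.
apply/eqP; rewrite eq_le; apply/andP; split.
  by apply: ge_inf; [exists (P x) => _ [x' Xx' <-]; exact: minx|exists x].
by apply: lb_le_inf; [exists (P x), x|move=> _ [x' Xx' <-]; exact: minx].
Qed.

End SOECFacts.

Section AlmostEverywhere.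
Context {R : realType} {d : measure_display} {T : measurableType d}.
Variables (mu : probability T R) (E : set T).
Hypotheses (mE : measurable E) (muE : mu (~` E) = 0%E).

Lemma integral_eq_on_full (f g : T -> \bar R) :
  measurable_fun setT f -> measurable_fun setT g -> (forall v, E v -> f v = g v) ->
  (\int[mu]_v f v = \int[mu]_v g v)%E.
Proof.
move=> mf mg fg; apply: ae_eq_integral => //.
exists (~` E); split=> // [|v /= h Ev]; first exact: measurableC.
by apply: h => _; exact: fg.
Qed.

Lemma integrable_eq_on_full (f g : T -> R) :
  measurable_fun setT g -> (forall v, E v -> f v = g v) ->
  mu.-integrable setT (EFin \o f) ->
  mu.-integrable setT (EFin \o g) /\ \int[mu]_v f v = \int[mu]_v g v.
Proof.
move=> mg fg /integrableP[mf f_fin]; split; last first.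
  congr fine; apply: integral_eq_on_full => // [|v /fg ->//].
  exact: measurableT_comp.
apply/integrableP; split; first exact: measurableT_comp.
rewrite (_ : integral _ _ _ = \int[mu]_v `|(EFin \o f) v|)%E//.
apply: integral_eq_on_full => [||v /fg /= ->//]; apply: measurableT_comp => //.
exact: measurableT_comp.
Qed.

End AlmostEverywhere.

(** * Measurability and moments of the stochastic subgradients *)

Section Oracle.
Context {R : realType} {d m : nat} {q : 'I_m.+1 -> nat}.
Variables (X : set 'rV[R]_d) (mu : probability (samples R q) R)
  (F : forall i : 'I_m.+1, 'rV[R]_d -> 'rV[R]_(q i) -> R) (rc : 'I_m -> R)
  (F' : forall i : 'I_m.+1, 'rV[R]_d -> 'rV[R]_(q i) -> 'rV[R]_d)
  (Xi : forall i : 'I_m.+1, set 'rV[R]_(q i)) (r : R).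
Variables (Nx : 'rV[R]_d -> R) (Ny : 'rV[R]_m.+1 -> R) (Mx My Q : R).
Hypotheses (soec : soec_assumptions X mu F rc Xi) (nNx : is_norm Nx) (nNy : is_norm Ny).
Hypothesis (lt : light_tail X mu F rc F' Xi r Nx Ny Mx My Q).

(** A measurable set of full measure replaces the supports, which need not be measurable
    themselves. *)
Lemma full_support : exists E : set (samples R q),
  [/\ measurable E, mu (~` E) = 0%E & forall v, E v -> forall i, Xi (v i)].
Proof.
have [A [mA A0 sA]] := soec_support soec.
exists (~` A); split; rewrite ?setCK//; first exact: measurableC.
by move=> v Av; apply: contrapT => nv; apply: Av; exact: sA.
Qed.

Lemma measurable_sample_coord i :
  measurable_fun setT (fun v : samples R q => v i : borel R (q i)).
Proof.
move=> _ B mB; rewrite setTI; apply: sub_sigma_algebra.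
by exists i => //; exists B => //; rewrite setTI.
Qed.

Variable E : set (samples R q).
Hypotheses (mE : measurable E) (muE : mu (~` E) = 0%E)
  (EXi : forall v, E v -> forall i, Xi (v i)).

(* [F] is only continuous in [x] for samples in the supports, which need not be
   measurable; it is cut off outside of [E]. *)
Definition Fcut (i : 'I_m.+1) (x : 'rV[R]_d) (v : samples R q) : R := F x (v i) * \1_E v.

Definition Gycut (x : 'rV[R]_d) (v : samples R q) : 'rV[R]_m.+1 :=
  \row_i (Fcut i x v - level rc r i).

Lemma FcutE i x v : E v -> Fcut i x v = F x (v i).
Proof. by move=> Ev; rewrite /Fcut indicE mem_set// mulr1. Qed.

Lemma GycutE x v : E v -> Gycut x v = Gy F rc r x v.
Proof. by move=> Ev; apply/rowP => i; rewrite !mxE FcutE. Qed.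

Lemma measurable_Fcut i x : X x -> measurable_fun setT (Fcut i x).
Proof.
move=> Xx; apply: measurable_funM => //.
have /measurable_int := soec_F_integrable soec i Xx.
by move/measurable_EFinP.
Qed.

Lemma continuous_Fcut i v : {within X, continuous ((Fcut i)^~ v)}.
Proof.
have [Ev|Ev] := pselect (E v).
  rewrite (_ : _ ^~ v = (fun x => F x (v i))); last by apply/funext => x; rewrite FcutE.
  by apply: (soec_F_continuous soec); exact: EXi.
rewrite (_ : _ ^~ v = cst 0); first by move=> x; exact: cvg_cst.
by apply/funext => x; rewrite /Fcut indicE memNset// mulr0.
Qed.

Lemma integrable_Gycut x i : X x ->
  mu.-integrable setT (fun v => (Gycut x v 0 i)%:E) /\
  \int[mu]_v Gycut x v 0 i = gy mu F rc r x 0 i.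
Proof.
move=> Xx; have [] := @integrable_eq_on_full _ _ _ mu E mE muE
    (fun v => Gy F rc r x v 0 i) (fun v => Gycut x v 0 i) _ _ (Gy_integrable r soec i Xx).
- under eq_fun do rewrite mxE; apply: measurable_funB => //; exact: measurable_Fcut.
- by move=> v Ev; rewrite GycutE.
by move=> h1 h2; split=> //; rewrite -h2 mxE.
Qed.

Section Joint.
Context {d1} {T1 : measurableType d1}.
Variables (x : T1 -> 'rV[R]_d) (y : T1 -> 'rV[R]_m.+1).
Hypotheses (mx : rV_measurable setT x) (Xx : forall t, X (x t)).
Hypotheses (my : rV_measurable setT y).

Lemma rV_measurable_Gycut :
  rV_measurable setT (fun p : T1 * samples R q => Gycut (x p.1) p.2).
Proof.
move=> i; under eq_fun do rewrite mxE; apply: measurable_funB => //.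
apply: (measurable_fun_Caratheodory mx Xx) => [v Xv|s]; first exact: measurable_Fcut.
exact: continuous_Fcut.
Qed.

Lemma rV_measurable_Gx :
  rV_measurable setT (fun p : T1 * samples R q => Gx F' (x p.1) (y p.1) p.2).
Proof.
move=> k.
under eq_fun do rewrite /Gx summxE; apply: measurable_sum => i.
under eq_fun do rewrite mxE; apply: measurable_funM.
  exact: (measurableT_comp (@my i) measurable_fst).
pose h (p : T1 * samples R q) : borel R d * borel R (q i) := (x p.1, p.2 i).
have mh : measurable_fun setT h.
  apply: measurable_fun_pair.
    exact: (measurableT_comp (rV_measurable_borel mx) measurable_fst).
  exact: (measurableT_comp (@measurable_sample_coord i) measurable_snd).
have mX : measurable (X `*` setT : set (borel R d * borel R (q i))).
  apply: measurableX => //.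
  rewrite -[X]setCK; apply: measurableC; apply: sub_sigma_algebra.
  by rewrite openC; exact: soec_closed soec.
have mF : measurable_fun setT
    (fun p : T1 * samples R q => F' (x p.1) (p.2 i) : borel R d).
  apply: (measurable_comp mX _ (lt_F'_measurable lt (i := i)) mh).
  by move=> _ [p _ <-]; split=> //=; exact: Xx.
exact: (borel_rV_measurable mF k).
Qed.

Lemma rV_measurable_gy : rV_measurable setT (fun t => gy mu F rc r (x t)).
Proof.
move=> i.
rewrite (_ : (fun t => _) = (fun t => \int[mu]_v Gycut (x t) v 0 i)).
  exact: (measurable_Rintegral_section mu (@rV_measurable_Gycut i)).
by apply/funext => t; case: (integrable_Gycut i (Xx t)).
Qed.

End Joint.

Lemma measurable_pair_section {d1 d2 d3} {T1 : measurableType d1} {T2 : measurableType d2}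
    {T3 : measurableType d3} (f : T1 * T2 -> T3) t :
  measurable_fun setT f -> measurable_fun setT (fun v => f (t, v)).
Proof. by move=> mf; exact: (measurableT_comp mf (pair1_measurable t)). Qed.

Lemma measurable_Gycut x : X x -> rV_measurable setT (Gycut x).
Proof.
move=> Xx i; under eq_fun do rewrite mxE; apply: measurable_funB => //.
exact: measurable_Fcut.
Qed.

Lemma measurable_Gy x : X x -> rV_measurable setT (Gy F rc r x).
Proof.
move=> Xx i; have /measurable_int := Gy_integrable r soec i Xx.
by move/measurable_EFinP.
Qed.

Lemma measurable_Gx x y : X x -> rV_measurable setT (Gx F' x y).
Proof.
move=> Xx i.
have mc (n : nat) (w : 'rV[R]_n) : rV_measurable setT (fun _ : samples R q => w) by [].
exact: (measurable_pair_section point (@rV_measurable_Gx _ _ _ _ (@mc _ x) (fun=> Xx) (@mc _ y) i)).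
Qed.

(** Testing against the unit ball moves the dual norm under the expectation, and the tail of [Gy]
    bounds the mean of its dual norm by [My]. *)
Lemma gy_tail x : X x -> dual_norm Ny (gy mu F rc r x) <= My.
Proof.
move=> Xx; apply: dual_norm_le => // h h1.
have [ih <-] := Rintegral_dot h (fun i => Gy_integrable r soec i Xx).
apply: le_trans (ler_norm _) _.
have My0 := lt_My_gt0 lt.
have mh : measurable_fun setT (fun v => dot (Gy F rc r x v) h).
  by apply/measurable_EFinP; exact: measurable_int ih.
have ma : measurable_fun setT (fun v => dual_norm Ny (Gy F rc r x v) / My).
  by apply: measurable_funM => //; apply: measurable_dual_norm => //; exact: measurable_Gy.
have := le_normr_Rintegral_tail (mu := mu) (ltW My0) mh ma.
case=> // [v|].
  rewrite mulrC divfK ?gt_eqF//; apply: le_trans (normr_dot_le_dual nNy _ _) _.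
  by rewrite -[leRHS]mulr1 ler_wpM2l// dual_norm_ge0.
under eq_integral do rewrite expr_div_n.
exact: lt_Gy_tail lt _ Xx.
Qed.

Lemma gx_dot x y h : X x -> simplex m.+1 y ->
  mu.-integrable setT (fun v => (dot (Gx F' x y v) h)%:E) /\
  \int[mu]_v dot (Gx F' x y v) h = dot (gx mu F' x y) h.
Proof.
by move=> Xx Yy; apply: Rintegral_dot => i; exact: lt_Gx_integrable lt _ _ _ Xx Yy.
Qed.

End Oracle.

Section Exceptional.
Context {R : realType} {d : measure_display} {Om : measurableType d}.
Variable P : probability Om R.

(** Only the exceptional set is required to be measurable, which permits passing from the stopped
    process to the run. *)
Definition holds_up_to (e : R) (p : Om -> Prop) : Prop :=
  exists B : set Om, [/\ measurable B, (P B <= e%:E)%E & forall o, ~ B o -> p o].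

Lemma holds_up_to_lt (f : Om -> R) (u e : R) : measurable_fun setT f ->
  (P [set o | (u <= f o)%R] <= e%:E)%E -> holds_up_to e (fun o => f o < u).
Proof.
move=> mf Pf; exists [set o | u <= f o]; split=> // [|o /negP]; last by rewrite -ltNge.
rewrite (_ : [set _ | _] = f @^-1` `[u, +oo[).
  by rewrite -[X in measurable X]setTI; exact: mf.
by apply/seteqP; split=> o /=; rewrite in_itv/= andbT.
Qed.

Lemma holds_up_to_and (e1 e2 : R) (p1 p2 : Om -> Prop) :
  holds_up_to e1 p1 -> holds_up_to e2 p2 ->
  holds_up_to (e1 + e2) (fun o => p1 o /\ p2 o).
Proof.
move=> [B1 [m1 P1 h1]] [B2 [m2 P2 h2]]; exists (B1 `|` B2); split.
- exact: measurableU.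
- by apply: le_trans (leeD P1 P2); exact: measureU2.
- by move=> o Bo; split; [apply: h1|apply: h2] => ?; apply: Bo; [left|right].
Qed.

Lemma holds_up_to_le (e1 e2 : R) (p1 p2 : Om -> Prop) : e1 <= e2 ->
  (forall o, p1 o -> p2 o) -> holds_up_to e1 p1 -> holds_up_to e2 p2.
Proof.
move=> e12 p12 [B [mB PB hB]]; exists B; split=> // [|o /hB /p12 //].
by apply: le_trans PB _; rewrite lee_fin.
Qed.

Lemma holds_up_to_with_prob_ge (e : R) (p : Om -> Prop) :
  holds_up_to e p -> with_prob_ge P (1 - e) [set o | p o].
Proof.
move=> [B [mB PB hB]]; exists (~` B); split=> //; first exact: measurableC.
by rewrite probability_setC// EFinB leeB.
Qed.

End Exceptional.

Section Tails.
Context {R : realType} {d m : nat} {q : 'I_m.+1 -> nat}.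
Variables (X : set 'rV[R]_d) (mu : probability (samples R q) R)
  (F : forall i : 'I_m.+1, 'rV[R]_d -> 'rV[R]_(q i) -> R) (rc : 'I_m -> R)
  (F' : forall i : 'I_m.+1, 'rV[R]_d -> 'rV[R]_(q i) -> 'rV[R]_d)
  (Xi : forall i : 'I_m.+1, set 'rV[R]_(q i)) (r : R).
Variables (Nx : 'rV[R]_d -> R) (Ny : 'rV[R]_m.+1 -> R) (Mx My Q : R).
Hypotheses (soec : soec_assumptions X mu F rc Xi) (nNx : is_norm Nx) (nNy : is_norm Ny).
Hypothesis (lt : light_tail X mu F rc F' Xi r Nx Ny Mx My Q).
Variable E : set (samples R q).
Hypotheses (mE : measurable E) (muE : mu (~` E) = 0%E)
  (EXi : forall v, E v -> forall i, Xi (v i)).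
Context {dO : measure_display} {Om : measurableType dO} {P : probability Om R}.
Variable xi : nat -> {RV P >-> samples R q}.
Hypothesis iid_xi : iid mu xi.
Variables (gamma : nat -> R) (x : forall s, history xi s -> 'rV[R]_d)
  (y : forall s, history xi s -> 'rV[R]_m.+1).
Hypotheses (gamma0 : forall s, 0 < gamma s)
  (mx : forall s, rV_measurable setT (@x s)) (Xx : forall s o, X (@x s o))
  (my : forall s, rV_measurable setT (@y s)) (Yy : forall s o, simplex m.+1 (@y s o)).

Local Notation Gycut := (Gycut F rc r E).
Local Notation gy := (gy mu F rc r).
Local Notation Gx := (Gx F').
Local Notation gx := (gx mu F').

Let V t := \sum_(s < t) gamma s ^+ 2.

Let V0 t : (0 < t)%N -> 0 < V t.
Proof.
case: t => // t _; rewrite /V big_ord_recl ltr_pwDl ?exprn_gt0//.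
by apply: sumr_ge0 => s _; exact: sqr_ge0.
Qed.

(** At the level W K sqrt V the exponent u^2/(8 K^2 V) reduces to W^2/8. *)
Lemma weighted_martingale_tail (g : forall s, history xi s * samples R q -> R) (K W : R) t :
  (forall s, measurable_fun setT (@g s)) ->
  (forall s o, mu.-integrable setT (fun v => (@g s (o, v))%:E)) ->
  0 < K -> 0 < W -> (0 < t)%N ->
  (forall s o, (\int[mu]_v (expR ((@g s (o, v) - \int[mu]_v @g s (o, v)) ^+ 2
      / (K * gamma s) ^+ 2))%:E <= (expR 1)%:E)%E) ->
  holds_up_to P (expR (- (W ^+ 2 / 8))) (fun o =>
    \sum_(s < t) (@g s (o, xi s o) - \int[mu]_v @g s (o, v)) < W * K * Num.sqrt (V t)).
Proof.
move=> mg ig K0 W0 t0 tg.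
have sV : \sum_(s < t) (K * gamma s) ^+ 2 = K ^+ 2 * V t.
  by rewrite mulr_sumr; apply: eq_bigr => s _; rewrite exprMn.
have Vt := V0 t0; have s0 : 0 < Num.sqrt (V t) by rewrite sqrtr_gt0.
apply: holds_up_to_lt; first exact: (measurable_martingale mu mg).
have sg0 s : 0 < K * gamma s by rewrite mulr_gt0.
apply: le_trans (martingale_tail iid_xi mg ig sg0 tg (t := t) _ _) _.
- by rewrite sV mulr_gt0// exprn_gt0.
- by rewrite !mulr_gt0.
rewrite lee_fin ler_expR lerN2 sV le_eqVlt; apply/orP; left; apply/eqP.
rewrite !exprMn sqr_sqrtr ?ltW//; move: (V t) Vt => p p0.
by field; rewrite !gt_eqF.
Qed.

Section JointSection.
Context {d1} {T1 : measurableType d1}.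
Variables (x1 : T1 -> 'rV[R]_d) (y1 : T1 -> 'rV[R]_m.+1).
Hypotheses (mx1 : rV_measurable setT x1) (Xx1 : forall t, X (x1 t)).
Hypotheses (my1 : rV_measurable setT y1).

Lemma rV_measurable_fst n (f : T1 -> 'rV[R]_n) : rV_measurable setT f ->
  rV_measurable setT (fun p : T1 * samples R q => f p.1).
Proof. by move=> mf j; exact: (measurableT_comp (mf j) measurable_fst). Qed.

Lemma measurable_Phicut :
  measurable_fun setT (fun p : T1 * samples R q => dot (Gycut (x1 p.1) p.2) (y1 p.1)).
Proof.
apply: measurable_dot; last exact: rV_measurable_fst.
exact: (rV_measurable_Gycut r soec mE EXi mx1 Xx1).
Qed.

End JointSection.

Lemma Phicut_dot x1 y1 : X x1 ->
  mu.-integrable setT (fun v => (dot (Gycut x1 v) y1)%:E) /\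
    \int[mu]_v dot (Gycut x1 v) y1 = dot (gy x1) y1.
Proof.
move=> Xx1; have [i1 i2] := Rintegral_dot y1
  (fun i => proj1 (integrable_Gycut r soec mE muE i Xx1)).
rewrite i2; split=> //; congr dot; apply/rowP => i.
by rewrite [LHS]mxE; case: (integrable_Gycut r soec mE muE i Xx1).
Qed.

(** The sign [c] covers both directions: 1 for the noise along the iterates [y], -1 for that along
    the averaged sequence. The tail assumption on [Phi] is uniform over the simplex, so any adapted
    [y] has the scale [Q]. *)
Lemma Phi_martingale_tail (c W : R) t : c ^+ 2 = 1 -> 0 < W -> (0 < t)%N ->
  holds_up_to P (expR (- (W ^+ 2 / 8))) (fun o =>
    \sum_(s < t) c * gamma s * (dot (Gycut (@x s o) (xi s o)) (@y s o)
      - dot (gy (@x s o)) (@y s o)) < W * Q * Num.sqrt (V t)).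
Proof.
move=> c1 W0 t0.
pose g s (p : history xi s * samples R q) :=
  c * gamma s * dot (Gycut (@x s p.1) p.2) (@y s p.1).
have mg s : measurable_fun setT (@g s).
  by apply: measurable_funM => //; exact: measurable_Phicut.
have ig s o : mu.-integrable setT (fun v => (@g s (o, v))%:E) /\
    \int[mu]_v @g s (o, v) = c * gamma s * dot (gy (@x s o)) (@y s o).
  have [i1 i2] := Phicut_dot (@y s o) (Xx o); split.
    by apply: eq_integrableT (integrableZl measurableT (c * gamma s) i1) => v; rewrite -EFinM.
  by rewrite RintegralZl// i2.
apply: holds_up_to_le (lexx _) _ (weighted_martingale_tail (t := t) mg
  (fun s o => proj1 (ig s o)) (lt_Q_gt0 lt) W0 t0 _).
  move=> o; apply: le_lt_trans; rewrite le_eqVlt; apply/orP; left; apply/eqP.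
  by apply: eq_bigr => s _; rewrite (proj2 (ig _ _)) -mulrBr.
move=> s o; rewrite (proj2 (ig s o)).
apply: le_trans (lt_Phi_tail lt (Xx o) (Yy o)).
rewrite le_eqVlt; apply/orP; left; apply/eqP.
have mPhi : measurable_fun setT (fun v => dot (Gycut (@x s o) v) (@y s o)).
  exact: (measurable_pair_section o (measurable_Phicut (@mx s) (@Xx s) (@my s))).
apply: (integral_eq_on_full mE muE).
- do 2 apply: measurableT_comp => //.
  apply: measurable_funM => //; apply: measurable_funX; apply: measurable_funB => //.
  exact: measurable_funM.
- do 2 apply: measurableT_comp => //.
  apply: measurable_funM => //; apply: measurable_funX; apply: measurableT_comp => //.
  apply: measurable_funB => //.
  have mGy := measurable_Gy r soec (Xx o).
  rewrite (_ : Phi F rc r _ _ = (fun v => dot (Gy F rc r (@x s o) v) (@y s o))).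
    exact: measurable_dot.
  by apply/funext => v; rewrite PhiE.
move=> v Ev; congr ((expR _)%:E).
rewrite PhiE (phiE r soec _ (Xx o)) /g GycutE// -mulrBr real_normK ?num_real//.
have g0 := gamma0 s; have Q0 := lt_Q_gt0 lt.
rewrite !exprMn c1 mul1r; field; rewrite !gt_eqF//.
Qed.

(** Duality bounds the increment by B times the dual norm of [Gx] over [Mx]; the factor 2 in [2 * B]
    is the price of centering. *)
Lemma Gx_martingale_tail (u : 'rV[R]_d) (B W : R) t : X u ->
  0 < B -> (forall x', X x' -> Nx (x' - u) * Mx <= B) -> 0 < W -> (0 < t)%N ->
  holds_up_to P (expR (- (W ^+ 2 / 8))) (fun o =>
    \sum_(s < t) gamma s * (dot (gx (@x s o) (@y s o)) (@x s o - u)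
      - dot (Gx (@x s o) (@y s o) (xi s o)) (@x s o - u)) < W * (2 * B) * Num.sqrt (V t)).
Proof.
move=> Xu B0 NB W0 t0.
have Mx0 := lt_Mx_gt0 lt.
pose g s (p : history xi s * samples R q) :=
  - gamma s * dot (Gx (@x s p.1) (@y s p.1) p.2) (@x s p.1 - u).
have mGx s := rV_measurable_Gx soec lt (@mx s) (@Xx s) (@my s).
have mxu s : rV_measurable setT (fun o => @x s o - u).
  by move=> j; under eq_fun do rewrite !mxE; apply: measurable_funB => //; exact: mx.
have mg s : measurable_fun setT (@g s).
  apply: measurable_funM => //; apply: measurable_dot; first exact: mGx.
  exact: (rV_measurable_fst (@mxu s)).
have ig s o : mu.-integrable setT (fun v => (@g s (o, v))%:E) /\
    \int[mu]_v @g s (o, v) = - gamma s * dot (gx (@x s o) (@y s o)) (@x s o - u).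
  have [i1 i2] := gx_dot lt (@x s o - u) (Xx o) (Yy o); split.
    by apply: eq_integrableT (integrableZl measurableT (- gamma s) i1) => v; rewrite -EFinM.
  by rewrite RintegralZl// i2.
have B2 : 0 < 2 * B by rewrite mulr_gt0.
apply: holds_up_to_le (lexx _) _ (weighted_martingale_tail (t := t) mg
  (fun s o => proj1 (ig s o)) B2 W0 t0 _).
  move=> o; apply: le_lt_trans; rewrite le_eqVlt; apply/orP; left; apply/eqP.
  by apply: eq_bigr => s _; rewrite (proj2 (ig _ _)) /g; ring.
move=> s o.
have mGxo : rV_measurable setT (Gx (@x s o) (@y s o)) by exact: (measurable_Gx soec lt).
have -> : (2 * B * gamma s) = 2 * (B * gamma s) by rewrite mulrA.
apply: (@centered_tail _ _ _ mu _ (fun v => dual_norm Nx (Gx (@x s o) (@y s o) v) / Mx)).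
- by rewrite mulr_gt0.
- exact: (measurable_pair_section o (@mg s)).
- by apply: measurable_funM => //; exact: measurable_dual_norm.
- move=> v; rewrite /g /= normrM normrN (gtr0_norm (gamma0 s)).
  set D := dual_norm _ _.
  have -> : B * gamma s * (D / Mx) = gamma s * (D * B / Mx) by field; rewrite gt_eqF.
  rewrite ler_pM2l// ler_pdivlMr//.
  apply: le_trans (ler_wpM2r (ltW Mx0) (normr_dot_le_dual nNx _ _)) _.
  by rewrite -mulrA ler_wpM2l ?dual_norm_ge0// NB.
under eq_integral do rewrite expr_div_n.
exact: (lt_Gx_tail lt (Xx o) (Yy o)).
Qed.

Lemma square_tail (a : forall s, history xi s * samples R q -> R) (l : R) t :
  (forall s, measurable_fun setT (@a s)) -> (0 < t)%N ->
  (forall s o, (\int[mu]_v (expR (@a s (o, v)))%:E <= (expR 1)%:E)%E) ->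
  holds_up_to P (expR (- l)) (fun o =>
    \sum_(s < t) gamma s ^+ 2 * @a s (o, xi s o) <= (1 + l) * V t).
Proof.
move=> ma t0 ta.
exists [set o | (1 + l) * V t < \sum_(s < t) gamma s ^+ 2 * @a s (o, xi s o)]; split.
- have mf : measurable_fun setT
      (fun o : Om => \sum_(s < t) gamma s ^+ 2 * @a s (o, xi s o)).
    apply: measurable_sum => s; apply: measurable_funM => //.
    have h := measurableT_comp (@ma s) (measurable_history_pair (xi := xi) (ltnSn s)).
    exact: (measurable_history_Om h).
  rewrite (_ : [set _ | _] = (fun o : Om =>
      \sum_(s < t) gamma s ^+ 2 * @a s (o, xi s o)) @^-1` `](1 + l) * V t, +oo[).
    by rewrite -[X in measurable X]setTI; exact: mf.
  by apply/seteqP; split=> o /=; rewrite in_itv/= andbT.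
- exact: (weighted_mean_tail iid_xi ma (fun s => sqr_ge0 (gamma s)) ta l (V0 t0)).
- by move=> o /negP; rewrite -leNgt.
Qed.

End Tails.

(** * The run and its stopped version *)

Section ArgminMeasurable.
Context {R : realType} {n : nat}.
Variables (A : set 'rV[R]_n) (N w : 'rV[R]_n -> R) (grad : 'rV[R]_n -> 'rV[R]_n) (a : R).
Hypotheses (nN : is_norm N) (sA : segment_closed A) (dgf : is_dgf N A w grad a).
Hypothesis D_gt0 : 0 < dgf_diam A w.
Context {d1} {T1 : measurableType d1}.

(** A minimizer is a Lipschitz function of the linear term. A domain [D] is allowed because the run
    is controlled only on the event that the samples are in the full set. *)
Lemma rV_measurable_argmin (D : set T1) (f y : T1 -> 'rV[R]_n) : measurable D ->
  rV_measurable D f ->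
  (forall t, D t -> is_argmin A (fun x => dot (f t) x + (2 * dgf_diam A w ^+ 2)^-1 * w x) (y t)) ->
  rV_measurable D y.
Proof.
move=> mD mf ymin j; have [K K0 yK] := argmin_lipschitz nN sA dgf D_gt0.
apply: (measurable_fun_factor mD mf) => t Dt e e0.
have K1 : 0 < K + 1 by lra.
exists (e / (K + 1)) => [|t' Dt']; first exact: divr_gt0.
rewrite ltr_pdivlMr// => ff.
have := coord_le_norm (y t - y t') j; rewrite !mxE => /le_lt_trans; apply.
apply: le_lt_trans (yK _ _ _ _ (ymin _ Dt) (ymin _ Dt')) _.
by apply: le_lt_trans ff; rewrite mulrC ler_wpM2l//; lra.
Qed.

Lemma rV_measurable_grad (x : T1 -> 'rV[R]_n) : rV_measurable setT x ->
  (forall t, dom_subdiff A w (x t)) -> rV_measurable setT (fun t => grad (x t)).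
Proof.
move=> mx dx j; apply: (measurable_fun_factor measurableT mx) => t _ e e0.
have [r0 r0_gt0 h] := within_continuous_eps (dgf_gradient_continuous dgf) (dx t) e0.
exists r0 => // t' _ /(h _ (dx t')); apply: le_lt_trans.
by have := coord_le_norm (grad (x t) - grad (x t')) j; rewrite !mxE.
Qed.

End ArgminMeasurable.

Section Run.
Context {R : realType} {d m : nat} {q : 'I_m.+1 -> nat}.
Variables (X : set 'rV[R]_d) (mu : probability (samples R q) R)
  (F : forall i : 'I_m.+1, 'rV[R]_d -> 'rV[R]_(q i) -> R) (rc : 'I_m -> R)
  (F' : forall i : 'I_m.+1, 'rV[R]_d -> 'rV[R]_(q i) -> 'rV[R]_d)
  (Xi : forall i : 'I_m.+1, set 'rV[R]_(q i)) (r : R).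
Variables (Nx : 'rV[R]_d -> R) (Ny : 'rV[R]_m.+1 -> R).
Variables (wx : 'rV[R]_d -> R) (gradx : 'rV[R]_d -> 'rV[R]_d) (ax : R)
  (wy : 'rV[R]_m.+1 -> R) (grady : 'rV[R]_m.+1 -> 'rV[R]_m.+1) (ay : R).
Hypotheses (soec : soec_assumptions X mu F rc Xi) (nNx : is_norm Nx) (nNy : is_norm Ny).
Hypotheses (dgx : is_dgf Nx X wx gradx ax) (dgy : is_dgf Ny (simplex m.+1) wy grady ay).
Hypotheses (exminx : exists x, is_argmin X wx x) (exmaxx : exists x, is_argmax X wx x)
  (exminy : exists y, is_argmin (simplex m.+1) wy y)
  (exmaxy : exists y, is_argmax (simplex m.+1) wy y).
Let Dx := dgf_diam X wx.
Let Dy := dgf_diam (simplex m.+1) wy.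
Hypotheses (Dx0 : 0 < Dx) (Dy0 : 0 < Dy).
Context {Om : Type}.
Variable xi : nat -> Om -> samples R q.
Variables (gamma : nat -> R) (N : nat) (z : nat -> Om -> 'rV[R]_d * 'rV[R]_m.+1).
Hypothesis gamma0 : forall s, 0 < gamma s.
Hypothesis run : is_OVSMD_run X F rc F' wx gradx wy grady r gamma N xi z.

Let cx : R := (2 * Dx ^+ 2)^-1.
Let cy : R := (2 * Dy ^+ 2)^-1.
Local Notation Y := (simplex m.+1).

Let cx0 : 0 < cx. Proof. by rewrite invr_gt0 mulr_gt0// exprn_gt0. Qed.
Let cy0 : 0 < cy. Proof. by rewrite invr_gt0 mulr_gt0// exprn_gt0. Qed.

Let sX : segment_closed X.
Proof. by apply: convex_set_segment; exact: soec_convex soec. Qed.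

Lemma omegaz_argmin_split u : is_argmin (X `*` Y) (omegaz X wx wy) u ->
  is_argmin X wx u.1 /\ is_argmin Y wy u.2.
Proof.
move=> [[Xu Yu] umin]; split; split=> // u1 Au1.
  have := umin (u1, u.2) (conj Au1 Yu).
  by rewrite /omegaz /= lerD2r ler_pM2r.
have := umin (u.1, u1) (conj Xu Au1).
by rewrite /omegaz /= lerD2l ler_pM2r.
Qed.

(** The prox objective separates over the two blocks and, up to constants, each is a linear form
    plus a multiple of [wx] or [wy]. *)
Lemma prox_split z' zeta u : is_prox X wx gradx wy grady z' zeta u ->
  is_argmin X (fun x1 => dot (zeta.1 - cx *: gradx z'.1) x1 + cx * wx x1) u.1 /\
  is_argmin Y (fun y1 => dot (zeta.2 - cy *: grady z'.2) y1 + cy * wy y1) u.2.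
Proof.
move=> [[Xu Yu] umin]; split; split=> // u1 Au1.
  have := umin (u1, u.2) (conj Au1 Yu).
  rewrite /bregman /omegaz /dotz /gradz /= -/Dx -/Dy -/cx -/cy.
  by rewrite !dotBl !dotZl !dotBr; lra.
have := umin (u.1, u1) (conj Xu Au1).
rewrite /bregman /omegaz /dotz /gradz /= -/Dx -/Dy -/cx -/cy.
by rewrite !dotBl !dotZl !dotBr; lra.
Qed.

Lemma run_argmin0 o : is_argmin X wx (z 0 o).1 /\ is_argmin Y wy (z 0 o).2.
Proof. by apply: omegaz_argmin_split; case: (run o). Qed.

Lemma run_step o s : (s <= N)%N ->
  is_argmin X (fun x1 => dot (gamma s *: Gx F' (z s o).1 (z s o).2 (xi s o)
     - cx *: gradx (z s o).1) x1 + cx * wx x1) (z s.+1 o).1 /\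
  is_argmin Y (fun y1 => dot (gamma s *: - Gy F rc r (z s o).1 (xi s o)
     - cy *: grady (z s o).2) y1 + cy * wy y1) (z s.+1 o).2.
Proof. by move=> sN; have [_ /(_ _ sN) /prox_split] := run o. Qed.

Lemma run_descent o t : (t <= N.+1)%N ->
  [/\ forall s, (s <= t)%N -> dom_subdiff X wx (z s o).1 /\ dom_subdiff Y wy (z s o).2,
    forall u, X u -> \sum_(s < t) dot (gamma s *: Gx F' (z s o).1 (z s o).2 (xi s o))
       ((z s o).1 - u) <= 1 / 2 + Dx ^+ 2 / ax * \sum_(s < t)
        dual_norm Nx (gamma s *: Gx F' (z s o).1 (z s o).2 (xi s o)) ^+ 2
  & forall u, Y u -> \sum_(s < t) dot (gamma s *: - Gy F rc r (z s o).1 (xi s o))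
       ((z s o).2 - u) <= 1 / 2 + Dy ^+ 2 / ay * \sum_(s < t)
        dual_norm Ny (gamma s *: - Gy F rc r (z s o).1 (xi s o)) ^+ 2].
Proof.
move=> tN; have [m1 m2] := run_argmin0 o.
have [d1 h1] := mirror_descent nNx sX dgx exminx exmaxx Dx0
  (x := fun s => (z s o).1) (z := fun s => gamma s *: Gx F' (z s o).1 (z s o).2 (xi s o))
  m1 (fun s st => proj1 (run_step o (leq_trans st tN))).
have [d2 h2] := mirror_descent nNy simplex_segment dgy exminy exmaxy Dy0
  (x := fun s => (z s o).2) (z := fun s => gamma s *: - Gy F rc r (z s o).1 (xi s o))
  m2 (fun s st => proj2 (run_step o (leq_trans st tN))).
by split=> // s st; split; [exact: d1|exact: d2].
Qed.

End Run.

Section Process.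
Context {R : realType} {d m : nat} {q : 'I_m.+1 -> nat}.
Variables (X : set 'rV[R]_d) (mu : probability (samples R q) R)
  (F : forall i : 'I_m.+1, 'rV[R]_d -> 'rV[R]_(q i) -> R) (rc : 'I_m -> R)
  (F' : forall i : 'I_m.+1, 'rV[R]_d -> 'rV[R]_(q i) -> 'rV[R]_d)
  (Xi : forall i : 'I_m.+1, set 'rV[R]_(q i)) (r : R).
Variables (Nx : 'rV[R]_d -> R) (Ny : 'rV[R]_m.+1 -> R) (Mx My Q : R).
Variables (wx : 'rV[R]_d -> R) (gradx : 'rV[R]_d -> 'rV[R]_d) (ax : R)
  (wy : 'rV[R]_m.+1 -> R) (grady : 'rV[R]_m.+1 -> 'rV[R]_m.+1) (ay : R).
Hypotheses (soec : soec_assumptions X mu F rc Xi) (nNx : is_norm Nx) (nNy : is_norm Ny).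
Hypotheses (dgx : is_dgf Nx X wx gradx ax) (dgy : is_dgf Ny (simplex m.+1) wy grady ay).
Hypotheses (exminx : exists x, is_argmin X wx x) (exmaxx : exists x, is_argmax X wx x)
  (exminy : exists y, is_argmin (simplex m.+1) wy y)
  (exmaxy : exists y, is_argmax (simplex m.+1) wy y).
Let Dx := dgf_diam X wx.
Let Dy := dgf_diam (simplex m.+1) wy.
Hypotheses (Dx0 : 0 < Dx) (Dy0 : 0 < Dy).
Hypothesis (lt : light_tail X mu F rc F' Xi r Nx Ny Mx My Q).
Variable E : set (samples R q).
Hypotheses (mE : measurable E) (muE : mu (~` E) = 0%E)
  (EXi : forall v, E v -> forall i, Xi (v i)).
Context {dO : measure_display} {Om : measurableType dO} {P : probability Om R}.
Variable xi : nat -> {RV P >-> samples R q}.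
Hypothesis iid_xi : iid mu xi.
Variables (gamma : nat -> R) (N : nat) (z : nat -> Om -> 'rV[R]_d * 'rV[R]_m.+1).
Hypothesis gamma0 : forall s, 0 < gamma s.
Hypothesis run : is_OVSMD_run X F rc F' wx gradx wy grady r gamma N xi z.

Let cx : R := (2 * Dx ^+ 2)^-1.
Let cy : R := (2 * Dy ^+ 2)^-1.
Local Notation Y := (simplex m.+1).

Let sX : segment_closed X.
Proof. by apply: convex_set_segment; exact: soec_convex soec. Qed.

Let argmin0 := run_argmin0 Dx0 Dy0 run.
Let step := run_step run.
Let descent := run_descent soec nNx nNy dgx dgy exminx exmaxx exminy exmaxy Dx0 Dy0 run.

Definition all_in_support s (o : Om) := forall k, (k < s)%N -> E (xi k o).

Lemma measurable_all_in_support s :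
  measurable ([set o | all_in_support s o] : set (history xi s)).
Proof.
by apply: sub_sigma_algebra; exists (fun=> E).
Qed.

(* Without the cut-off the run need not be measurable, since [F] is only
   controlled on the samples of [E]. *)
Definition stopped s (o : history xi s) : 'rV[R]_d * 'rV[R]_m.+1 :=
  if `[< (s <= N)%N /\ all_in_support s o >] then z s o else z 0 point.

(** Strong convexity makes the minimizer of [omegaz] unique, so the starting point is deterministic
    although it is given as a function of [o]. *)
Lemma z0_const o o' : z 0 o = z 0 o'.
Proof.
have [x1 y1] := argmin0 o; have [x2 y2] := argmin0 o'.
have uniq n (A : set 'rV[R]_n) Nn w grad a u v :
    is_norm Nn -> segment_closed A -> is_dgf Nn A w grad a -> 0 < dgf_diam A w ->
    is_argmin A w u -> is_argmin A w v -> u = v.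
  move=> nN sA dgf D0 mu1 mv.
  have [K K0 yK] := argmin_lipschitz nN sA dgf D0.
  have c0 : 0 < (2 * dgf_diam A w ^+ 2)^-1 by rewrite invr_gt0 mulr_gt0// exprn_gt0.
  have m0 b : is_argmin A w b ->
      is_argmin A (fun x => dot 0 x + (2 * dgf_diam A w ^+ 2)^-1 * w x) b.
    by move=> [Ab bmin]; split=> // x Ax; rewrite !dot0l !add0r ler_pM2l// bmin.
  have := yK _ _ _ _ (m0 _ mu1) (m0 _ mv).
  by rewrite subrr normr0 mulr0 normr_le0 subr_eq0 => /eqP.
rewrite (surjective_pairing (z 0 o)) (surjective_pairing (z 0 o')).
by rewrite (uniq _ _ _ _ _ _ _ _ nNx sX dgx Dx0 x1 x2)
  (uniq _ _ _ _ _ _ _ _ nNy simplex_segment dgy Dy0 y1 y2).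
Qed.

Lemma stopped_dom s (o : history xi s) :
  dom_subdiff X wx (stopped o).1 /\ dom_subdiff Y wy (stopped o).2.
Proof.
rewrite /stopped; case: asboolP => [[sN _]|_].
  by have [h _ _] := descent o (leqW sN); exact: h.
by have [h _ _] := descent point (leq0n N.+1); exact: h.
Qed.

Lemma stopped_X s (o : history xi s) : X (stopped o).1.
Proof. by case: (stopped_dom o) => -[]. Qed.

Lemma stopped_Y s (o : history xi s) : Y (stopped o).2.
Proof. by case: (stopped_dom o) => _ []. Qed.

Lemma stoppedE s (o : Om) : (s <= N)%N -> all_in_support s o -> @stopped s o = z s o.
Proof. by move=> sN so; rewrite /stopped; case: asboolP => // -[]. Qed.

(** By induction: on the event that the samples seen lie in [E], the next iterate is a minimizer
    whose linear term is a measurable function of the previous stopped point and the last sample;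
    elsewhere it is constant. [Gycut] may stand for [Gy] on that event. *)
Lemma measurable_stopped s :
  rV_measurable setT (fun o : history xi s => (stopped o).1) /\
  rV_measurable setT (fun o : history xi s => (stopped o).2).
Proof.
elim: s => [|s [mx my]].
  have st0 (o : history xi 0) : stopped o = z 0 point.
    by rewrite /stopped; case: asboolP => // _; exact: z0_const.
  split=> j; under eq_fun do rewrite st0; exact: measurable_cst.
have [sN|sN] := leqP s.+1 N; last first.
  have stS (o : history xi s.+1) : stopped o = z 0 point.
    by rewrite /stopped; case: asboolP => // -[]; rewrite leqNgt sN.
  split=> j; under eq_fun do rewrite stS; exact: measurable_cst.
pose D : set (history xi s.+1) := [set o | all_in_support s.+1 o].
have mD : measurable D by exact: measurable_all_in_support.
have mpair := measurable_history_pair (xi := xi) (ltnSn s).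
have mprev := measurable_history_le (xi := xi) (leqnSn s).
have mGx j := measurableT_comp
  (@rV_measurable_Gx _ _ _ _ _ _ _ _ _ _ _ _ _ _ _ _ soec lt _ _ _ _ mx
    (fun o => stopped_X o) my j) mpair.
have mGy j := measurableT_comp
  (@rV_measurable_Gycut _ _ _ _ _ _ _ _ _ r soec _ mE EXi _ _ _ mx
    (fun o => stopped_X o) j) mpair.
have mgx := rV_measurable_grad dgx mx (fun o => proj1 (stopped_dom o)).
have mgy := rV_measurable_grad dgy my (fun o => proj2 (stopped_dom o)).
have DE (o : history xi s.+1) : D o -> @stopped s o = z s o.
  by move=> Do; apply: stoppedE (ltnW sN) _ => k ks; apply: Do; exact: ltnW.
have mx1 : rV_measurable D (fun o => (z s.+1 o).1).
  apply: (rV_measurable_argmin nNx sX dgx Dx0 mD (f := fun o : history xi s.+1 =>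
    gamma s *: Gx F' (@stopped s o).1 (@stopped s o).2 (xi s o)
     - cx *: gradx (@stopped s o).1)).
    move=> j; apply: measurable_funTS; under eq_fun do rewrite !mxE.
    apply: measurable_funB; apply: measurable_funM => //; first exact: mGx.
    exact: (measurableT_comp (@mgx j) mprev).
  by move=> o Do; rewrite DE//; exact: proj1 (step o (ltnW sN)).
have my1 : rV_measurable D (fun o => (z s.+1 o).2).
  apply: (rV_measurable_argmin nNy simplex_segment dgy Dy0 mD (f := fun o : history xi s.+1 =>
    gamma s *: - Gycut F rc r E (@stopped s o).1 (xi s o)
     - cy *: grady (@stopped s o).2)).
    move=> j; apply: measurable_funTS.
    rewrite (_ : (fun _ => _) = (fun o => - gamma s * Gycut F rc r E (@stopped s o).1 (xi s o) 0 j
      - cy * grady (@stopped s o).2 0 j)); last first.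
      by apply/funext => o; rewrite !mxE mulrN mulNr.
    apply: measurable_funB; apply: measurable_funM => //; first exact: mGy.
    exact: (measurableT_comp (@mgy j) mprev).
  move=> o Do; rewrite DE// GycutE; last exact: Do.
  exact: proj2 (step o (ltnW sN)).
have mb : measurable_fun setT (fun o : history xi s.+1 => `[< all_in_support s.+1 o >]).
  apply: (@measurable_fun_bool _ _ _ _ true).
  rewrite setTI (_ : _ @^-1` _ = D)//.
  by apply/seteqP; split=> o /=; case: asboolP.
have bE : setT `&` (fun o : history xi s.+1 => `[< all_in_support s.+1 o >]) @^-1` [set true] = D.
  by rewrite setTI; apply/seteqP; split=> o /=; case: asboolP.
have stE (o : history xi s.+1) : stopped o =
    if `[< all_in_support s.+1 o >] then z s.+1 o else z 0 point.
  by rewrite /stopped; congr (if _ then _ else _); apply/asbool_equiv_eq; split=> // -[].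
split=> j.
  rewrite (_ : (fun _ => _) = (fun o : history xi s.+1 => if `[< all_in_support s.+1 o >]
      then (z s.+1 o).1 0 j else (z 0 point).1 0 j)); last first.
    by apply/funext => o; rewrite stE; case: ifP.
  by apply: measurable_fun_if => //; rewrite bE; exact: mx1.
rewrite (_ : (fun _ => _) = (fun o : history xi s.+1 => if `[< all_in_support s.+1 o >]
    then (z s.+1 o).2 0 j else (z 0 point).2 0 j)); last first.
  by apply/funext => o; rewrite stE; case: ifP.
by apply: measurable_fun_if => //; rewrite bE; exact: my1.
Qed.

End Process.

(** * Pathwise bounds *)

Lemma dual_normZ {R : realType} {n} (N : 'rV[R]_n -> R) (c : R) g : is_norm N -> 0 < c ->
  dual_norm N (c *: g) = c * dual_norm N g.
Proof.
move=> nN c0.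
have le1 a h : 0 < a -> dual_norm N (a *: h) <= a * dual_norm N h.
  move=> a0; apply: dual_norm_le => // x x1; rewrite dotZl ler_pM2l//.
  exact: dual_norm_ge.
apply/eqP; rewrite eq_le le1//= -ler_pdivlMl//.
have c1 : 0 < c^-1 by rewrite invr_gt0.
by apply: le_trans (le1 _ _ c1); rewrite scalerA mulVf ?gt_eqF// scale1r.
Qed.

Lemma segment_closed_mean {R : realType} {n} (A : set 'rV[R]_n) (gamma : nat -> R)
    (x : nat -> 'rV[R]_n) t : segment_closed A -> (forall s, 0 < gamma s) ->
  (forall s, (s <= t)%N -> A (x s)) ->
  A ((\sum_(s < t.+1) gamma s)^-1 *: \sum_(s < t.+1) gamma s *: x s).
Proof.
move=> sA g0; elim: t => [|t IH] Ax.
  by rewrite !big_ord1 scalerA mulVf ?gt_eqF// scale1r; exact: Ax.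
rewrite big_ord_recr /= [X in _ *: X]big_ord_recr /=.
set S := \sum_(s < t.+1) gamma s; set v := \sum_(s < t.+1) gamma s *: x s.
have S0 : 0 < S.
  by rewrite /S big_ord_recl ltr_pwDl// sumr_ge0// => s _; exact: ltW.
have g1 := g0 t.+1; have Sg : 0 < S + gamma t.+1 by rewrite addr_gt0.
have := sA _ _ (S / (S + gamma t.+1)) (IH (fun s st => Ax s (leqW st))) (Ax _ (leqnn _)).
rewrite divr_ge0 ?(ltW S0) ?(ltW Sg)//= ler_pdivrMr// mul1r lerDl (ltW g1) => /(_ isT).
rewrite -/S -/v scalerA (_ : S / _ * S^-1 = (S + gamma t.+1)^-1); last first.
  by field; rewrite !gt_eqF.
rewrite (_ : 1 - _ = (S + gamma t.+1)^-1 * gamma t.+1); last by field; rewrite !gt_eqF.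
by rewrite -scalerA -scalerDr.
Qed.

Section Pathwise.
Context {R : realType} {d m : nat} {q : 'I_m.+1 -> nat}.
Variables (X : set 'rV[R]_d) (mu : probability (samples R q) R)
  (F : forall i : 'I_m.+1, 'rV[R]_d -> 'rV[R]_(q i) -> R) (rc : 'I_m -> R)
  (F' : forall i : 'I_m.+1, 'rV[R]_d -> 'rV[R]_(q i) -> 'rV[R]_d)
  (Xi : forall i : 'I_m.+1, set 'rV[R]_(q i)) (r : R).
Variables (Nx : 'rV[R]_d -> R) (Ny : 'rV[R]_m.+1 -> R) (Mx My Q : R).
Variables (wx : 'rV[R]_d -> R) (gradx : 'rV[R]_d -> 'rV[R]_d) (ax : R)
  (wy : 'rV[R]_m.+1 -> R) (grady : 'rV[R]_m.+1 -> 'rV[R]_m.+1) (ay : R).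
Hypotheses (soec : soec_assumptions X mu F rc Xi) (nNx : is_norm Nx) (nNy : is_norm Ny).
Hypotheses (dgx : is_dgf Nx X wx gradx ax) (dgy : is_dgf Ny (simplex m.+1) wy grady ay).
Hypotheses (exminx : exists x, is_argmin X wx x) (exmaxx : exists x, is_argmax X wx x)
  (exminy : exists y, is_argmin (simplex m.+1) wy y)
  (exmaxy : exists y, is_argmax (simplex m.+1) wy y).
Let Dx := dgf_diam X wx.
Let Dy := dgf_diam (simplex m.+1) wy.
Hypotheses (Dx0 : 0 < Dx) (Dy0 : 0 < Dy).
Hypothesis (lt : light_tail X mu F rc F' Xi r Nx Ny Mx My Q).
Context {Om : Type}.
Variable xi : nat -> Om -> samples R q.
Variables (gamma : nat -> R) (N : nat) (z : nat -> Om -> 'rV[R]_d * 'rV[R]_m.+1).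
Hypothesis gamma0 : forall s, 0 < gamma s.
Hypothesis run : is_OVSMD_run X F rc F' wx gradx wy grady r gamma N xi z.

Local Notation Y := (simplex m.+1).
Local Notation phi := (phi mu F rc r).
Local Notation Gy := (Gy F rc r).
Local Notation gy := (gy mu F rc r).
Local Notation Gx := (Gx F').
Local Notation gx := (gx mu F').

Variables (o : Om) (t : nat) (u : 'rV[R]_d) (v : nat -> 'rV[R]_m.+1).
Hypotheses (tN : (t <= N)%N) (Xu : X u) (Yv : forall s, Y (v s)).
Hypothesis Hu : H X mu F rc r = Plevel mu F rc r u.

Let x s := (z s o).1.
Let y s := (z s o).2.
Let e s := xi s o.
Let S := \sum_(s < t.+1) gamma s.

Hypothesis vmin : forall s, is_argmin Y (fun y' =>
  dot (- \sum_(k < s) gamma k *: (gy (x k) - Gy (x k) (e k))) y'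
   + (2 * Dy ^+ 2)^-1 * wy y') (v s).

Variables (q1 q2 p1 sx sy : R).
Hypotheses
  (q1P : \sum_(s < t.+1) gamma s * (dot (Gy (x s) (e s)) (y s) - dot (gy (x s)) (y s)) <= q1)
  (q2P : \sum_(s < t.+1) gamma s * (dot (gy (x s)) (v s) - dot (Gy (x s) (e s)) (v s)) <= q2)
  (p1P : \sum_(s < t.+1) gamma s * (dot (gx (x s) (y s)) (x s - u)
     - dot (Gx (x s) (y s) (e s)) (x s - u)) <= p1)
  (sxP : \sum_(s < t.+1) gamma s ^+ 2 * dual_norm Nx (Gx (x s) (y s) (e s)) ^+ 2 <= sx)
  (syP : \sum_(s < t.+1) gamma s ^+ 2 * dual_norm Ny (Gy (x s) (e s)) ^+ 2 <= sy).

Let ax0 : 0 < ax. Proof. by case: dgx. Qed.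
Let ay0 : 0 < ay. Proof. by case: dgy. Qed.

Let S0 : 0 < S.
Proof. by rewrite /S big_ord_recl ltr_pwDl// sumr_ge0// => s _; exact: ltW. Qed.

Let descent := run_descent soec nNx nNy dgx dgy exminx exmaxx exminy exmaxy Dx0 Dy0 run o
  (tN : (t.+1 <= N.+1)%N).

Let Xx s : (s <= t)%N -> X (x s).
Proof. by move=> st; have [/(_ s (leqW st))[[]]] := descent. Qed.

Let Yy s : (s <= t)%N -> Y (y s).
Proof. by move=> st; have [/(_ s (leqW st))[_ []]] := descent. Qed.

(** [A] bounds S (u_t - H): its 1 is the sum of two mirror descent constants 1/2. [B] bounds S (P -
    u_t), the squared noise being controlled by twice the squares of [Gy] and of its mean. *)
Let A := 1 + Dx ^+ 2 / ax * sx + Dy ^+ 2 / ay * sy + q1 + p1.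
Let B := 1 / 2 + Dy ^+ 2 / ay * (2 * sy + 2 * My ^+ 2 * \sum_(s < t.+1) gamma s ^+ 2) + q2.

Let lin_le y' : Y y' ->
  \sum_(s < t.+1) gamma s * dot (Gy (x s) (e s)) y' <= S * H X mu F rc r + A.
Proof.
move=> Yy'; have [_ /(_ u Xu) hx /(_ y' Yy') hy] := descent.
have {}hx : \sum_(s < t.+1) gamma s * dot (Gx (x s) (y s) (e s)) (x s - u) <=
    1 / 2 + Dx ^+ 2 / ax * sx.
  apply: le_trans (_ : _ <= \sum_(s < t.+1) dot (gamma s *: Gx (x s) (y s) (e s)) (x s - u)) _.
    by apply: ler_sum => s _; rewrite dotZl.
  apply: (le_trans hx); rewrite lerD2l ler_wpM2l ?divr_ge0 ?sqr_ge0 ?(ltW ax0)//.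
  apply: le_trans sxP; apply: ler_sum => s _.
  by rewrite dual_normZ// exprMn.
have {}hy : \sum_(s < t.+1) gamma s * (dot (Gy (x s) (e s)) y' - dot (Gy (x s) (e s)) (y s)) <=
    1 / 2 + Dy ^+ 2 / ay * sy.
  apply: le_trans (_ : _ <= \sum_(s < t.+1) dot (gamma s *: - Gy (x s) (e s)) (y s - y')) _.
    by apply: ler_sum => s _; rewrite dotZl dotNl dotBr opprB.
  apply: (le_trans hy); rewrite lerD2l ler_wpM2l ?divr_ge0 ?sqr_ge0 ?(ltW ay0)//.
  apply: le_trans syP; apply: ler_sum => s _.
  by rewrite dual_normZ// dual_normN// exprMn.
(* The subgradient inequality for phi(., y_s) is taken from x_s to the minimizer [u], where phi(u,
   y_s) <= P(u) = H. *)
have hphi : \sum_(s < t.+1) gamma s * (dot (gy (x s)) (y s) - dot (gx (x s) (y s)) (x s - u))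
    <= S * H X mu F rc r.
  rewrite mulr_suml; apply: ler_sum => s _; rewrite ler_pM2l// Hu.
  have st : (s <= t)%N by rewrite -ltnS.
  have := lt_gx lt (Xx st) (Yy st) Xu.
  rewrite !(phiE r soec)//; last exact: Xx.
  have : dot (gy u) (y s) <= Plevel mu F rc r u.
    by apply: (dot_simplex_le (Yy st)) => i; exact: (gy_le_Plevel r soec).
  by rewrite !dotBr; lra.
have -> : \sum_(s < t.+1) gamma s * dot (Gy (x s) (e s)) y' =
   \sum_(s < t.+1) gamma s * (dot (Gy (x s) (e s)) y' - dot (Gy (x s) (e s)) (y s))
   + \sum_(s < t.+1) gamma s * (dot (Gy (x s) (e s)) (y s) - dot (gy (x s)) (y s))
   + \sum_(s < t.+1) gamma s * (dot (gy (x s)) (y s) - dot (gx (x s) (y s)) (x s - u))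
   + \sum_(s < t.+1) gamma s * (dot (gx (x s) (y s)) (x s - u)
       - dot (Gx (x s) (y s) (e s)) (x s - u))
   + \sum_(s < t.+1) gamma s * dot (Gx (x s) (y s) (e s)) (x s - u).
  by rewrite -!big_split /=; apply: eq_bigr => s _; ring.
apply: le_trans (lerD (lerD (lerD (lerD hy q1P) hphi) p1P) hx) _.
by rewrite /A le_eqVlt; apply/orP; left; apply/eqP; field; rewrite !gt_eqF.
Qed.

Let uset := [set S^-1 * \sum_(s < t.+1) gamma s *
   (Phi F rc r (x s) (y s) (e s) + dot (Gy (x s) (e s)) (y' - y s)) | y' in Y].

Let usetE y' : S^-1 * \sum_(s < t.+1) gamma s *
   (Phi F rc r (x s) (y s) (e s) + dot (Gy (x s) (e s)) (y' - y s)) =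
  S^-1 * \sum_(s < t.+1) gamma s * dot (Gy (x s) (e s)) y'.
Proof.
by congr (_ * _); apply: eq_bigr => s _; rewrite PhiE dotBr addrC subrK.
Qed.

Lemma xbar_in : X (xbar gamma z t o).
Proof.
have sX : segment_closed X by apply: convex_set_segment; exact: soec_convex soec.
exact: (segment_closed_mean (x := x) sX gamma0 Xx).
Qed.

Lemma uhat_le : uhat F rc r gamma xi z t o <= H X mu F rc r + A / S.
Proof.
have ub : ubound uset (H X mu F rc r + A / S).
  move=> _ [y' Yy' <-]; rewrite usetE ler_pdivrMl//.
  apply: (le_trans (lin_le Yy')); rewrite mulrDr lerD2l.
  by rewrite mulrCA divff ?mulr1 ?gt_eqF.
by apply: ge_sup => //; exists (S^-1 * \sum_(s < t.+1) gamma s *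
   (Phi F rc r (x s) (y s) (e s) + dot (Gy (x s) (e s)) (v 0 - y s))), (v 0).
Qed.

Lemma Plevel_le_uhat :
  Plevel mu F rc r (xbar gamma z t o) <= uhat F rc r gamma xi z t o + B / S.
Proof.
set xb := xbar gamma z t o.
have Xxb : X xb by exact: xbar_in.
have [i ->] := Plevel_vertex r soec Xxb; rewrite -dot_delta.
set y' := delta_mx 0 i; have Yy' : Y y' by exact: simplex_delta.
(* Jensen's inequality through one subgradient at [xb]: its linear terms cancel, since [xb] is the
   weighted mean of the iterates. *)
have h1 : S * dot (gy xb) y' <= \sum_(s < t.+1) gamma s * dot (gy (x s)) y'.
  have : \sum_(s < t.+1) gamma s * (dot (gy xb) y' + dot (gx xb y') (x s - xb))
      <= \sum_(s < t.+1) gamma s * dot (gy (x s)) y'.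
    apply: ler_sum => s _; rewrite ler_pM2l//.
    have st : (s <= t)%N by rewrite -ltnS.
    have := lt_gx lt Xxb Yy' (Xx st).
    by rewrite !(phiE r soec)//; exact: Xx.
  apply: le_trans; rewrite le_eqVlt; apply/orP; left; apply/eqP.
  under eq_bigr do rewrite mulrDr; rewrite big_split /= -mulr_suml -/S.
  suff -> : \sum_(s < t.+1) gamma s * dot (gx xb y') (x s - xb) = 0 by rewrite addr0.
  have Sxb : S *: xb = \sum_(s < t.+1) gamma s *: x s.
    by rewrite /xb /xbar scalerA divff ?gt_eqF// scale1r.
  under eq_bigr do rewrite -dotZr; rewrite -dot_sumr.
  under eq_bigr do rewrite scalerBr; rewrite sumrB -Sxb -scaler_suml subrr.
  exact: dot0r.
have h2 : \sum_(s < t.+1) gamma s * dot (Gy (x s) (e s)) y' <= S * uhat F rc r gamma xi z t o.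
  rewrite -ler_pdivrMl// -usetE; apply: ub_le_sup; last by exists y'.
  exists (S^-1 * (S * H X mu F rc r + A)) => _ [y1 Yy1 <-].
  by rewrite usetE ler_pM2l ?invr_gt0//; exact: lin_le.
have := dual_averaging nNy simplex_segment dgy exminy exmaxy Dy0
  (z := fun k => gamma k *: (gy (x k) - Gy (x k) (e k))) vmin t.+1 Yy'.
set dn := \sum_(s < t.+1) dual_norm _ _ ^+ 2 => h3.
have dnP : dn <= 2 * sy + 2 * My ^+ 2 * \sum_(s < t.+1) gamma s ^+ 2.
  apply: (@le_trans _ _ (2 * \sum_(s < t.+1) gamma s ^+ 2 * dual_norm Ny (Gy (x s) (e s)) ^+ 2
      + 2 * My ^+ 2 * \sum_(s < t.+1) gamma s ^+ 2)); last by rewrite lerD2r ler_pM2l.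
  rewrite !mulr_sumr -big_split /=; apply: ler_sum => s _.
  have st : (s <= t)%N by rewrite -ltnS.
  rewrite dual_normZ// exprMn.
  have := dual_normD nNy (gy (x s)) (- Gy (x s) (e s)); rewrite dual_normN//.
  have := gy_tail soec nNy lt (Xx st).
  have := dual_norm_ge0 nNy (gy (x s) - Gy (x s) (e s)).
  have := dual_norm_ge0 nNy (gy (x s)).
  have := dual_norm_ge0 nNy (Gy (x s) (e s)).
  move: (dual_norm Ny (gy (x s) - _)) (dual_norm Ny (gy (x s))) (dual_norm Ny _).
  move=> a b c c0 b0 a0 bM abc.
  have : a ^+ 2 <= 2 * c ^+ 2 + 2 * My ^+ 2.
    have : a ^+ 2 <= (My + c) ^+ 2 by rewrite ler_sqr ?nnegrE//; lra.
    by have := sqr_ge0 (My - c); lra.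
  by move=> /(ler_wpM2l (sqr_ge0 (gamma s))); lra.
(* The noise at the vertex is split at v_s: the difference is the dual averaging regret, the rest a
   scalar martingale. *)
have h4 : \sum_(s < t.+1) gamma s * dot (gy (x s)) y' =
    \sum_(s < t.+1) gamma s * dot (Gy (x s) (e s)) y'
    + \sum_(s < t.+1) dot (gamma s *: (gy (x s) - Gy (x s) (e s))) (y' - v s)
    + \sum_(s < t.+1) gamma s * (dot (gy (x s)) (v s) - dot (Gy (x s) (e s)) (v s)).
  by rewrite -!big_split /=; apply: eq_bigr => s _; rewrite dotZl dotBr !dotBl; ring.
have h5 : Dy ^+ 2 / ay * dn <= Dy ^+ 2 / ay * (2 * sy + 2 * My ^+ 2 * \sum_(s < t.+1) gamma s ^+ 2).
  by rewrite ler_wpM2l ?divr_ge0 ?sqr_ge0 ?(ltW ay0).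
rewrite -(ler_pM2l S0) mulrDr (mulrCA S B) divff ?mulr1 ?gt_eqF//.
by rewrite /B -/Dy; move: h1 h2 h3 h4 h5 q2P; rewrite -/Dy; lra.
Qed.

End Pathwise.

(** * The exceptional events *)

Section Events.
Context {R : realType} {d m : nat} {q : 'I_m.+1 -> nat}.
Variables (X : set 'rV[R]_d) (mu : probability (samples R q) R)
  (F : forall i : 'I_m.+1, 'rV[R]_d -> 'rV[R]_(q i) -> R) (rc : 'I_m -> R)
  (F' : forall i : 'I_m.+1, 'rV[R]_d -> 'rV[R]_(q i) -> 'rV[R]_d)
  (Xi : forall i : 'I_m.+1, set 'rV[R]_(q i)) (r : R).
Variables (Nx : 'rV[R]_d -> R) (Ny : 'rV[R]_m.+1 -> R) (Mx My Q : R).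
Variables (wx : 'rV[R]_d -> R) (gradx : 'rV[R]_d -> 'rV[R]_d) (ax : R)
  (wy : 'rV[R]_m.+1 -> R) (grady : 'rV[R]_m.+1 -> 'rV[R]_m.+1) (ay : R).
Hypotheses (soec : soec_assumptions X mu F rc Xi) (nNx : is_norm Nx) (nNy : is_norm Ny).
Hypotheses (dgx : is_dgf Nx X wx gradx ax) (dgy : is_dgf Ny (simplex m.+1) wy grady ay).
Hypotheses (exminx : exists x, is_argmin X wx x) (exmaxx : exists x, is_argmax X wx x)
  (exminy : exists y, is_argmin (simplex m.+1) wy y)
  (exmaxy : exists y, is_argmax (simplex m.+1) wy y).
Let Dx := dgf_diam X wx.
Let Dy := dgf_diam (simplex m.+1) wy.
Hypotheses (Dx0 : 0 < Dx) (Dy0 : 0 < Dy).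
Hypothesis (lt : light_tail X mu F rc F' Xi r Nx Ny Mx My Q).
Context {dO : measure_display} {Om : measurableType dO} {P : probability Om R}.
Variable xi : nat -> {RV P >-> samples R q}.
Hypothesis iid_xi : iid mu xi.
Variables (gamma : nat -> R) (N : nat) (z : nat -> Om -> 'rV[R]_d * 'rV[R]_m.+1).
Hypothesis gamma0 : forall s, 0 < gamma s.
Hypothesis run : is_OVSMD_run X F rc F' wx gradx wy grady r gamma N xi z.

Local Notation Y := (simplex m.+1).
Local Notation Gy := (Gy F rc r).
Local Notation gy := (gy mu F rc r).
Local Notation Gx := (Gx F').
Local Notation gx := (gx mu F').
Let cy : R := (2 * Dy ^+ 2)^-1.

Lemma holds_all_in_support E t : measurable E -> mu (~` E) = 0%E ->
  holds_up_to P 0 (@all_in_support _ _ _ E _ _ _ xi t).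
Proof.
move=> mE muE; elim: t => [|t IH].
  by exists set0; split=> //; rewrite measure0.
have ht : holds_up_to P 0 (fun o => E (xi t o)).
  exists (xi t @^-1` ~` E); split=> [||o /= /contrapT//].
    by apply: measurable_preimage_RV; exact: measurableC.
  by case: iid_xi => /(_ t _ (measurableC mE)) + _; rewrite muE /distribution /pushforward => ->.
apply: holds_up_to_le (holds_up_to_and IH ht); first by rewrite addr0.
by move=> o [h1 h2] k; rewrite ltnS leq_eqVlt => /predU1P[->//|]; exact: h1.
Qed.

(** The choice is harmless for measurability, the minimizer being unique and Lipschitz in [l]. *)
Definition argmin_sel (l : 'rV[R]_m.+1) : 'rV[R]_m.+1 :=
  projT1 (cid (argmin_exists dgy exminy l simplex_compact)).

Lemma argmin_selP l : is_argmin Y (fun y => dot l y + cy * wy y) (argmin_sel l).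
Proof. by rewrite /argmin_sel; case: cid. Qed.

Definition noise (k : nat) (o : Om) : 'rV[R]_m.+1 :=
  gamma k *: (gy (z k o).1 - Gy (z k o).1 (xi k o)).

Definition averaged (s : nat) (o : Om) := argmin_sel (- \sum_(k < s) noise k o).

(** All five bounds are proved for the stopped process with [Gycut], and read on the run where every
    sample lies in [E]; that event has probability one and adds 0 to the budget. *)
Lemma run_events (u : 'rV[R]_d) (B W L : R) t : (t <= N)%N -> X u ->
  0 < B -> (forall x', X x' -> Nx (x' - u) * Mx <= B) -> 0 < W -> L <= W ^+ 2 / 8 ->
  let V := \sum_(s < t.+1) gamma s ^+ 2 in
  holds_up_to P (5 * expR (- L)) (fun o => [/\
    \sum_(s < t.+1) gamma s * (dot (Gy (z s o).1 (xi s o)) (z s o).2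
       - dot (gy (z s o).1) (z s o).2) <= W * Q * Num.sqrt V,
    \sum_(s < t.+1) gamma s * (dot (gy (z s o).1) (averaged s o)
       - dot (Gy (z s o).1 (xi s o)) (averaged s o)) <= W * Q * Num.sqrt V,
    \sum_(s < t.+1) gamma s * (dot (gx (z s o).1 (z s o).2) ((z s o).1 - u)
       - dot (Gx (z s o).1 (z s o).2 (xi s o)) ((z s o).1 - u)) <= W * (2 * B) * Num.sqrt V,
    \sum_(s < t.+1) gamma s ^+ 2 * dual_norm Nx (Gx (z s o).1 (z s o).2 (xi s o)) ^+ 2
      <= (1 + L) * Mx ^+ 2 * V
  & \sum_(s < t.+1) gamma s ^+ 2 * dual_norm Ny (Gy (z s o).1 (xi s o)) ^+ 2
      <= (1 + L) * My ^+ 2 * V]).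
Proof.
move=> tN Xu B0 NB W0 LW V.
have [E [mE muE EXi]] := full_support soec.
pose st s (o : history xi s) := stopped E N z o.
pose x s (o : history xi s) := (st s o).1.
pose y s (o : history xi s) := (st s o).2.
have mst s := measurable_stopped soec nNx nNy dgx dgy exminx exmaxx exminy exmaxy
   Dx0 Dy0 lt mE EXi run s.
have mx s : rV_measurable setT (x s) := proj1 (mst s).
have my s : rV_measurable setT (y s) := proj2 (mst s).
have Xx s o : X (x s o).
  exact: (stopped_X soec nNx nNy dgx dgy exminx exmaxx exminy exmaxy Dx0 Dy0 E run).
have Yy s o : Y (y s o).
  exact: (stopped_Y soec nNx nNy dgx dgy exminx exmaxx exminy exmaxy Dx0 Dy0 E run).
pose nz k (o : Om) := gamma k *: (gy (x k o) - Gycut F rc r E (x k o) (xi k o)).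
(* Built from the stopped points and [Gycut], hence measurable on [history xi s]; it coincides with
   [averaged] on the good event. *)
pose v s (o : history xi s) := argmin_sel (- \sum_(k < s) nz k o).
have Yv s o : Y (v s o) by case: (argmin_selP (- \sum_(k < s) nz k o)).
have mv s : rV_measurable setT (v s).
  apply: (rV_measurable_argmin nNy simplex_segment dgy Dy0 measurableT
    (f := fun o : history xi s => - \sum_(k < s) nz k o)); last first.
    by move=> o _; exact: argmin_selP.
  move=> j; rewrite (_ : (fun _ => _) = (fun o : history xi s => - \sum_(k < s) gamma k *
      (gy (x k o) 0 j - Gycut F rc r E (x k o) (xi k o) 0 j))); last first.
    apply/funext => o; rewrite !mxE summxE; congr (- _); apply: eq_bigr => k _.
    by rewrite !mxE.
  apply: measurableT_comp => //; apply: measurable_sum => k.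
  apply: measurable_funM => //; apply: measurable_funB.
    exact: (measurableT_comp (rV_measurable_gy r soec mE muE EXi (mx k) (Xx k) j)
      (measurable_history_le (xi := xi) (ltnW (ltn_ord k)))).
  exact: (measurableT_comp (rV_measurable_Gycut r soec mE EXi (mx k) (Xx k) j)
    (measurable_history_pair (xi := xi) (ltn_ord k))).
have eL : expR (- (W ^+ 2 / 8)) <= expR (- L) by rewrite ler_expR lerN2.
have t0 : (0 < t.+1)%N by [].
have h0 := holds_all_in_support t.+1 mE muE.
have h1 := Phi_martingale_tail soec lt mE muE EXi iid_xi gamma0 mx Xx my Yy
  (expr1n R 2) W0 t0.
have h2 := Phi_martingale_tail soec lt mE muE EXi iid_xi gamma0 mx Xx mv Yv
  (c := -1) (etrans (sqrrN 1) (expr1n R 2)) W0 t0.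
have h3 := Gx_martingale_tail soec nNx lt iid_xi gamma0 mx Xx my Yy Xu B0 NB W0 t0.
have Mx0 := lt_Mx_gt0 lt; have My0 := lt_My_gt0 lt.
have h4 : holds_up_to P (expR (- L)) (fun o => \sum_(s < t.+1) gamma s ^+ 2 *
   (dual_norm Nx (Gx (x s o) (y s o) (xi s o)) ^+ 2 / Mx ^+ 2) <= (1 + L) * V).
  apply: (square_tail iid_xi gamma0 (a := fun s (p : history xi s * samples R q) =>
     dual_norm Nx (Gx (x s p.1) (y s p.1) p.2) ^+ 2 / Mx ^+ 2)) => // s.
    apply: measurable_funM => //; apply: measurable_funX; apply: measurable_dual_norm => //.
    exact: (rV_measurable_Gx soec lt (mx s) (Xx s) (my s)).
  by move=> o; exact: (lt_Gx_tail lt (Xx s o) (Yy s o)).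
have h5 : holds_up_to P (expR (- L)) (fun o => \sum_(s < t.+1) gamma s ^+ 2 *
   (dual_norm Ny (Gycut F rc r E (x s o) (xi s o)) ^+ 2 / My ^+ 2) <= (1 + L) * V).
  apply: (square_tail iid_xi gamma0 (a := fun s (p : history xi s * samples R q) =>
     dual_norm Ny (Gycut F rc r E (x s p.1) p.2) ^+ 2 / My ^+ 2)) => // s.
    apply: measurable_funM => //; apply: measurable_funX; apply: measurable_dual_norm => //.
    exact: (rV_measurable_Gycut r soec mE EXi (mx s) (Xx s)).
  move=> o; apply: le_trans (lt_Gy_tail lt (Xx s o)).
  rewrite le_eqVlt; apply/orP; left; apply/eqP; apply: (integral_eq_on_full mE muE).
  - do 2 apply: measurableT_comp => //.
    apply: measurable_funM => //; apply: measurable_funX; apply: measurable_dual_norm => //.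
    exact: (measurable_Gycut r soec mE (Xx s o)).
  - do 2 apply: measurableT_comp => //.
    apply: measurable_funM => //; apply: measurable_funX; apply: measurable_dual_norm => //.
    exact: (measurable_Gy r soec (Xx s o)).
  - by move=> e Ee; rewrite GycutE.
have h := holds_up_to_and h0 (holds_up_to_and h1 (holds_up_to_and h2
  (holds_up_to_and h3 (holds_up_to_and h4 h5)))).
apply: holds_up_to_le h; first by move: eL; move: (expR _) (expR _) => e1 e2; lra.
move=> o [so [{}h1 [{}h2 [{}h3 [{}h4 {}h5]]]]].
have stE (s : nat) : (s <= t)%N -> st s o = z s o.
  move=> s_t; apply: stoppedE; first exact: leq_trans tN.
  by move=> k ks; apply: so; exact: leq_trans ks (leqW s_t).
have xE (s : 'I_t.+1) : x s o = (z s o).1 by rewrite /x stE// -ltnS.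
have yE (s : 'I_t.+1) : y s o = (z s o).2 by rewrite /y stE// -ltnS.
have GE (s : 'I_t.+1) : Gycut F rc r E (x s o) (xi s o) = Gy (z s o).1 (xi s o).
  by rewrite xE GycutE//; exact: so.
have vE (s : 'I_t.+1) : v s o = averaged s o.
  rewrite /v /averaged; congr (argmin_sel (- _)); apply: eq_bigr => k _.
  have kt : (k < t.+1)%N by exact: leq_trans (ltn_ord k) (ltnW (ltn_ord s)).
  by rewrite /nz /noise -(GE (Ordinal kt)) -(xE (Ordinal kt)).
split.
- apply: ltW; apply: le_lt_trans h1; apply: ler_sum => s _.
  by rewrite mul1r GE xE yE.
- apply: ltW; apply: le_lt_trans h2; apply: ler_sum => s _.
  by rewrite GE xE vE mulN1r mulNr -mulrN opprB.
- apply: ltW; apply: le_lt_trans h3; apply: ler_sum => s _.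
  by rewrite xE yE.
- rewrite mulrAC -ler_pdivrMr ?exprn_gt0// mulr_suml; apply: le_trans h4.
  by apply: ler_sum => s _; rewrite xE yE mulrA.
- rewrite mulrAC -ler_pdivrMr ?exprn_gt0// mulr_suml; apply: le_trans h5.
  by apply: ler_sum => s _; rewrite GE mulrA.
Qed.

End Events.

(** * From the good event to the iteration bound *)

Theorem theorem2 (R : realType) (d m : nat) (q : 'I_m.+1 -> nat)
    (* the problem *)
    (X : set 'rV[R]_d) (Xi : forall i : 'I_m.+1, set 'rV[R]_(q i))
    (mu : probability (samples R q) R)
    (F : forall i : 'I_m.+1, 'rV[R]_d -> 'rV[R]_(q i) -> R) (rc : 'I_m -> R)
    (F' : forall i : 'I_m.+1, 'rV[R]_d -> 'rV[R]_(q i) -> 'rV[R]_d)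
    (* the geometry *)
    (Nx : 'rV[R]_d -> R) (Ny : 'rV[R]_m.+1 -> R)
    (wx : 'rV[R]_d -> R) (gradx : 'rV[R]_d -> 'rV[R]_d) (ax : R)
    (wy : 'rV[R]_m.+1 -> R) (grady : 'rV[R]_m.+1 -> 'rV[R]_m.+1) (ay : R)
    (* the light-tail and accuracy parameters *)
    (Mx My Q r eps delta : R)
    (* the samples and the run, with iteration limit N *)
    (dO : measure_display) (Om : measurableType dO) (P : probability Om R)
    (xi : nat -> {RV P >-> samples R q})
    (N : nat) (z : nat -> Om -> 'rV[R]_d * 'rV[R]_m.+1) :
  let Dx := dgf_diam X wx in
  let Dy := dgf_diam (simplex m.+1) wy in
  let M := ovsmd_M Dx Dy ax ay Mx My in
  let gamma := fun t : nat => 1 / (M * Num.sqrt t.+1%:R) in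
  let xb := xbar gamma z in
  let u := uhat F rc r gamma xi z in
  soec_assumptions X mu F rc Xi ->
  is_norm Nx -> is_norm Ny ->
  is_dgf Nx X wx gradx ax -> is_dgf Ny (simplex m.+1) wy grady ay ->
  (exists x, is_argmin X wx x) -> (exists x, is_argmax X wx x) ->
  (exists y, is_argmin (simplex m.+1) wy y) ->
  (exists y, is_argmax (simplex m.+1) wy y) ->
  0 < Dx -> 0 < Dy ->
  light_tail X mu F rc F' Xi r Nx Ny Mx My Q ->
  fstar X mu F rc < r -> 0 < eps -> 0 < delta < 1 ->
  iid mu xi ->
  is_OVSMD_run X F rc F' wx gradx wy grady r gamma N xi z ->
  (forall t : nat, (t <= N)%N -> iteration_bound Q M delta eps <= t%:R ->
    with_prob_ge P (1 - delta)
      [set o | Plevel mu F rc r (xb t o) - H X mu F rc r <= eps /\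
               `|u t o - H X mu F rc r| <= eps]) /\
  (iteration_bound Q M delta eps <= N%:R ->
    is_stochastic_oracle X mu F rc P r eps delta (u N) (xb N)).
Proof.
move=> Dx Dy M gamma xb u soec nNx nNy dgx dgy exminx exmaxx exminy exmaxy Dx0 Dy0
  lt _ eps0 /andP[delta0 delta1] iid_xi run.
have ax0 := dgf_modulus_gt0 dgx; have ay0 := dgf_modulus_gt0 dgy.
have Mx0 := lt_Mx_gt0 lt; have My0 := lt_My_gt0 lt; have Q0 := lt_Q_gt0 lt.
set mx := 2 * Dx ^+ 2 / ax * Mx ^+ 2; set my := 2 * Dy ^+ 2 / ay * My ^+ 2.
have mx0 : 0 < mx by rewrite mulr_gt0 ?exprn_gt0// divr_gt0// mulr_gt0// exprn_gt0.
have my0 : 0 < my by rewrite mulr_gt0 ?exprn_gt0// divr_gt0// mulr_gt0// exprn_gt0.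
have M0 : 0 < M by rewrite sqrtr_gt0 addr_gt0.
have M2 : M ^+ 2 = mx + my by rewrite sqr_sqrtr// addr_ge0// ltW.
clearbody M.
have gamma0 s : 0 < gamma s by rewrite divr_gt0// mulr_gt0// sqrtr_gt0.
set W := Omega delta; set L := ln (24 / delta).
have L0 : 0 < L by rewrite ln_gt0// ltr_pdivlMr//; lra.
(* Both branches of the maximum in [Omega] are used: this one for the terms linear in L, the square
   root one for L <= W^2/8, where 12 leaves room over 8. *)
have LW : 4 / 3 * L <= W by rewrite /W /Omega le_max lexx orbT.
have W0 : 0 < W by apply: lt_le_trans LW; rewrite mulr_gt0.
have W2 : L <= W ^+ 2 / 8.
  have : Num.sqrt (12 * L) <= W by rewrite /W /Omega le_max lexx.
  rewrite -ler_sqr ?nnegrE ?sqrtr_ge0 ?(ltW W0)// sqr_sqrtr ?mulr_ge0 ?(ltW L0)//; lra.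
(* Five events then cost 5 delta/24, less than delta. *)
have eL : expR (- L) = delta / 24.
  by rewrite expRN lnK ?posrE ?divr_gt0// invf_div.
have [us Xus [Hus minus]] := H_argmin r soec.
have sX : segment_closed X by apply: convex_set_segment; exact: soec_convex soec.
(* The squared diameter bound 8 Dx^2/ax times Mx^2 equals 4 [mx], at most 4 M^2. *)
have NB x' : X x' -> Nx (x' - us) * Mx <= 2 * M.
  move=> Xx'; rewrite -ler_sqr ?nnegrE ?mulr_ge0 ?(ltW M0) ?(ltW Mx0) ?is_norm_ge0//.
  have := dgf_diam_norm nNx sX dgx exminx exmaxx Dx0 Xx' Xus; rewrite -/Dx => h.
  rewrite !exprMn M2.
  apply: (@le_trans _ _ (8 * Dx ^+ 2 / ax * Mx ^+ 2)); first by rewrite ler_pM2r ?exprn_gt0.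
  by have := my0; rewrite /mx; lra.
have main t : (t <= N)%N -> iteration_bound Q M delta eps <= t%:R ->
    with_prob_ge P (1 - delta)
      [set o | Plevel mu F rc r (xb t o) - H X mu F rc r <= eps /\
               `|u t o - H X mu F rc r| <= eps].
  move=> tN; rewrite /iteration_bound -/W ge_max => /andP[t6 tT].
  have {}t6 : (6 <= t)%N by rewrite -(ler_nat R).
  have M20 : 0 < 2 * M by rewrite mulr_gt0.
  have := run_events soec nNx nNy dgx dgy exminx exmaxx exminy exmaxy Dx0 Dy0 lt iid_xi
    gamma0 run tN Xus M20 NB W0 W2.
  set V := \sum_(s < t.+1) gamma s ^+ 2; cbv zeta => ev.
  apply: holds_up_to_with_prob_ge; apply: holds_up_to_le ev; first by rewrite eL; lra.
  move=> o [e1 e2 e3 e4 e5].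
  set h := \sum_(s < t.+1) (s.+1%:R : R)^-1.
  have hV : V = h / M ^+ 2.
    rewrite /V /h mulr_suml; apply: eq_bigr => s _.
    rewrite /gamma div1r exprVn exprMn sqr_sqrtr// invfM mulrC//.
  have h0 : 0 <= h by apply: sumr_ge0.
  have sV : Num.sqrt V = Num.sqrt h / M.
    rewrite hV sqrtrM// sqrtrV ?sqr_ge0// sqrtr_sqr gtr0_norm//.
  set S := \sum_(s < t.+1) gamma s.
  have S0 : 0 < S by rewrite /S big_ord_recl ltr_pwDl// sumr_ge0// => s _; exact: ltW.
  have SM : Num.sqrt t.+1%:R <= M * S.
    apply: le_trans (sum_invsqrt_ge t) _; rewrite /S mulr_sumr; apply: ler_sum => s _.
    by rewrite /gamma div1r invfM mulrA divff ?mul1r ?gt_eqF.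
  have vmin s := argmin_selP dgy exminy (- \sum_(k < s) noise mu F rc r xi gamma z k o).
  have Yv s : simplex m.+1 (averaged mu F rc r dgy exminy xi gamma z s o) by case: (vmin s).
  have up := uhat_le soec nNx nNy dgx dgy exminx exmaxx exminy exmaxy Dx0 Dy0 lt gamma0 run
    tN Xus Yv Hus e1 e3 e4 e5.
  have down := Plevel_le_uhat soec nNx nNy dgx dgy exminx exmaxx exminy exmaxy Dx0 Dy0 lt
    gamma0 run tN Xus Hus vmin e1 e2 e3 e4 e5.
  have Hle : H X mu F rc r <= Plevel mu F rc r (xb t o).
    rewrite Hus; apply: minus.
    exact: (xbar_in soec nNx nNy dgx dgy exminx exmaxx exminy exmaxy Dx0 Dy0 gamma0 run o tN).
  move: up down; rewrite -/(xb t o) -/(u t o) -/S -/V -/Dx -/Dy.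
  set A := (_ + _ + _ + _ + _ : R); set B := (_ + _ + _ : R) => up down.
  have sh0 : 0 <= Num.sqrt h by exact: sqrtr_ge0.
  have V0 : 0 <= V by rewrite hV divr_ge0// sqr_ge0.
  (* [mx] and [my] are the two parts of M^2, so the block sums of squares add up to the harmonic sum
     h. *)
  have hVM : h = mx * V + my * V by rewrite -mulrDl -M2 hV mulrC divfK// gt_eqF// exprn_gt0.
  have mxV : 0 <= mx * V by rewrite mulr_ge0// ltW.
  have myV : 0 <= my * V by rewrite mulr_ge0// ltW.
  have q0 : 0 <= W * Q * (Num.sqrt h / M).
    by apply: mulr_ge0; [apply: mulr_ge0; exact: ltW|apply: divr_ge0 => //; exact: ltW].
  have p0 : 0 <= W * Num.sqrt h by rewrite mulr_ge0// ltW.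
  (* The last term is the gradient martingale W (2 B) sqrt V with B = 2 M and sqrt V = sqrt h /
     M. *)
  have AE : A = 1 + (1 + L) / 2 * h + W * Q * (Num.sqrt h / M) + 4 * (W * Num.sqrt h).
    by rewrite /A sV hVM /mx /my; field; rewrite !gt_eqF.
  have BE : B = 1 / 2 + (2 + L) * (my * V) + W * Q * (Num.sqrt h / M).
    by rewrite /B sV /my; field; rewrite !gt_eqF.
  have Lh : 0 <= L * h by rewrite mulr_ge0// ltW.
  have LmyV : 0 <= L * (my * V) by rewrite mulr_ge0// ltW.
  have LmxV : 0 <= L * (mx * V) by rewrite mulr_ge0// ltW.
  have A0 : 0 <= A by rewrite AE; lra.
  have B0 : 0 <= B by rewrite BE; lra.
  (* Since [my * V <= h], the coefficients of h add up to at most 5/2 + 3/2 L, as in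
     [rate_bound]. *)
  have AB : (A + B) / S <= eps.
    rewrite ler_pdivrMr// -(ler_pM2l M0) mulrCA.
    apply: le_trans (ler_wpM2l (ltW eps0) SM).
    apply: le_trans (rate_bound Q0 M0 (ltW L0) W0 LW eps0 t6 tT h0 (harmonic_le_ln t)).
    rewrite ler_pM2l// AE BE.
    have Lh2 : L * h = L * (mx * V) + L * (my * V) by rewrite hVM mulrDr.
    lra.
  have AS : 0 <= A / S by rewrite divr_ge0// ltW.
  have BS : 0 <= B / S by rewrite divr_ge0// ltW.
  (* From H <= P <= u + B/S and u <= H + A/S: P - H is at most (A + B)/S, and u - H lies between
     -B/S and A/S. *)
  move: AB; rewrite mulrDl => AB; rewrite ler_norml.
  by split; [|apply/andP; split]; lra.
split=> // NT; split; last exact: main.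
move=> o; exact: (xbar_in soec nNx nNy dgx dgy exminx exmaxx exminy exmaxy Dx0 Dy0
  gamma0 run o (leqnn N)).
Qed.
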